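(* Let $H:V\times V\to\mathbb R$ satisfy the following four conditions. (i) (Periodicity) $H(x+z,p)=H(x,p)$ for all $x,p\in V$, $z\in\Lambda$. (ii) (Rearrangement invariance) $H(x\circ g,p\circ g)=H(x,p)$ for all $x,p\in V$, $g\in\mathcal G$. (iii) (Local Lipschitz continuity) There is $L_x>0$ such that $|H(x,p)-H(y,p)|\le L_x(1+\|p\|)\|x-y\|$ for all $x,y,p\in V$; and for every $R>0$ there is $L_R>0$ such that $|H(x,p)-H(x,q)|\le L_R\|p-q\|$ for all $x\in V$ and all $p,q\in V$ in the ball $B_V(0,R)$. (iv) (Coercivity) $\lim_{\|p\|\to\infty}\inf_{x\in V}H(x,p)=+\infty$. Let $u_0:V\to\mathbb R$ satisfy $u_0(x)=u_0(Mx)$ for all $x\in V$ and $u_0\in C^1_b(V)$. For each $\varepsilon>0$ let $u^\varepsilon:V\times[0,\infty)\to\mathbb R$ be the unique bounded uniformly continuous viscosity solution of $$u^\varepsilon_t+H\left(\tfrac{x}{\varepsilon},Du^\varepsilon\right)=0\ \text{ in }V\times(0,\infty),\qquad u^\varepsilon(x,0)=u_0(x)\ \text{ on }V.$$ Let $\overline H:\mathbb R^d\to\mathbb R$ be the effective Hamiltonian of $H$, and let $\widetilde u:\mathbb R^d\times[0,\infty)\to\mathbb R$ be the unique viscosity solution of $$\widetilde u_t+\overline H(D\widetilde u)=0\ \text{ in }\mathbb R^d\times(0,\infty),\qquad \widetilde u(q,0)=u_0(q\chi_I)\ \text{ on }\mathbb R^d.$$ Then for every $T>0$ there exists $C_T>0$,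 independent of $\varepsilon$, such that for every $\varepsilon>0$ $$\sup_{(x,t)\in V\times[0,T]}\left|u^\varepsilon(x,t)-\widetilde u(\mathfrak m(x),t)\right|\le C_T\,\varepsilon^{1/3}.$$
   Context: Fix $d\ge1$. $I=[0,1]^d$, $\lambda_0$ is Lebesgue measure on $I$, $V=L^2(I;\mathbb R^d)$ with its Hilbert norm $\|\cdot\|$; $V^*$ is identified with $V$ by Riesz, so Fréchet derivatives $Du$ are elements of $V$. $\Lambda=L^2(I;\mathbb Z^d)=\{z\in V: z(i)\in\mathbb Z^d\text{ for a.e. }i\}$. $\mathcal G$ is the group of bijections $g:I\to I$ with $g,g^{-1}$ Borel measurable and $g_\#\lambda_0=(g^{-1})_\#\lambda_0=\lambda_0$. For $q\in\mathbb R^d$, $q\chi_I\in V$ is the constant function $q$. $\mathfrak m(x)=\int_I x\,d\lambda_0\in\mathbb R^d$ and $Mx=\mathfrak m(x)\chi_I\in V$. $C^1_b(V)$ is the space of bounded, continuously Fréchet differentiable functions $V\to\mathbb R$ with bounded derivative. Effective Hamiltonian: for $p\in\mathbb R^d$, $\overline H(p)$ is the unique constant $c\in\mathbb R$ such that the cell problem $H(y,p\chi_I+Dv(y))=c$ in $V$ admits a viscosity solution $v:V\to\mathbb R$ that is Lipschitz, $\Lambda$-periodic ($v(y+z)=v(y)$ for $z\in\Lambda$) and $\mathcal G$-invariant ($v(y\circ g)=v(y)$ for $g\in\mathcal G$). Viscosity solutions are continuous functions and are understood with $C^1$ (Fréchet) test functions: $w$ is a subsolution (supersolution) if whenever $w-\varphi$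 has a local maximum (minimum) at an interior point, the equation with the derivatives of $\varphi$ inserted at that point holds with $\le0$ ($\ge0$); a solution is both. For the Cauchy problems, ''bounded uniformly continuous'' means bounded and uniformly continuous on $V\times[0,T]$ for each finite $T>0$, and uniqueness of $\widetilde u$ is in the class of functions bounded and uniformly continuous on $\mathbb R^d\times[0,T]$ for each $T>0$. *)

(* Defs.v *)
From HB Require Import structures.
From mathcomp Require Import all_boot all_order all_algebra.
From mathcomp Require Import archimedean ring_quotient generic_quotient ring lra.
From mathcomp Require Import all_classical all_reals all_analysis.
From mathcomp Require Import measurable_realfun measurable_fun_approximation.

Set Implicit Arguments.
Unset Strict Implicit.
Unset Printing Implicit Defensive.

Import Order.TTheory GRing.Theory Num.Theory.
Import numFieldNormedType.Exports.

Local Open Scope classical_set_scope.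
Local Open Scope ring_scope.
Local Open Scope quotient_scope.

Section unit_interval.
Context (R : realType).

Definition unitI : Type := {x : R | 0 <= x <= 1}.

HB.instance Definition _ := Choice.on unitI.
HB.instance Definition _ :=
  isPointed.Build unitI (exist _ 0 (introT andP (conj (lexx 0) ler01))).
HB.instance Definition _ :=
  Measurable.copy unitI (g_sigma_algebra_preimageType (val : unitI -> R)).

Lemma measurable_unitI_image (A : set unitI) :
  measurable A -> measurable [set val x | x in A].
Proof.
move=> [B mB <-]; rewrite setTI.
rewrite (_ : [set _ | _ in _] = B `&` `[0, 1]%classic).
  by apply: measurableI => //; exact: measurable_itv.
apply/seteqP; split => [_ [x Bx <-]|x [Bx /=]]; rewrite /= in_itv/=.
  by split => //; exact: (valP x).
by move=> x01; exists (exist _ x x01).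
Qed.

(* Lebesgue measure restricted to [0,1], carried to the subtype. *)
Definition lebesgue_unitI (A : set unitI) : \bar R :=
  lebesgue_measure [set val x | x in A].

Let lebesgue_unitI0 : lebesgue_unitI set0 = 0%E.
Proof. by rewrite /lebesgue_unitI image_set0 measure0. Qed.

Let lebesgue_unitI_ge0 A : (0 <= lebesgue_unitI A)%E.
Proof. exact: measure_ge0. Qed.

Let lebesgue_unitI_sigma_additive : semi_sigma_additive lebesgue_unitI.
Proof.
move=> F mF tF mUF; rewrite /lebesgue_unitI image_bigcup.
apply: measure_semi_sigma_additive.
- by move=> n; exact: measurable_unitI_image.
- apply/trivIsetP => i j _ _ ij; apply/seteqP; split => // _ [[x Fx <-] [y Fy]].
  move=> /val_inj yx; rewrite yx in Fy.
  have : (F i `&` F j) x by split.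
  by move/trivIsetP : tF => /(_ i j Logic.I Logic.I ij) ->.
- by rewrite -image_bigcup; exact: measurable_unitI_image.
Qed.

HB.instance Definition _ := isMeasure.Build _ _ _ lebesgue_unitI
  lebesgue_unitI0 lebesgue_unitI_ge0 lebesgue_unitI_sigma_additive.

Let lebesgue_unitI_setT : lebesgue_unitI setT = 1%E.
Proof.
rewrite /lebesgue_unitI (_ : [set _ | _ in _] = `[0, 1]%classic).
  by rewrite lebesgue_measure_itv/= lte_fin ltr01 oppr0 adde0.
apply/seteqP; split => [_ [x _ <-]|x]; rewrite /= in_itv/=.
  exact: (valP x).
by move=> x01; exists (exist _ x x01).
Qed.

HB.instance Definition _ :=
  Measure_isProbability.Build _ _ _ lebesgue_unitI lebesgue_unitI_setT.

End unit_interval.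

(* [0,1]^d with the product sigma-algebra and the d-fold product of Lebesgue
   measure on [0,1]. *)
Section cube.
Context (R : realType).

Definition cube (d : nat) : Type := d.-tuple (unitI R).

HB.instance Definition _ d := Measurable.on (cube d).

Definition cube_cons (d : nat) (p : unitI R * cube d) : cube d.+1 :=
  [the d.+1.-tuple (unitI R) of p.1 :: p.2].

Let measurable_cube_cons d : measurable_fun setT (@cube_cons d).
Proof. exact: measurable_cons. Qed.

HB.instance Definition _ d :=
  isMeasurableFun.Build _ _ _ _ (@cube_cons d) (@measurable_cube_cons d).

Fixpoint lebesgue_cube (d : nat) : probability (cube d) R :=
  if d is d'.+1
  then distribution
         [the probability _ _ of (@lebesgue_unitI R \x lebesgue_cube d')%E]
         [the {mfun _ >-> _} of @cube_cons d']
  else dirac ([tuple] : cube 0).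

End cube.

Lemma lebesgue_cube_box (R : realType) n (A : 'I_n -> set (unitI R)) :
  (forall j, measurable (A j)) ->
  lebesgue_cube R n [set i | forall j, A j (tnth i j)] =
    (\prod_(j < n) lebesgue_unitI (A j))%E.
Proof.
elim: n A => [A _|n IH A mA].
  rewrite big_ord0 /= diracE mem_set//=.
  by case.
have mB : measurable [set i : cube R n | forall j, A (lift ord0 j) (tnth i j)].
  rewrite (_ : [set _ | _] =
      \bigcap_j ((fun i : cube R n => tnth i j) @^-1` A (lift ord0 j))); last first.
    by apply/seteqP; split => i /= h j => [_|]; exact: h.
  apply: fin_bigcap_measurable => // j _.
  by rewrite -[X in measurable X]setTI; exact: measurable_tnth.
rewrite big_ord_recl -IH// -product_measure1E//.
rewrite /= /distribution /pushforward; congr ((_ \x _)%E _).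
apply/seteqP; split => [[a i] /= h|[a i] /= [a0 h] j].
  split; first exact: (h ord0).
  by move=> j; have := h (lift ord0 j); rewrite tnthS.
by case: (unliftP ord0 j) => [k|] ->; rewrite ?tnthS//; exact: h.
Qed.

Section square_integrable_functions.
Context (R : realType) (d : nat).
Local Notation lam := (lebesgue_cube R d).

Definition square_integrable : {pred cube R d -> 'rV[R]_d} :=
  fun f => `[< forall j, (fun i => f i ord0 j) \in Lfun lam 2%:E >].

Lemma square_integrable_submod_closed : submod_closed square_integrable.
Proof.
have [L0 LD] := Lfun_submod_closed lam (lee1n 2).
split.
  apply/asboolP => j; rewrite (_ : (fun _ => _) = 0) //.
  by apply/funext => i; rewrite mxE.
move=> a f g /asboolP fL /asboolP gL; apply/asboolP => j.
rewrite (_ : (fun _ => _) =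
    a *: (fun i => f i ord0 j) + (fun i => g i ord0 j)).
  exact: LD.
by apply/funext => i; rewrite !mxE.
Qed.

HB.instance Definition _ := GRing.isSubmodClosed.Build _ _ square_integrable
  square_integrable_submod_closed.

Record L2fun := MkL2fun {
  L2fun_val :> cube R d -> 'rV[R]_d;
  _ : L2fun_val \in square_integrable }.

HB.instance Definition _ := [isSub for L2fun_val].
HB.instance Definition _ := [Choice of L2fun by <:].
HB.instance Definition _ := [SubChoice_isSubLmodule of L2fun by <:].

Definition ae_zero : {pred L2fun} :=
  fun f => `[< {ae lam, forall i, f i = 0} >].

Lemma ae_zero_zmod_closed : zmod_closed ae_zero.
Proof.
split; first by apply/asboolP; apply: nearW.
move=> f g /asboolP f0 /asboolP g0; apply/asboolP.
apply: filterS2 f0 g0 => i fi gi.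
by rewrite (_ : (f - g) i = f i - g i)// fi gi subr0.
Qed.

HB.instance Definition _ := GRing.isZmodClosed.Build _ ae_zero
  ae_zero_zmod_closed.

(* L^2([0,1]^d; R^d): square integrable maps modulo a.e. equality. An element
   coerces to a chosen representative, so pointwise statements about it are
   meaningful only almost everywhere. *)
Definition L2 : Type := Quotient.quot ae_zero.
HB.instance Definition _ := Choice.on L2.
HB.instance Definition _ := EqQuotient.on L2.
HB.instance Definition _ := GRing.Zmodule.on L2.

Definition L2rep (x : L2) : cube R d -> 'rV[R]_d := L2fun_val (repr x).
Coercion L2rep : L2 >-> Funclass.

(* The class of f, and 0 if f is not square integrable; see L2classE. *)
Definition L2class (f : cube R d -> 'rV[R]_d) : L2 := \pi_L2 (insubd 0 f).

Lemma L2P (x y : L2) : x = y <-> {ae lam, forall i, x i = y i}.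
Proof.
split=> [->|xy]; first exact: nearW.
rewrite -[x]reprK -[y]reprK; apply/eqP; rewrite -Quotient.idealrBE.
apply/asboolP; apply: filterS xy => i xyi.
have : x i - y i = 0 by rewrite xyi subrr.
exact.
Qed.

Lemma pi_L2E (f : L2fun) : {ae lam, forall i, (\pi_L2 f : L2) i = f i}.
Proof.
have /eqP : \pi_L2 (repr (\pi_L2 f : L2)) = \pi_L2 f :> L2 by rewrite reprK.
rewrite -Quotient.idealrBE => /asboolP; apply: filterS => i.
by move=> /subr0_eq.
Qed.

Lemma L2classE (f : cube R d -> 'rV[R]_d) : f \in square_integrable ->
  {ae lam, forall i, L2class f i = f i}.
Proof.
move=> fL; have := pi_L2E (insubd 0 f); apply: filterS => i.
by rewrite insubdK.
Qed.

Lemma L2addE (x y : L2) : {ae lam, forall i, (x + y : L2) i = x i + y i}.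
Proof.
have E : \pi_L2 (repr x + repr y) = x + y by rewrite raddfD/= !reprK.
by apply: filterS (pi_L2E (repr x + repr y)) => i; rewrite E.
Qed.

Definition L2scale (a : R) (x : L2) : L2 := \pi_L2 (a *: repr x).

Lemma L2scaleE a (x : L2) : {ae lam, forall i, L2scale a x i = a *: x i}.
Proof. exact: pi_L2E. Qed.

Lemma pi_L2scale a (f : L2fun) : \pi_L2 (a *: f) = L2scale a (\pi_L2 f).
Proof.
apply/L2P; apply: filterS3 (pi_L2E (a *: f)) (L2scaleE a (\pi_L2 f))
  (pi_L2E f) => i -> -> ->.
by [].
Qed.

Let L2scaleA a b x : L2scale a (L2scale b x) = L2scale (a * b) x.
Proof. by rewrite -[x]reprK -!pi_L2scale scalerA reprK. Qed.

Let L2scale1 : left_id 1 L2scale.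
Proof. by move=> x; rewrite /L2scale scale1r reprK. Qed.

Let L2scaleDr : right_distributive L2scale +%R.
Proof.
move=> a x y; rewrite -[x]reprK -[y]reprK -raddfD/= -!pi_L2scale scalerDr.
by rewrite raddfD.
Qed.

Let L2scaleDl x : {morph L2scale^~ x : a b / a + b}.
Proof. by move=> a b; rewrite /L2scale scalerDl raddfD. Qed.

HB.instance Definition _ := GRing.Zmodule_isLmodule.Build R L2
  L2scaleA L2scale1 L2scaleDr L2scaleDl.

Definition L2dot (x y : L2) : R :=
  \sum_(j < d) \int[lam]_i (x i ord0 j * y i ord0 j).

Lemma L2coord (x : L2) j : (fun i => x i ord0 j) \in Lfun lam 2%:E.
Proof. by rewrite /L2rep; case: (repr x) => f /= /asboolP. Qed.

Lemma L2dot_integrable (x y : L2) j :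
  lam.-integrable setT (EFin \o (fun i => x i ord0 j * y i ord0 j)).
Proof. by apply/Lfun1_integrable/Lfun2_mul_Lfun1; exact: L2coord. Qed.

Lemma L2dotC x y : L2dot x y = L2dot y x.
Proof.
by apply: eq_bigr => j _; apply: eq_Rintegral => i _; rewrite mulrC.
Qed.

Let ae_eq_dot (f : cube R d -> R) (x y : L2) j :
  {ae lam, forall i, x i ord0 j * y i ord0 j = f i} ->
  lam.-integrable setT (EFin \o f) ->
  \int[lam]_i (x i ord0 j * y i ord0 j) = \int[lam]_i f i.
Proof.
move=> xyf fi; congr fine; apply: ae_eq_integral => //.
- exact: measurable_int (L2dot_integrable x y j).
- exact: measurable_int fi.
- by apply: filterS xyf => i /= ->.
Qed.

Lemma L2dotDl x y z : L2dot (x + y) z = L2dot x z + L2dot y z.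
Proof.
rewrite -big_split; apply: eq_bigr => j _ /=.
have ix := L2dot_integrable x z j; have iy := L2dot_integrable y z j.
rewrite -RintegralD//; apply: ae_eq_dot.
  by apply: filterS (L2addE x y) => i ->; rewrite mxE mulrDl.
have := integrableD measurableT ix iy.
by congr (_.-integrable _ _).
Qed.

Lemma L2dotZl a x z : L2dot (a *: x) z = a * L2dot x z.
Proof.
rewrite mulr_sumr; apply: eq_bigr => j _ /=.
have ix := L2dot_integrable x z j.
rewrite -RintegralZl//; apply: ae_eq_dot.
  by apply: filterS (L2scaleE a x) => i; rewrite mulrA => ->; rewrite mxE.
have := integrableZl measurableT a ix.
by congr (_.-integrable _ _).
Qed.

Lemma L2dot_ge0 x : 0 <= L2dot x x.
Proof.
apply: sumr_ge0 => j _; apply: Rintegral_ge0 => i _.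
by rewrite -expr2 sqr_ge0.
Qed.

Lemma L2dot_eq0 x : L2dot x x = 0 -> x = 0.
Proof.
move=> x0; apply/L2P.
have pi0 : {ae lam, forall i, (0 : L2) i = 0}.
  by apply: filterS (pi_L2E 0) => i; rewrite raddf0.
have x0j j : {ae lam, forall i, x i ord0 j = 0}.
  have ix := L2dot_integrable x x j.
  have : (\int[lam]_i `|(x i ord0 j * x i ord0 j)%:E| = 0)%E.
    rewrite (eq_integral (fun i => (x i ord0 j * x i ord0 j)%:E)); last first.
      by move=> i _; rewrite abse_EFin -expr2 ger0_norm ?sqr_ge0.
    rewrite -[LHS]fineK; last exact: integrable_fin_num.
    congr EFin; apply: (psumr_eq0P _ x0) => // k _.
    by apply: Rintegral_ge0 => i _; rewrite -expr2 sqr_ge0.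
  move/(ae_eq_integral_abs lam measurableT (measurable_int _ ix)).
  by apply: filterS => i /(_ Logic.I) [] /eqP; rewrite mulf_eq0 orbb => /eqP.
have : {ae lam, forall i, forall j, x i ord0 j = 0} by exact: filter_forall.
apply: filterS2 pi0 => i -> x0i; apply/rowP => j.
by rewrite x0i mxE.
Qed.

Lemma L2dotDr x y z : L2dot x (y + z) = L2dot x y + L2dot x z.
Proof. by rewrite ![L2dot x _]L2dotC L2dotDl. Qed.

Lemma L2dotZr a x z : L2dot x (a *: z) = a * L2dot x z.
Proof. by rewrite ![L2dot x _]L2dotC L2dotZl. Qed.

Lemma L2dot_cauchy_schwarz x y : L2dot x y ^+ 2 <= L2dot x x * L2dot y y.
Proof.
have [y0|y0] := eqVneq (L2dot y y) 0.
  have -> : y = 0 *: y by rewrite scale0r (L2dot_eq0 y0).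
  by rewrite !L2dotZr !mul0r expr0n mulr0.
have ygt0 : 0 < L2dot y y by rewrite lt_def y0 L2dot_ge0.
have := L2dot_ge0 (L2dot y y *: x + (- L2dot x y) *: y).
rewrite !(L2dotDl, L2dotDr, L2dotZl, L2dotZr) (L2dotC y x) => h.
rewrite -subr_ge0 -(pmulr_rge0 _ ygt0); apply: le_trans h _.
by rewrite le_eqVlt; apply/orP; left; apply/eqP; ring.
Qed.

Definition L2norm (x : L2) : R := Num.sqrt (L2dot x x).

Let L2norm_triangle x y : L2norm (x + y) <= L2norm x + L2norm y.
Proof.
have h0 z : 0 <= L2norm z by exact: sqrtr_ge0.
rewrite -(@ler_pXn2r _ 2) ?nnegrE ?addr_ge0//.
rewrite sqrrD !sqr_sqrtr ?L2dot_ge0// !(L2dotDl, L2dotDr) (L2dotC y x).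
suff : L2dot x y <= L2norm x * L2norm y by lra.
rewrite -sqrtrM ?L2dot_ge0//; apply: le_trans (ler_norm _) _.
by rewrite -sqrtr_sqr ler_wsqrtr// L2dot_cauchy_schwarz.
Qed.

Let L2normZ a x : L2norm (a *: x) = `|a| * L2norm x.
Proof.
by rewrite /L2norm L2dotZl L2dotZr mulrA -expr2 sqrtrM ?sqr_ge0// sqrtr_sqr.
Qed.

Let L2norm_eq0 x : L2norm x = 0 -> x = 0.
Proof.
move/eqP; rewrite sqrtr_eq0 => x0; apply: L2dot_eq0.
by apply/le_anti; rewrite x0 L2dot_ge0.
Qed.

HB.instance Definition _ := Lmodule_isNormed.Build R L2
  L2norm_triangle L2normZ L2norm_eq0.

End square_integrable_functions.

Section rearrangements.
Context (R : realType) (d : nat).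
Local Notation lam := (lebesgue_cube R d).

Definition rearrangement (g : cube R d -> cube R d) : Prop :=
  exists h : cube R d -> cube R d,
    [/\ cancel g h, cancel h g,
        measurable_fun setT g, measurable_fun setT h &
        forall A, measurable A ->
          pushforward lam g A = lam A /\ pushforward lam h A = lam A].

Definition L2comp (x : L2 R d) (g : cube R d -> cube R d) : L2 R d :=
  L2class (x \o g).

Definition L2cst (q : 'rV[R]_d) : L2 R d := L2class (cst q).

Lemma square_integrable_comp (x : L2 R d) g :
  rearrangement g -> x \o g \in @square_integrable R d.
Proof.
move=> [h [_ _ mg _ lamg]]; apply/asboolP => j.
have := L2coord x j; rewrite !inE => /andP[] /[!inE]/= mx fx.
have mxg : measurable_fun setT (fun i => x (g i) ord0 j).
  exact: (measurableT_comp mx).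
apply/andP; split; rewrite inE//=.
move: fx; rewrite /finite_norm unlock /=.
have mx2 : @measurable_fun _ _ (cube R d) (\bar R) setT
    (fun i => `|(x i ord0 j)%:E| `^ 2)%E.
  apply: (measurableT_comp (measurable_poweR 2)).
  by do 2 apply: measurableT_comp => //.
rewrite (_ : (\int[lam]_i _)%E =
    (\int[pushforward lam g]_i (`|(x i ord0 j)%:E| `^ 2))%E)//.
  by rewrite ge0_integral_pushforward//= => y _; exact: poweR_ge0.
apply: eq_measure_integral => A mA _; have [E _] := lamg A mA.
exact: esym E.
Qed.

Lemma L2compE (x : L2 R d) g :
  rearrangement g -> {ae lam, forall i, L2comp x g i = x (g i)}.
Proof. by move=> rg; exact: L2classE (square_integrable_comp x rg). Qed.

Lemma L2cstE (q : 'rV[R]_d) : {ae lam, forall i, L2cst q i = q}.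
Proof. by apply: L2classE; apply/asboolP => j; exact: Lfun_cst. Qed.

Definition mean (x : L2 R d) : 'rV[R]_d := \row_j \int[lam]_i x i ord0 j.

Definition integer_valued (z : L2 R d) : Prop :=
  {ae lam, forall i, forall j, z i ord0 j \is a Num.int}.

End rearrangements.

(* Viscosity solutions of F(z, Dw(z)) = 0 on an open set U. The derivative of
   a test function is identified, through the inner product ip, with the vector
   Dphi z such that 'd phi z h = ip (Dphi z) h; by this isometry continuity of
   Dphi is continuity of the Frechet derivative. *)
Section viscosity_solutions.
Context {R : realType} {E : normedModType R}.
Implicit Types (ip : E -> E -> R) (U : set E) (F : E -> E -> R) (w : E -> R).

Definition C1_on ip U (phi : E -> R) (Dphi : E -> E) : Prop :=
  forall z, U z -> is_diff z phi (ip (Dphi z)) /\ {for z, continuous Dphi}.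

Definition viscosity_subsolution ip U F w : Prop :=
  forall phi Dphi, C1_on ip U phi Dphi ->
  forall z, U z -> (\forall y \near z, w y - phi y <= w z - phi z) ->
  F z (Dphi z) <= 0.

Definition viscosity_supersolution ip U F w : Prop :=
  forall phi Dphi, C1_on ip U phi Dphi ->
  forall z, U z -> (\forall y \near z, w z - phi z <= w y - phi y) ->
  0 <= F z (Dphi z).

Definition viscosity_solution ip U F w : Prop :=
  [/\ forall z, U z -> {for z, continuous w},
      viscosity_subsolution ip U F w & viscosity_supersolution ip U F w].

Definition buc_on (A : set E) w : Prop :=
  [bounded w z | z in A] /\
  forall e, 0 < e -> exists2 delta, 0 < delta &
    forall z z', A z -> A z' -> `|z - z'| < delta -> `|w z - w z'| < e.

End viscosity_solutions.

(* Functions on E x [0,+oo[ are represented by functions on E * R, whose values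
   at negative times are never used. A space-time derivative q has spatial
   part q.1 and time part q.2. *)
Section cauchy.
Context {R : realType} {E : normedModType R}.

Definition spacetime_dot (ip : E -> E -> R) (z z' : E * R) : R :=
  ip z.1 z'.1 + z.2 * z'.2.

Definition buc_cauchy_solution (ip : E -> E -> R) (Ham : E -> E -> R)
    (w0 : E -> R) (w : E * R -> R) : Prop :=
  [/\ forall T, 0 < T -> buc_on [set z : E * R | 0 <= z.2 <= T] w,
      viscosity_solution (spacetime_dot ip) [set z : E * R | 0 < z.2]
        (fun z q => q.2 + Ham z.1 q.1) w &
      forall x, w (x, 0) = w0 x].

End cauchy.

Section hamiltonians.
Context {R : realType} {d : nat}.
Local Notation V := (L2 R d).
Implicit Types H : V -> V -> R.

Definition periodic_hamiltonian H : Prop :=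
  forall x p z, integer_valued z -> H (x + z) p = H x p.

Definition rearrangement_invariant_hamiltonian H : Prop :=
  forall x p g, rearrangement g -> H (L2comp x g) (L2comp p g) = H x p.

Definition locally_lipschitz_hamiltonian H : Prop :=
  (exists2 Lx, 0 < Lx & forall x y p,
     `|H x p - H y p| <= Lx * (1 + `|p|) * `|x - y|) /\
  (forall r, 0 < r -> exists2 Lr, 0 < Lr & forall x p q,
     `|p| < r -> `|q| < r -> `|H x p - H x q| <= Lr * `|p - q|).

Definition coercive_hamiltonian H : Prop :=
  forall M : R, exists r : R, forall p : V, r < `|p| ->
    (M%:E <= ereal_inf [set (H x p)%:E | x in [set: V]])%E.

Definition cell_solution H (p : 'rV[R]_d) (c : R) (v : V -> R) : Prop :=
  [/\ viscosity_solution (@L2dot R d) [set: V]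
        (fun y q => H y (L2cst p + q) - c) v,
      exists k : R, k.-lipschitz v,
      forall y z, integer_valued z -> v (y + z) = v y &
      forall y g, rearrangement g -> v (L2comp y g) = v y].

Definition effective_hamiltonian H (Hbar : 'rV[R]_d -> R) : Prop :=
  forall p, unique (fun c => exists v, cell_solution H p c v) (Hbar p).

Definition rVdot (p q : 'rV[R]_d) : R := \sum_(j < d) p ord0 j * q ord0 j.

Definition C1b (w : V -> R) : Prop :=
  exists2 Dw : V -> V, C1_on (@L2dot R d) setT w Dw &
    [bounded w x | x in [set: V]] /\ [bounded Dw x | x in [set: V]].

End hamiltonians.

(* Main.v *)
(* The perturbed test function method is run with exact correctors, the slope of
   the corrector being one more variable of the doubling. With s = eps^(1/3) and
   a corrector v_p for every slope p in a bounded set, one maximizes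
     u(x, t) - ubar(q, t') - |m x - q|^2 / (2 s) - |m x - q - s p'|^2 / (2 s)
       - |x - xi|^2 / (2 eps s) - eps v_p'(xi / eps)
   over (x, t, xi, q, t') and takes a nearly optimal p'. Comparing p' with
   p = (m x - q) / s and using that the correctors are uniformly bounded (by
   coercivity they are uniformly Lipschitz, and integer translations bring every
   point of L^2 into a ball of fixed radius) gives s |p - p'|^2 <= C eps, that is
   |p - p'| = O(s). The equation for u at slope p + (p - p') and the corrector
   equation at slope p' then differ by O(s). Maxima, which need not be attained in
   infinite dimension, are replaced by those of Borwein-Preiss perturbations, and
   only quadratic test functions are ever needed. The reverse inequality is the
   same estimate for -u, -ubar and the Hamiltonian -H(x, -p). For eps > 1 the zero
   function serves as a corrector with bounded error. *)

From HB Require Import structures.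
Require Import Defs.
From mathcomp Require Import all_boot all_order all_algebra.
From mathcomp Require Import ring lra.
From mathcomp Require Import all_classical all_reals all_analysis.
From mathcomp Require Import measurable_realfun.

Import Order.TTheory GRing.Theory Num.Theory.
Import numFieldNormedType.Exports.

Local Open Scope classical_set_scope.
Local Open Scope ring_scope.

(** The obstacle is the dependence of the correctors on the slope: nothing is known about the
    regularity of p -> v_p, so v_p with p = (m x - q) / s inserted could not be tested in x and q.
    Freezing the slope as p' avoids this, and the second square ties p' to p; the gradients of the
    two squares add up to 2 p - p'. Since v_p' is only Lipschitz, it gets its own variable xi, and
    the square in x - xi carries its gradient over to x.

    The exponent balances two errors. Replacing p' by p costs the oscillation of eps v, so |p - p'|
    is of order (eps / s)^(1/2), while the squares in m x - q cost O(s) at time 0; these agree for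
    eps = s^3.

    Slopes stay in a fixed ball because ubar inherits the Lipschitz constant of its initial datum.
    Coercivity bounds the gradient in L^2 on one side of the doubling only; the other side differs
    by a bounded amount. The Lipschitz bound for ubar and the rate both come from one comparison
    argument, [time_doubling], in which the slope is a parameter without topology. *)

Lemma Lfun2_sqr d (T : measurableType d) (R : realType)
    (mu : {measure set T -> \bar R}) (f : T -> R) :
  measurable_fun setT f -> (\int[mu]_i (f i ^+ 2)%:E < +oo)%E ->
  f \in Lfun mu 2%:E.
Proof.
move=> mf f2; rewrite inE; apply/andP; split; rewrite inE//=.
rewrite /finite_norm unlock /=.
apply: poweR_lty; rewrite (le_lt_trans _ f2)//.
rewrite le_eqVlt; apply/orP; left; apply/eqP; apply: eq_integral => i _ /=.
by rewrite -[2]/(2%:R) powR_mulrn// -normrX ger0_norm ?sqr_ge0.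
Qed.

(** * Completeness of L^2 along geometrically convergent sequences *)

Section scalar_completeness.
Context d (T : measurableType d) (R : realType) (mu : probability T R).
Variables (f : nat -> T -> R) (C : R).
Hypothesis mf : forall n, measurable_fun setT (f n).
Hypothesis fC : forall n,
  (\int[mu]_i ((f n.+1 i - f n i) ^+ 2)%:E <= (C * (4^-1) ^+ n)%:E)%E.

Let S i : \bar R := (\sum_(n <oo) `|f n.+1 i - f n i|%:E)%E.

Let mabs n : @measurable_fun _ _ T (\bar R) setT (EFin \o (fun i => `|f n.+1 i - f n i| : R)).
Proof.
apply/measurable_EFinP; apply: measurableT_comp => //.
exact: measurable_funB.
Qed.

Let C_ge0 : 0 <= C.
Proof.
have := fC 0; rewrite expr0 mulr1 -lee_fin; apply: le_trans.
by apply: integral_ge0 => i _; rewrite lee_fin sqr_ge0.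
Qed.

Let int_abs n :
  (\int[mu]_i `|f n.+1 i - f n i|%:E <= ((C + 1) * (2^-1) ^+ n)%:E)%E.
Proof.
have mg : @measurable_fun _ _ T (\bar R) setT (EFin \o (fun i => (f n.+1 i - f n i) ^+ 2 : R)).
  by apply/measurable_EFinP; apply: measurable_funX; exact: measurable_funB.
(* Weighted arithmetic-geometric mean: |a| <= 2^n a^2 + 2^-n. The squares integrate to at most C
   4^-n and the total mass is one, whence (C + 1) 2^-n. *)
apply: (@le_trans _ _ (\int[mu]_i ((2 ^+ n)%:E * ((f n.+1 i - f n i) ^+ 2)%:E +
    ((2^-1) ^+ n)%:E))%E).
  apply: ge0_le_integral => //.
  - exact: mabs.
  - by apply: emeasurable_funD => //; exact: (measurable_funeM _ mg).
  - move=> i _; rewrite lee_fin.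
    set a := f n.+1 i - f n i.
    have h2 : 2^-1 ^+ n * 2 ^+ n = 1 :> R by rewrite -exprMn mulVf ?expr1n.
    have h0 : 0 < (2 : R) ^+ n by rewrite exprn_gt0.
    rewrite -(ler_pM2l h0) mulrDr [2 ^+ n * 2^-1 ^+ n]mulrC h2.
    rewrite -(real_normK (num_real a)).
    rewrite mulrA -expr2 -exprMn.
    have := sqr_ge0 (2 ^+ n * `|a| - 1).
    have : 0 <= 2 ^+ n * `|a| by exact: mulr_ge0 (ltW h0) (normr_ge0 a).
    by nra.
rewrite ge0_integralD//; last 2 first.
- by move=> i _; rewrite -EFinM lee_fin; apply: mulr_ge0; [exact: exprn_ge0|exact: sqr_ge0].
- exact: (measurable_funeM _ mg).
rewrite integral_cst// [X in (_ + _ * X)%E]probability_setT mule1.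
rewrite ge0_integralZl//; last by move=> i _; rewrite lee_fin sqr_ge0.
apply: (@le_trans _ _ ((2 ^+ n)%:E * (C * (4^-1) ^+ n)%:E + (2^-1 ^+ n)%:E)%E).
  apply: leeD => //; apply: lee_wpmul2l; last exact: fC.
  by rewrite lee_fin exprn_ge0.
rewrite -EFinM -EFinD lee_fin mulrDl mul1r lerD2r mulrCA -exprMn.
by rewrite (_ : 2 * 4^-1 = 2^-1 :> R)//; lra.
Qed.

Let S_fin : (\int[mu]_i S i < +oo)%E.
Proof.
rewrite integral_nneseries//.
apply: (@le_lt_trans _ _ ((C + 1) * 2)%:E); last exact: ltry.
apply: lime_le.
  by apply: is_cvg_nneseries => n _ _; exact: integral_ge0.
apply: nearW => n.
apply: (@le_trans _ _ (\sum_(0 <= k < n) ((C + 1) * 2^-1 ^+ k)%:E)%E).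
  by apply: lee_sum => k _; exact: int_abs.
rewrite sumEFin lee_fin.
rewrite -[leLHS]/(series (geometric (C + 1) 2^-1) n).
rewrite geometric_seriesE; last by apply/eqP; lra.
rewrite (_ : 1 - 2^-1 = 2^-1 :> R) ?invrK//; last by lra.
rewrite ler_wpM2r// ler_piMr ?addr_ge0// lerBlDr lerDl exprn_ge0//.
Qed.

Let mS : @measurable_fun _ _ T (\bar R) setT S.
Proof.
apply: ge0_emeasurable_sum => // n _; exact: mabs.
Qed.

Let S_ge0 i : (0 <= S i)%E.
Proof. by apply: nneseries_ge0 => n _ _; rewrite lee_fin. Qed.

Let cvg_f i : S i \is a fin_num -> cvgn (f ^~ i).
Proof.
move=> Si.
have -> : f ^~ i = (fun n => f 0 i + series (telescope (f ^~ i)) n).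
  by apply/funext => n; rewrite -eq_sum_telescope.
apply: is_cvgD; first exact: is_cvg_cst.
apply: normed_cvg; apply: nondecreasing_is_cvgn.
  by apply: nondecreasing_series => n _ _ /=; exact: normr_ge0.
exists (fine (S i)) => _ [n _ <-].
rewrite -lee_fin fineK// /S /series /= -sumEFin.
by apply: nneseries_lim_ge => k _ _; rewrite lee_fin.
Qed.

(** Integrability of the series of increments makes it finite on a set D of full measure, where the
    telescoping sequence converges absolutely. Multiplying by the indicator of D gives convergence
    everywhere, so that the limit is measurable. *)
Lemma ae_cvg_of_geometric : exists D : set T, exists2 g : T -> R,
  [/\ measurable D, {ae mu, forall i, D i} & measurable_fun setT g] &
  forall i, f n i * \1_D i @[n --> \oo] --> g i.
Proof.
pose D := [set i | S i < +oo]%E.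
have mD : measurable D.
  by rewrite -[D]setTI; exact: emeasurable_fun_infty_o.
have Dfin i : D i -> S i \is a fin_num by move=> Di; rewrite ge0_fin_numE.
have cvgD i : cvgn (fun n => f n i * \1_D i).
  rewrite indicE; case: (boolP (i \in D)) => [/set_mem Di|_].
    rewrite (_ : (fun n => _) = f ^~ i); first by apply: cvg_f; exact: Dfin.
    by apply/funext => n; rewrite mulr1.
  rewrite (_ : (fun n => _) = cst 0); first exact: is_cvg_cst.
  by apply/funext => n; rewrite mulr0.
exists D, (fun i => limn (fun n => f n i * \1_D i)) => //; split=> //.
  have : mu.-integrable setT S.
    apply/integrableP; split => //.
    by rewrite (eq_integral S)// => i _; rewrite gee0_abs.
  move=> /(integrable_ae measurableT); apply: filterS => i /(_ Logic.I) Si.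
  by rewrite /D /= -ge0_fin_numE.
apply: (@measurable_fun_cvg _ _ _ _ (fun n i => f n i * \1_D i)).
  by move=> n; apply: measurable_funM => //; exact: measurable_indic.
by move=> i _; exact: cvgD.
Qed.

End scalar_completeness.

Section L2_completeness.
Context (R : realType) (d : nat).
Local Notation V := (L2 R d).
Local Notation lam := (lebesgue_cube R d).

Lemma L2subE (x y : V) : {ae lam, forall i, (x - y : V) i = x i - y i}.
Proof.
apply: filterS2 (L2addE x (- y)) (L2scaleE (-1) y) => i -> h; congr (_ + _).
by rewrite -scaleN1r h scaleN1r.
Qed.

Lemma measurable_L2coord (x : V) j : measurable_fun setT (fun i => x i ord0 j).
Proof. by have := L2coord x j; rewrite inE => /andP[] /[!inE]. Qed.

Lemma L2dot_coordE (x : V) :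
  (L2dot x x)%:E = (\sum_(j < d) \int[lam]_i ((x i ord0 j) ^+ 2)%:E)%E.
Proof.
rewrite /L2dot -sumEFin; apply: eq_bigr => j _.
rewrite /Rintegral fineK; first by apply: eq_integral => i _; rewrite expr2.
by apply: integrable_fin_num => //; exact: L2dot_integrable.
Qed.

Lemma coord_le_L2dot (x : V) j :
  (\int[lam]_i ((x i ord0 j) ^+ 2)%:E <= (L2dot x x)%:E)%E.
Proof.
rewrite L2dot_coordE (bigD1 j)//= leeDl// sume_ge0// => k _.
by apply: integral_ge0 => i _; rewrite lee_fin sqr_ge0.
Qed.

Lemma ae_sqr_integral (f g : cube R d -> R) :
  measurable_fun setT f -> measurable_fun setT g ->
  {ae lam, forall i, f i = g i} ->
  (\int[lam]_i (f i ^+ 2)%:E = \int[lam]_i (g i ^+ 2)%:E)%E.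
Proof.
move=> mf mg fg; apply: ae_eq_integral => //.
- by apply/measurable_EFinP; exact: measurable_funX.
- by apply/measurable_EFinP; exact: measurable_funX.
- by apply: filterS fg => i -> _.
Qed.

Lemma L2_geometric_dist (u : nat -> V) (C : R) :
  (forall n, L2dot (u n.+1 - u n) (u n.+1 - u n) <= C * (4^-1) ^+ n) ->
  forall n k, L2dot (u n - u (n + k)%N) (u n - u (n + k)%N)
    <= 4 * C * (4^-1) ^+ n.
Proof.
move=> uC.
have C0 : 0 <= C.
  by have := le_trans (L2dot_ge0 _) (uC 0); rewrite expr0 mulr1.
pose s := Num.sqrt C.
have s0 : 0 <= s by exact: sqrtr_ge0.
have sC : s ^+ 2 = C by rewrite sqr_sqrtr.
have e4 n : (4^-1 : R) ^+ n = (2^-1 ^+ n) ^+ 2.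
  by rewrite exprAC; congr (_ ^+ n); lra.
have step n : `|u n.+1 - u n| <= s * 2^-1 ^+ n.
  rewrite /Num.norm /= /L2norm -[leRHS]ger0_norm ?mulr_ge0 ?exprn_ge0//.
  by rewrite -sqrtr_sqr ler_wsqrtr// exprMn sC -e4.
(* The induction carries the exact partial sum of the geometric series; without the factor
   [1 - 2^-1 ^+ k] the bound would not propagate. *)
have dist n k : `|u (n + k)%N - u n| <= 2 * s * 2^-1 ^+ n * (1 - 2^-1 ^+ k).
  elim: k => [|k IH]; first by rewrite addn0 subrr normr0 expr0 subrr mulr0.
  rewrite addnS -(subrK (u (n + k)%N) (u _.+1)) -addrA.
  apply: le_trans (ler_normD _ _) _; apply: le_trans (lerD (step _) IH) _.
  by rewrite exprD !exprS le_eqVlt; apply/orP; left; apply/eqP; field.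
move=> n k.
have : 2 * s * 2^-1 ^+ n * (1 - 2^-1 ^+ k) <= 2 * s * 2^-1 ^+ n.
  rewrite mulrBr mulr1 lerBlDr lerDl.
  by do 2 (apply: mulr_ge0; last exact: exprn_ge0); exact: mulr_ge0.
move=> /(le_trans (dist n k)); rewrite distrC {1}/Num.norm /= /L2norm => h.
rewrite -(sqr_sqrtr (L2dot_ge0 _)) e4 -sC.
have -> : 4 * s ^+ 2 * (2^-1 ^+ n) ^+ 2 = (2 * s * 2^-1 ^+ n) ^+ 2.
  by rewrite !exprMn; congr (_ * _ * _); lra.
by rewrite ler_pXn2r ?nnegrE ?sqrtr_ge0//; apply: le_trans h; exact: sqrtr_ge0.
Qed.

(** Riesz-Fischer with a rate: coordinatewise limits exist almost everywhere, and Fatou's lemma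
    passes the bound of [L2_geometric_dist] to the limit. *)
Theorem L2_geometric_complete (u : nat -> V) (C : R) :
  (forall n, L2dot (u n.+1 - u n) (u n.+1 - u n) <= C * (4^-1) ^+ n) ->
  exists l C', forall n, L2dot (u n - l) (u n - l) <= C' * (4^-1) ^+ n.
Proof.
move=> uC; pose f j n i := u n i ord0 j.
have mf j n : measurable_fun setT (f j n) by exact: measurable_L2coord.
have diff j m n : (\int[lam]_i ((f j m i - f j n i) ^+ 2)%:E
    <= (L2dot (u m - u n) (u m - u n))%:E)%E.
  apply: le_trans (coord_le_L2dot (u m - u n) j).
  rewrite (ae_sqr_integral (fun i => (u m - u n : V) i ord0 j)
    (fun i => f j m i - f j n i))//.
  - exact: measurable_L2coord.
  - exact: measurable_funB.
  - by apply: filterS (L2subE (u m) (u n)) => i ->; rewrite !mxE.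
have /= lim_f j : exists Dg : set (cube R d) * (cube R d -> R),
    [/\ measurable Dg.1, {ae lam, forall i, Dg.1 i} & measurable_fun setT Dg.2] /\
    forall i, f j n i * \1_(Dg.1) i @[n --> \oo] --> Dg.2 i.
  have [|D [g h1 h2]] := @ae_cvg_of_geometric _ _ _ lam (f j) C (mf j).
    by move=> n; apply: le_trans (diff j _ _) _; rewrite lee_fin.
  by exists (D, g).
have [Dg DgP] := choice lim_f.
pose g j := (Dg j).2.
have mg j : measurable_fun setT (g j) by have [[]] := DgP j.
have close j n : (\int[lam]_i ((f j n i - g j i) ^+ 2)%:E
    <= (4 * C * (4^-1) ^+ n)%:E)%E.
  have [[mD aD _] cv] := DgP j; set D := (Dg j).1 in mD aD cv.
  pose h m i := f j m i * \1_D i.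
  have mh m : measurable_fun setT (h m).
    by apply: measurable_funM => //; exact: measurable_indic.
  have hf m : {ae lam, forall i, h m i = f j m i}.
    by apply: filterS aD => i Di; rewrite /h indicE mem_set// mulr1.
  rewrite (ae_sqr_integral (fun i => f j n i - g j i) (fun i => h n i - g j i));
    [|exact: measurable_funB|exact: measurable_funB|]; last first.
    by apply: filterS (hf n) => i ->.
  have cvh i : limn_einf (fun m => ((h n i - h m i) ^+ 2)%:E)
      = ((h n i - g j i) ^+ 2)%:E.
    have : ((h n i - h m i) ^+ 2)%:E @[m --> \oo] --> ((h n i - g j i) ^+ 2)%:E.
      apply: cvg_EFin; first exact: nearW.
      apply: cvgM; (apply: cvgB; [exact: cvg_cst|exact: cv]).
    by move=> /cvg_limn_einf_sup[].
  under eq_integral do rewrite -cvh.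
  apply: le_trans (fatou _ _ _ _) _ => //.
  - by move=> m; apply/measurable_EFinP/measurable_funX; exact: measurable_funB.
  - by move=> m i _; rewrite lee_fin sqr_ge0.
  rewrite limn_einf_lim; apply: lime_le; first exact: is_cvg_einfs.
  apply: nearW => m; apply: ereal_inf_le.
  (* The infimum over indices from m on is estimated by the term of index n + m, to which the bound
     on distances from [u n] applies. *)
  exists (\int[lam]_i ((h n i - h (n + m)%N i) ^+ 2)%:E)%E.
    by exists (n + m)%N => //=; rewrite leq_addl.
  rewrite (ae_sqr_integral _ (fun i => f j n i - f j (n + m)%N i)).
  - apply: le_trans (diff _ _ _) _; rewrite lee_fin; exact: L2_geometric_dist.
  - exact: measurable_funB.
  - exact: measurable_funB.
  - by apply: filterS2 (hf n) (hf (n + m)%N) => i -> ->.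
pose l : V := L2class (fun i => \row_j g j i).
have gL j : g j \in Lfun lam 2%:E.
  have gf : (fun i => f j 0 i - g j i) \in Lfun lam 2%:E.
    apply: Lfun2_sqr; first exact: measurable_funB.
    exact: le_lt_trans (close j 0) (ltry _).
  have [_ LD] := Lfun_submod_closed lam (lee1n 2).
  rewrite (_ : g j = (-1) *: (fun i => f j 0 i - g j i) + f j 0).
    by apply: LD => //; exact: L2coord.
  by apply/funext => i; rewrite !fctE scaleN1r opprB subrK.
have lE : {ae lam, forall i, l i = \row_j g j i}.
  apply: L2classE; apply/asboolP => j.
  by rewrite (_ : (fun i => _) = g j)//; apply/funext => i; rewrite mxE.
exists l, (d%:R * (4 * C)) => n.
rewrite -lee_fin L2dot_coordE.
apply: (@le_trans _ _ (\sum_(j < d) 4 * C * (4^-1) ^+ n)%:E).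
  rewrite -sumEFin; apply: lee_sum => j _.
  rewrite (ae_sqr_integral _ (fun i => f j n i - g j i))//.
  - exact: measurable_L2coord.
  - exact: measurable_funB.
  - by apply: filterS2 (L2subE (u n) l) lE => i -> ->; rewrite !mxE.
by rewrite sumr_const card_ord lee_fin -[d%:R * _ * _]mulrA (mulr_natl _ d).
Qed.
End L2_completeness.

(* An inner product whose norm is only equivalent to the given one, since the norm
   of a product of normed modules is the maximum norm. Completeness is required
   for geometrically convergent sequences. *)
Record hilbertian {R : realType} {E : normedModType R} (ip : E -> E -> R) :
    Prop := Hilbertian {
  ipC : forall x y, ip x y = ip y x;
  ipDl : forall x y z, ip (x + y) z = ip x z + ip y z;
  ipZl : forall a x z, ip (a *: x) z = a * ip x z;
  ip_norm : exists2 k, 0 < k &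
    forall x, ip x x <= k * `|x| ^+ 2 /\ `|x| ^+ 2 <= k * ip x x;
  ip_complete : forall (u : nat -> E) (C : R),
    (forall n, ip (u n.+1 - u n) (u n.+1 - u n) <= C * 4^-1 ^+ n) ->
    exists l C', forall n, ip (u n - l) (u n - l) <= C' * 4^-1 ^+ n }.

Arguments ipC {R E ip}.
Arguments ipDl {R E ip}.
Arguments ipZl {R E ip}.
Arguments ip_norm {R E ip}.
Arguments ip_complete {R E ip}.

Lemma is_diff_sqr_remainder (R : realType) (E : normedModType R) (phi : E -> R)
    (L : {linear E -> R}) z (K : R) :
  (forall h, `|L h| <= K * `|h|) ->
  (forall h, `|phi (z + h) - phi z - L h| <= K * `|h| ^+ 2) ->
  is_diff z phi L.
Proof.
move=> LK phiK.
have Lc : continuous L.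
  apply/linear_bounded_continuous/linear_boundedP.
  exists K; split=> [|r Kr x]; first exact: num_real.
  by apply: le_trans (LK x) _; rewrite ler_wpM2r// ltW.
have dphi : phi \o shift z = cst (phi z) + L +o_ 0 id.
  have [K0|K0] := leP K 0.
    apply/eqaddoP => e e0; near=> h; rewrite !fctE /= (addrC h).
    rewrite opprD addrA; apply: le_trans (phiK h) _.
    by apply: (@le_trans _ _ 0); rewrite ?mulr_le0_ge0 ?mulr_ge0 ?sqr_ge0// ltW.
  apply/eqaddoP => _/posnumP[e]; near=> h => /=.
  rewrite !fctE /= opprD addrA addrC addrA -[X in `|X|]addrC.
  rewrite (_ : _ + _ = phi (z + h) - phi z - L h); last by rewrite (addrC z); ring.
  apply: le_trans (phiK h) _.
  rewrite expr2 mulrA ler_wpM2r//.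
  rewrite mulrC -ler_pdivlMr//; near: h.
  apply: nbhs_le_nbhs_norm; exists (e%:num / K) => /=.
    exact: divr_gt0.
  by move=> h /=; rewrite sub0r normrN => /ltW.
have dE := diff_unique Lc dphi.
by apply: DiffDef => //; apply/diff_locallyP; rewrite dE.
Unshelve. all: by end_near. Qed.

(** * Inner product calculus and paraboloids as test functions *)

Section hilbertian_theory.
Context {R : realType} {E : normedModType R} {ip : E -> E -> R}.
Hypothesis hE : hilbertian ip.
Implicit Types x y z : E.

Lemma ipDr x y z : ip x (y + z) = ip x y + ip x z.
Proof. by rewrite ![ip x _](ipC hE) (ipDl hE). Qed.
Lemma ipZr a x z : ip x (a *: z) = a * ip x z.
Proof. by rewrite ![ip x _](ipC hE) (ipZl hE). Qed.
Lemma ipNl x y : ip (- x) y = - ip x y.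
Proof. by rewrite -scaleN1r (ipZl hE) mulN1r. Qed.
Lemma ipNr x y : ip x (- y) = - ip x y.
Proof. by rewrite -scaleN1r ipZr mulN1r. Qed.
Lemma ipBl x y z : ip (x - y) z = ip x z - ip y z.
Proof. by rewrite (ipDl hE) ipNl. Qed.
Lemma ipBr x y z : ip x (y - z) = ip x y - ip x z.
Proof. by rewrite ipDr ipNr. Qed.
Lemma ip0l x : ip 0 x = 0.
Proof. by rewrite -(scale0r 0) (ipZl hE) mul0r. Qed.
Lemma ip0r x : ip x 0 = 0.
Proof. by rewrite (ipC hE) ip0l. Qed.

(** Positivity is not a field of [hilbertian]; it comes from the comparison with the norm in
    [ip_norm]. *)
Lemma ip_ge0 x : 0 <= ip x x.
Proof.
have [k k0 /(_ x) [_ h]] := ip_norm hE.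
by rewrite -(pmulr_rge0 _ k0); apply: le_trans h; exact: sqr_ge0.
Qed.

Lemma ip_eq0 x : ip x x = 0 -> x = 0.
Proof.
have [k k0 /(_ x) [_ h]] := ip_norm hE; move=> x0.
apply/normr0_eq0/eqP; rewrite -sqrf_eq0; apply/eqP/le_anti.
by rewrite sqr_ge0 andbT; apply: le_trans h _; rewrite x0 mulr0.
Qed.

Lemma ip_sqrD x y : ip (x + y) (x + y) = ip x x + 2 * ip x y + ip y y.
Proof. by rewrite (ipDl hE) !ipDr (ipC hE y x); ring. Qed.

Lemma ip_sqrB x y : ip (x - y) (x - y) = ip x x - 2 * ip x y + ip y y.
Proof. by rewrite ipBl !ipBr (ipC hE y x); ring. Qed.

Lemma ip_sqrN x : ip (- x) (- x) = ip x x.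
Proof. by rewrite ipNl ipNr opprK. Qed.

Lemma ip_sqrZ a x : ip (a *: x) (a *: x) = a ^+ 2 * ip x x.
Proof. by rewrite (ipZl hE) ipZr mulrA. Qed.

Lemma ip_cauchy_schwarz x y : ip x y ^+ 2 <= ip x x * ip y y.
Proof.
have [y0|y0] := eqVneq (ip y y) 0.
  by rewrite (ip_eq0 _ y0) !ip0r mulr0 expr0n.
have ygt0 : 0 < ip y y by rewrite lt_def y0 ip_ge0.
have := ip_ge0 (ip y y *: x - ip x y *: y).
rewrite ip_sqrB !ip_sqrZ (ipZl hE) ipZr => h.
rewrite -subr_ge0 -(pmulr_rge0 _ ygt0); apply: le_trans h _.
by rewrite le_eqVlt; apply/orP; left; apply/eqP; ring.
Qed.

Lemma ip_young (c : R) x y : 0 < c -> 2 * ip x y <= c * ip x x + c^-1 * ip y y.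
Proof.
move=> c0; have := ip_ge0 (c *: x - y); rewrite ip_sqrB ip_sqrZ (ipZl hE) => h.
have ci : c^-1 * c = 1 by rewrite mulVf ?gt_eqF.
have : 0 <= c^-1 * (c ^+ 2 * ip x x - 2 * (c * ip x y) + ip y y).
  by apply: mulr_ge0 => //; rewrite invr_ge0 ltW.
have -> : c^-1 * (c ^+ 2 * ip x x - 2 * (c * ip x y) + ip y y) =
  (c^-1 * c) * (c * ip x x) - 2 * (c^-1 * c) * ip x y + c^-1 * ip y y by ring.
by rewrite ci; lra.
Qed.

Lemma ip_bounded : exists2 k, 0 < k & forall x y, `|ip x y| <= k * `|x| * `|y|.
Proof.
have [k k0 h] := ip_norm hE; exists k => // x y.
rewrite -(@ler_pXn2r _ 2) ?nnegrE//; last first.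
  by rewrite !mulr_ge0// ltW.
rewrite -normrX ger0_norm ?sqr_ge0//.
apply: le_trans (ip_cauchy_schwarz x y) _.
have -> : (k * `|x| * `|y|) ^+ 2 = (k * `|x| ^+ 2) * (k * `|y| ^+ 2) by ring.
by apply: ler_pM; rewrite ?ip_ge0//; have [] := h x; have [] := h y.
Qed.

Section paraboloid.
Variables (D z : E) (C : R).

Definition paraboloid y := ip D (y - z) + C * ip (y - z) (y - z).

Lemma paraboloidD y h : paraboloid (y + h) =
  paraboloid y + ip (D + (2 * C) *: (y - z)) h + C * ip h h.
Proof.
rewrite /paraboloid (addrAC y h); move: (y - z) => w.
by rewrite ip_sqrD ipDr (ipDl hE D) (ipZl hE); ring.
Qed.

Lemma is_diff_paraboloid y :
  is_diff y paraboloid (ip (D + (2 * C) *: (y - z))).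
Proof.
set G := _ + _.
have lin : linear (ip G) by move=> a u v; rewrite ipDr ipZr.
pose lG := GRing.isLinear.Build _ _ _ _ _ lin.
pose L : {linear E -> R} := HB.pack (ip G) lG.
have [k k0 kP] := ip_bounded.
have [k' k'0 k'P] := ip_norm hE.
apply: (@is_diff_sqr_remainder _ _ _ L _ (k * `|G| + `|C| * k')) => h.
  rewrite /= mulrDl; apply: le_trans (kP _ _) _; rewrite lerDl.
  by rewrite !mulr_ge0// ltW.
rewrite paraboloidD /= (_ : _ - _ = C * ip h h); last by rewrite -/G; ring.
rewrite normrM (ger0_norm (ip_ge0 h)) mulrDl -mulrA.
apply: le_trans (_ : `|C| * (k' * `|h| ^+ 2) <= _).
  by rewrite ler_wpM2l//; have [] := k'P h.
rewrite -mulrA lerDr; apply: mulr_ge0; first exact: ltW.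
by rewrite mulr_ge0 ?sqr_ge0.
Qed.

Lemma C1_paraboloid U :
  C1_on ip U paraboloid (fun y => D + (2 * C) *: (y - z)).
Proof.
move=> y _; split; first exact: is_diff_paraboloid.
apply: cvgD; first exact: cvg_cst.
apply: cvgZ; first exact: cvg_cst.
by apply: cvgB; [exact: cvg_id|exact: cvg_cst].
Qed.

Lemma continuous_paraboloid : continuous paraboloid.
Proof.
move=> y; have [h _] := is_diff_paraboloid y.
exact: differentiable_continuous.
Qed.

End paraboloid.

Lemma ip_sqr_continuous z : continuous (fun y => ip (y - z) (y - z)).
Proof.
rewrite (_ : (fun _ => _) = paraboloid 0 z 1); first exact: continuous_paraboloid.
by apply/funext => y; rewrite /paraboloid ip0l add0r mul1r.
Qed.

End hilbertian_theory.

Arguments paraboloid {R E} ip.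

(** * Near maxima and the Borwein-Preiss principle *)

Lemma near_max {R : realType} {T : Type} (A : set T) (g : T -> R) (M r : R) :
  A !=set0 -> (forall z, A z -> g z <= M) -> 0 < r ->
  exists2 z, A z & forall y, A y -> g y <= g z + r.
Proof.
move=> [z0 Az0] gM r0.
have hs : has_sup [set g z | z in A].
  by split; [exists (g z0); exists z0|exists M => _ [z Az <-]; exact: gM].
have [_ [z Az <-] h] := sup_adherent r0 hs.
exists z => // y Ay; move: h; rewrite ltrBlDr => /ltW; apply: le_trans.
by apply: ub_le_sup; [exact: hs.2|exists y].
Qed.

Section borwein_preiss.
Context {R : realType} {E : normedModType R} {ip : E -> E -> R}.
Hypothesis hE : hilbertian ip.
Implicit Types x y z : E.

Lemma ip_cvg T (F : set_system T) {FF : Filter F} (f g : T -> E) x y :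
  f @ F --> x -> g @ F --> y -> ip (f t) (g t) @[t --> F] --> ip x y.
Proof.
move=> fx gy.
(* Polarization reduces joint continuity to that of y -> [ip y y]. *)
have QE u v : ip u v = 2^-1 * (ip (u + v) (u + v) - ip u u - ip v v).
  by rewrite (ip_sqrD hE); field.
have Qc u : {for u, continuous (fun y => ip y y)}.
  have := @ip_sqr_continuous _ _ _ hE 0 u; rewrite (_ : (fun _ => _) = fun y => ip y y)//.
  by apply/funext => v; rewrite subr0.
rewrite QE; under eq_fun do rewrite QE.
apply: cvgM; first exact: cvg_cst.
apply: cvgB; first apply: cvgB.
- apply: (cvg_comp (fun t => f t + g t) (fun y => ip y y)); last exact: Qc.
  exact: cvgD.
- by apply: (cvg_comp f (fun y => ip y y)); last exact: Qc.
- by apply: (cvg_comp g (fun y => ip y y)); last exact: Qc.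
Qed.

Lemma geometric_cvg (u : nat -> E) l (C : R) :
  (forall n, ip (u n - l) (u n - l) <= C * 4^-1 ^+ n) -> u @ \oo --> l.
Proof.
move=> uC; have [k k0 kP] := ip_norm hE.
have h4 : (fun n => k * (C * 4^-1 ^+ n)) @ \oo --> 0.
  rewrite -[X in _ --> X](mulr0 k); apply: cvgM; first exact: cvg_cst.
  rewrite -[X in _ --> X](mulr0 C); apply: cvgM; first exact: cvg_cst.
  by apply: cvg_expr; rewrite ger0_norm//; lra.
apply/cvgrPdist_lt => e e0.
move/cvgrPdist_lt : h4 => /(_ (e ^+ 2) (exprn_gt0 _ e0)).
apply: filterS => n; rewrite sub0r normrN => h.
rewrite -(@ltr_pXn2r _ 2) ?nnegrE//; last exact: ltW.
rewrite distrC; apply: le_lt_trans h.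
have [_ kl] := kP (u n - l); apply: le_trans kl (le_trans _ (ler_norm _)).
by rewrite ler_pM2l//; exact: uC.
Qed.

Variables (A : set E) (f : E -> R) (M e : R).
Hypotheses (A_closed : closed A) (A_neq0 : A !=set0).
Hypothesis f_bounded : forall z, A z -> f z <= M.
Hypothesis f_usc : forall z r, A z -> 0 < r ->
  \forall y \near z, A y -> f y <= f z + r.
Hypothesis e_gt0 : 0 < e.

(** [al n] is the weight of the n-th penalty and [a n] the sum of the first n weights, with limit
    1/2. The tolerance [dl n] decays like 8^-n so that [2 * dl n / al n] equals e 4^-n, the rate
    that [ip_complete] asks for. *)
Let a n : R := 2^-1 - 2^-1 ^+ n.+1.
Let al n : R := 2^-1 ^+ n.+2.
Let dl n : R := e / 8 * 8^-1 ^+ n.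
(* The penalties al k |z - z_k|^2, k < n, add up to a n |z|^2 - 2 <z, b_n> up to a
   constant; in the limit they form the single square |z - zb|^2 / 2. *)
Let G n (b z : E) := f z - a n * ip z z + 2 * ip z b.

Let aS n : a n.+1 = a n + al n.
Proof. by rewrite /a /al !exprS; field. Qed.

Let a_gt0 n : 0 < a n.+1.
Proof.
rewrite /a subr_gt0 exprS gtr_pMr//; apply: exprn_ilt1 => //.
by lra.
Qed.

Let dl_gt0 n : 0 < dl n.
Proof. by rewrite /dl mulr_gt0 ?divr_gt0 ?exprn_gt0 ?invr_gt0. Qed.

Let al_gt0 n : 0 < al n.
Proof. by rewrite /al exprn_gt0. Qed.

Let pick_ex (nb : nat * E) : exists z, A z /\
  forall y, A y -> G nb.1.+1 nb.2 y <= G nb.1.+1 nb.2 z + dl nb.1.+1.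
Proof.
case: nb => n b /=.
have [|z Az h] := near_max A (G n.+1 b) (M + (a n.+1)^-1 * ip b b) _ A_neq0 _ (dl_gt0 n.+1).
  move=> z Az; have := ip_young hE _ z b (a_gt0 n).
  by have := f_bounded z Az; rewrite /G; lra.
by exists z.
Qed.

(** Each near-maximum z n of the function penalized so far becomes the centre of the next penalty.
    The points converge geometrically, and all penalties merge into one paraboloid, so the slope of
    the perturbation at the maximum is simply zs - zb. *)
Theorem borwein_preiss : exists zs zb, [/\ A zs, ip (zs - zb) (zs - zb) <= e,
  forall y, A y -> f y <= f zs + e &
  forall y, A y -> f y - 2^-1 * ip (y - zb) (y - zb)
                <= f zs - 2^-1 * ip (zs - zb) (zs - zb)].
Proof.
have [pick pickP] := choice pick_ex.
have [z1 Az1 z1P] := near_max A f M (dl 0) A_neq0 f_bounded (dl_gt0 0).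
(* State n is the pair (b_n, z_n). [pick (n, b)] serves stage [n.+1], since at stage 0 the penalty
   is void ([a 0] is 0) and [z1] is a near-maximum of [f] itself. *)
pose st := nat_rect (fun=> (E * E)%type) (0, z1)
  (fun n s => let b := s.1 + al n *: s.2 in (b, pick (n, b))).
pose b n := (st n).1; pose z n := (st n).2.
have bS n : b n.+1 = b n + al n *: z n by [].
have Az n : A (z n) by case: n => [//|n]; have [] := pickP (n, b n.+1).
have zP n y : A y -> G n (b n) y <= G n (b n) (z n) + dl n.
  case: n => [|n]; last by have [_ h] := pickP (n, b n.+1); exact: h.
  move=> Ay; have := z1P y Ay.
  rewrite /G /b /z /= !(ip0r hE) /a expr1 subrr !mul0r !mulr0 !subr0 !addr0.
  by [].
have GS n y : G n.+1 (b n.+1) y =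
    G n (b n) y - al n * ip (y - z n) (y - z n) + al n * ip (z n) (z n).
  by rewrite /G bS (ipDr hE) (ipZr hE) aS (ip_sqrB hE); ring.
have dlS n : dl n.+1 <= dl n.
  rewrite /dl exprS mulrCA ler_piMl//; last by lra.
  exact: ltW (dl_gt0 n).
(* Near-maximality of [z n.+1] at stage [n.+1] and of [z n] at stage n add up to al n |z_(n+1) -
   z_n|^2 <= dl n + dl (n+1). *)
have zS n : ip (z n.+1 - z n) (z n.+1 - z n) <= e * 4^-1 ^+ n.
  have h1 := zP n.+1 (z n) (Az n); have h2 := zP n (z n.+1) (Az n.+1).
  rewrite !GS subrr (ip0l hE) mulr0 subr0 in h1.
  have h3 : al n * ip (z n.+1 - z n) (z n.+1 - z n) <= 2 * dl n.
    by have := dlS n; lra.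
  rewrite -(ler_pM2l (al_gt0 n)); apply: le_trans h3 _.
  rewrite /dl /al (_ : 8^-1 = 2^-1 * 4^-1 :> R); last by field.
  by rewrite exprMn !exprS le_eqVlt; apply/orP; left; apply/eqP; field.
have [zs [C' zsC]] := ip_complete hE z e zS.
have z_cvg : z @ \oo --> zs by exact: geometric_cvg zsC.
have Azs : A zs by apply: (closed_cvg A) z_cvg => //; exact: nearW.
have [K K0 KP] : exists2 K, 0 < K & forall n, ip (z n) (z n) <= K.
  exists (2 * ip zs zs + 2 * `|C'| + 1).
    by have := ip_ge0 hE zs; have := normr_ge0 C'; lra.
  move=> n; have -> : z n = (z n - zs) + zs by rewrite subrK.
  rewrite (ip_sqrD hE).
  have h1 : ip (z n - zs) (z n - zs) <= `|C'|.
    apply: le_trans (zsC n) _; apply: le_trans (ler_norm _) _.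
    rewrite normrM ler_piMr// ger0_norm ?exprn_ge0 ?invr_ge0//.
    by apply: exprn_ile1; rewrite ?invr_ge0//; lra.
  by have := ip_young hE _ (z n - zs) zs ltr01; lra.
have [bs [C2 bsC]] : exists l C', forall n, ip (b n - l) (b n - l) <= C' * 4^-1 ^+ n.
  apply: (ip_complete hE _ K) => n.
  rewrite bS addrAC subrr add0r (ip_sqrZ hE) mulrC; apply: ler_pM.
  - exact: ip_ge0.
  - exact: sqr_ge0.
  - exact: KP.
  - rewrite /al exprAC (_ : 2^-1 ^+ 2 = 4^-1 :> R); last by field.
    by rewrite ler_wiXn2l ?invr_ge0 ?leqW ?leqnSn//; lra.
have b_cvg : b @ \oo --> bs by exact: geometric_cvg bsC.
have e2 : (fun n => 2^-1 ^+ n : R) @ \oo --> 0.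
  by apply: cvg_expr; rewrite ger0_norm//; lra.
have a_cvg : a @ \oo --> (2^-1 : R).
  rewrite -[X in _ --> X]subr0; apply: cvgB; first exact: cvg_cst.
  by rewrite (cvg_shiftS (fun n => 2^-1 ^+ n : R)).
have dl_cvg : dl @ \oo --> 0.
  rewrite -[X in _ --> X](mulr0 (e / 8)); apply: cvgM; first exact: cvg_cst.
  by apply: cvg_expr; rewrite ger0_norm//; lra.
(* The weights sum to 1/2, so the limit penalty |y|^2 / 2 - 2 <y, bs> is a square centred at twice
   [bs]. *)
pose zb := 2 *: bs.
have halfQ y : 2^-1 * ip y y - 2 * ip y bs =
    2^-1 * ip (y - zb) (y - zb) - 2 * ip bs bs.
  by rewrite (ip_sqrB hE) (ip_sqrZ hE) (ipZr hE); field.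
have f_near r : 0 < r -> \forall n \near \oo, f (z n) <= f zs + r.
  move=> r0.
  have h : \forall n \near \oo, A (z n) -> f (z n) <= f zs + r :=
    z_cvg _ (f_usc zs r Azs r0).
  by apply: filterS h => n /(_ (Az n)).
have f_nearS r : 0 < r -> \forall n \near \oo, f (z n.+1) <= f zs + r.
  move=> r0; have z_cvgS : (fun n => z n.+1) @ \oo --> zs by rewrite cvg_shiftS.
  have h : \forall n \near \oo, A (z n.+1) -> f (z n.+1) <= f zs + r :=
    z_cvgS _ (f_usc zs r Azs r0).
  by apply: filterS h => n /(_ (Az n.+1)).
have ler_lim (p q : nat -> R) (p' q' : R) : p @ \oo --> p' -> q @ \oo --> q' ->
    (\forall n \near \oo, p n <= q n) -> p' <= q' by exact: ler_cvg_to.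
have maxP y : A y -> f y - 2^-1 * ip (y - zb) (y - zb)
                <= f zs - 2^-1 * ip (zs - zb) (zs - zb).
  move=> Ay; apply/ler_addgt0Pr => r r0.
  suff : f y - 2^-1 * ip y y + 2 * ip y bs <=
      f zs + r - 2^-1 * ip zs zs + 2 * ip zs bs + 0.
    by have := halfQ y; have := halfQ zs; lra.
  apply: (ler_lim (fun n => G n (b n) y)
    (fun n => f zs + r - a n * ip (z n) (z n) + 2 * ip (z n) (b n) + dl n)).
  - apply: cvgD; first apply: cvgB; first exact: cvg_cst.
      by apply: cvgM => //; exact: cvg_cst.
    by apply: cvgM; [exact: cvg_cst|apply: ip_cvg => //; exact: cvg_cst].
  - apply: cvgD => //; apply: cvgD; first apply: cvgB; first exact: cvg_cst.
      by apply: cvgM => //; exact: ip_cvg.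
    by apply: cvgM; [exact: cvg_cst|exact: ip_cvg].
  - by apply: filterS (f_near r r0) => n; have := zP n y Ay; rewrite /G; lra.
pose c n : R := \sum_(k < n) al k * ip (z k) (z k).
have SE n y : a n * ip y y - 2 * ip y (b n) + c n =
    \sum_(k < n) al k * ip (y - z k) (y - z k).
  elim: n => [|n IH].
    by rewrite /c !big_ord0 /a /b expr1 subrr mul0r (ip0r hE); lra.
  rewrite big_ord_recr /= -IH /c big_ord_recr /= bS aS.
  by rewrite (ipDr hE) (ipZr hE) (ip_sqrB hE); ring.
(* The nonnegative sum of squares is evaluated at its minimizer b / a. *)
have c_ge n : (a n.+1)^-1 * ip (b n.+1) (b n.+1) <= c n.+1.
  have : 0 <= \sum_(k < n.+1) al k *
      ip ((a n.+1)^-1 *: b n.+1 - z k) ((a n.+1)^-1 *: b n.+1 - z k).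
    by apply: sumr_ge0 => k _; rewrite mulr_ge0 ?(ip_ge0 hE)// ltW.
  rewrite -SE (ip_sqrZ hE) (ipZl hE) expr2 !mulrA divff ?gt_eqF// mul1r.
  by lra.
(* [G n (b n) y - c n] is f minus all penalties so far. As a competitor at stage [n.+1], [z n] pays
   no new penalty, so the penalized value drops at most by the tolerance; the tolerances sum to less
   than e / 4. *)
have supP n y : A y -> f y <= G n (b n) (z n) - c n + e / 4 * (1 - 2^-1 ^+ n.+1).
  move=> Ay; elim: n => [|n IH].
    rewrite /c big_ord0; have := zP 0 y Ay.
    by rewrite /G /a /b /dl expr1 expr0 subrr /= !(ip0r hE); lra.
  have := zP n.+1 (z n) (Az n); rewrite GS subrr (ip0l hE) /c big_ord_recr /=.
  move: IH; rewrite /c; set s := \sum_(k < n) _.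
  have : dl n.+1 <= e / 4 * 2^-1 ^+ n.+2.
    rewrite /dl (_ : e / 8 = e / 4 * 2^-1); last by field.
    rewrite -mulrA ler_pM2l ?divr_gt0// [leRHS]exprS ler_pM2l//.
    by rewrite lerXn2r// ?nnegrE ?invr_ge0//; lra.
  by rewrite (exprS _ n.+1); lra.
(* Both size estimates of the conclusion are contained here: y = zs gives |zs - zb|^2 <= e / 2, and
   general y gives near-maximality of zs for f. *)
have boundP y : A y -> f y <= f zs - 2^-1 * ip (zs - zb) (zs - zb) + e / 4.
  move=> Ay; apply/ler_addgt0Pr => r r0.
  suff : f y <= f zs + r - (2^-1 * ip zs zs - 2 * ip zs bs + 2 * ip bs bs) + e / 4.
    by have := halfQ zs; lra.
  have i2 : 2 = (2^-1)^-1 :> R by rewrite invrK.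
  apply: (ler_lim (fun n => f y)
    (fun n => f zs + r - (a n.+1 * ip (z n.+1) (z n.+1) - 2 * ip (z n.+1) (b n.+1) +
       (a n.+1)^-1 * ip (b n.+1) (b n.+1)) + e / 4)).
  - exact: cvg_cst.
  - apply: cvgD; last exact: cvg_cst.
    apply: cvgB; first exact: cvg_cst.
    rewrite (cvg_shiftS (fun n => a n * ip (z n) (z n) - 2 * ip (z n) (b n) +
       (a n)^-1 * ip (b n) (b n))).
    apply: cvgD; first apply: cvgB.
    + by apply: cvgM => //; exact: ip_cvg.
    + by apply: cvgM; [exact: cvg_cst|exact: ip_cvg].
    + apply: cvgM; last exact: ip_cvg.
      by rewrite [X in _ --> X]i2; apply: cvgV => //; rewrite invr_neq0.
  - apply: filterS (f_nearS r r0) => n h1.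
    have := supP n.+1 y Ay; have := c_ge n; rewrite /G.
    have : 0 <= e / 4 * 2^-1 ^+ n.+2.
      by rewrite mulr_ge0 ?exprn_ge0 ?invr_ge0// divr_ge0// ltW.
    by lra.
exists zs, zb; split => //.
- by have := boundP zs Azs; have := ip_ge0 hE (zs - zb); lra.
- by move=> y Ay; have := e_gt0; have := boundP y Ay; have := ip_ge0 hE (zs - zb); lra.
Qed.

End borwein_preiss.

(** * Products, L^2, R^d and space-time as instances *)

Section hilbertian_instances.
Context {R : realType}.

Lemma hilbertian_prod (E F : normedModType R) ipE ipF :
  @hilbertian R E ipE -> @hilbertian R F ipF ->
  @hilbertian R (E * F)%type (fun z z' => ipE z.1 z'.1 + ipF z.2 z'.2).
Proof.
move=> hE hF; split.
- by move=> x y; rewrite (ipC hE) (ipC hF).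
- by move=> x y z /=; rewrite (ipDl hE) (ipDl hF) addrACA.
- by move=> a x z /=; rewrite (ipZl hE) (ipZl hF) mulrDr.
- have [k k0 kP] := ip_norm hE; have [l l0 lP] := ip_norm hF.
  exists (k + l); first exact: addr_gt0.
  move=> [x y] /=; have [kx1 kx2] := kP x; have [ly1 ly2] := lP y.
  have Qx := ip_ge0 hE x; have Qy := ip_ge0 hF y.
  rewrite prod_normE /=.
  have nx : `|x| <= Num.max `|x| `|y| by rewrite le_max lexx.
  have ny : `|y| <= Num.max `|x| `|y| by rewrite le_max lexx orbT.
  have nx2 : `|x| ^+ 2 <= Num.max `|x| `|y| ^+ 2.
    by rewrite ler_pXn2r ?nnegrE//; apply: le_trans nx.
  have ny2 : `|y| ^+ 2 <= Num.max `|x| `|y| ^+ 2.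
    by rewrite ler_pXn2r ?nnegrE//; apply: le_trans ny.
  have mxy : Num.max `|x| `|y| ^+ 2 <= `|x| ^+ 2 + `|y| ^+ 2.
    by have [_|_] := leP `|x| `|y|; rewrite ?lerDl ?lerDr sqr_ge0.
  by split; nra.
- move=> u C uC.
  have [|l [C1 lP]] := ip_complete hE (fun n => (u n).1) C.
    by move=> n; apply: le_trans (uC n); rewrite lerDl (ip_ge0 hF).
  have [|m [C2 mP]] := ip_complete hF (fun n => (u n).2) C.
    by move=> n; apply: le_trans (uC n); rewrite lerDr (ip_ge0 hE).
  exists (l, m), (C1 + C2) => n; rewrite mulrDl.
  by apply: lerD; [exact: lP|exact: mP].
Qed.

(** Completeness passes to a retract: the limit of j u in V is sent back by the contraction p. Thus
    R^d is complete as the constants of L^2, retracted by the mean, and R as the row vectors of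
    length one. *)
Lemma hilbertian_retract (V E : normedModType R) ipV ipE
    (j : E -> V) (p : V -> E) :
  @hilbertian R V ipV -> cancel j p ->
  (forall x y, j (x - y) = j x - j y) -> (forall x y, p (x - y) = p x - p y) ->
  (forall x y, ipE x y = ipV (j x) (j y)) ->
  (forall v, ipE (p v) (p v) <= ipV v v) ->
  (forall x y z, ipE (x + y) z = ipE x z + ipE y z) ->
  (forall a x z, ipE (a *: x) z = a * ipE x z) ->
  (exists2 k, 0 < k &
    forall x, ipE x x <= k * `|x| ^+ 2 /\ `|x| ^+ 2 <= k * ipE x x) ->
  @hilbertian R E ipE.
Proof.
move=> hV jp jB pB ipj ipp eD eZ en; split => //.
  by move=> x y; rewrite !ipj (ipC hV).
move=> u C uC; have [|l [C' lP]] := ip_complete hV (j \o u) C.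
  by move=> n /=; rewrite -jB -ipj.
exists (p l), C' => n; rewrite -[X in X - _](jp (u n)) -pB.
exact: le_trans (ipp _) (lP n).
Qed.

End hilbertian_instances.

Section L2_hilbertian.
Context {R : realType} {d : nat}.
Local Notation V := (L2 R d).
Local Notation lam := (lebesgue_cube R d).
Implicit Types (x y z : V) (p q : 'rV[R]_d).

Lemma L2norm_sqr x : `|x| ^+ 2 = L2dot x x.
Proof. by rewrite sqr_sqrtr// L2dot_ge0. Qed.

Lemma hilbertian_L2 : hilbertian (@L2dot R d).
Proof.
split.
- exact: L2dotC.
- exact: L2dotDl.
- exact: L2dotZl.
- by exists 1 => // x; rewrite L2norm_sqr mul1r.
- exact: L2_geometric_complete.
Qed.

Lemma L2norm_le x r : 0 <= r -> (`|x| <= r) = (L2dot x x <= r ^+ 2).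
Proof. by move=> r0; rewrite -L2norm_sqr ler_pXn2r ?nnegrE. Qed.

Lemma L2cstD p q : L2cst (p + q) = L2cst p + L2cst q.
Proof.
apply/L2P; have h := L2addE (L2cst p) (L2cst q).
apply: filterS2 h (filterI (L2cstE (p + q)) (filterI (L2cstE p) (L2cstE q))).
by move=> i -> [-> [-> ->]].
Qed.

Lemma L2cstZ a p : L2cst (a *: p) = a *: L2cst p.
Proof.
apply/L2P; have h := L2scaleE a (L2cst p).
apply: filterS2 h (filterI (L2cstE (a *: p)) (L2cstE p)).
by move=> i h [-> hp]; rewrite -[a *: L2cst p]/(L2scale a (L2cst p)) h hp.
Qed.

Lemma L2cstN p : L2cst (- p) = - L2cst p.
Proof. by rewrite -scaleN1r L2cstZ scaleN1r. Qed.

Lemma L2cstB p q : L2cst (p - q) = L2cst p - L2cst q.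
Proof. by rewrite L2cstD L2cstN. Qed.

Lemma L2dot_cstl p x : L2dot (L2cst p) x = rVdot p (mean x).
Proof.
apply: eq_bigr => j _; rewrite mxE -RintegralZl//; last first.
  apply/Lfun1_integrable; apply: Lfun_subset12; last exact: L2coord.
  exact: fin_num_measure.
have ij := L2dot_integrable (L2cst p) x j.
congr fine; apply: ae_eq_integral => //.
- exact: measurable_int ij.
- apply/measurable_EFinP; apply: measurable_funM => //.
  exact: measurable_L2coord.
- by apply: filterS (L2cstE p) => i -> _.
Qed.

Lemma rVdot_cst p q : rVdot p q = L2dot (L2cst p) (L2cst q).
Proof.
rewrite L2dot_cstl; congr rVdot; apply/rowP => j; rewrite mxE.
transitivity (\int[lam]_i (cst (q ord0 j) i)).
  rewrite Rintegral_cst// [X in _ * fine X](@probability_setT _ _ _ lam).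
  by rewrite mulr1.
congr fine; apply: ae_eq_integral => //.
- by apply/measurable_EFinP; exact: measurable_cst.
- by apply/measurable_EFinP; exact: measurable_L2coord.
- by apply: filterS (L2cstE q) => i -> _.
Qed.

Lemma rVdot_eq p q : (forall r, rVdot r p = rVdot r q) -> p = q.
Proof.
move=> h; apply/rowP => j; have := h (delta_mx ord0 j).
rewrite /rVdot (bigD1 j)//= [in RHS](bigD1 j)//= !mxE !eqxx !mul1r.
by rewrite !big1 ?addr0// => k kj; rewrite mxE (negPf kj) andbF mul0r.
Qed.

Lemma mean_cst p : mean (L2cst p) = p.
Proof. by apply: rVdot_eq => r; rewrite -L2dot_cstl -rVdot_cst. Qed.

Lemma rVdotDr p q r : rVdot p (q + r) = rVdot p q + rVdot p r.
Proof. by rewrite !rVdot_cst L2cstD L2dotDr. Qed.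

Lemma rVdotZr a p r : rVdot p (a *: r) = a * rVdot p r.
Proof. by rewrite !rVdot_cst L2cstZ L2dotZr. Qed.

Lemma meanD x y : mean (x + y) = mean x + mean y.
Proof. by apply: rVdot_eq => r; rewrite rVdotDr -!L2dot_cstl L2dotDr. Qed.

Lemma meanZ a x : mean (a *: x) = a *: mean x.
Proof. by apply: rVdot_eq => r; rewrite rVdotZr -!L2dot_cstl L2dotZr. Qed.

Lemma meanB x y : mean (x - y) = mean x - mean y.
Proof. by rewrite -scaleN1r meanD meanZ scaleN1r. Qed.

(** Pythagoras for the orthogonal projection of x onto the constants. *)
Lemma mean_contract x : rVdot (mean x) (mean x) <= L2dot x x.
Proof.
have := L2dot_ge0 (x - L2cst (mean x)).
rewrite (ip_sqrB hilbertian_L2) L2dotC L2dot_cstl -rVdot_cst; lra.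
Qed.

Lemma hilbertian_rV : hilbertian (@rVdot R d).
Proof.
apply: (@hilbertian_retract _ V _ (@L2dot R d) _ (@L2cst R d) (@mean R d)).
- exact: hilbertian_L2.
- exact: mean_cst.
- exact: L2cstB.
- exact: meanB.
- exact: rVdot_cst.
- exact: mean_contract.
- by move=> p q r; rewrite !rVdot_cst L2cstD L2dotDl.
- by move=> a p r; rewrite !rVdot_cst L2cstZ L2dotZl.
(* Row vectors carry the maximum norm, whence the factor d; the added 1 serves the reverse
   inequality and positivity. *)
- exists (d%:R + 1) => // q.
  have Q0 : 0 <= rVdot q q by apply: sumr_ge0 => j _; rewrite -expr2 sqr_ge0.
  have coord j : q ord0 j ^+ 2 <= rVdot q q.
    rewrite /rVdot (bigD1 j)//= -expr2 lerDl sumr_ge0// => k _.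
    by rewrite -expr2 sqr_ge0.
  have d0 : 0 <= d%:R :> R by [].
  split.
    have : rVdot q q <= d%:R * `|q| ^+ 2.
      apply: (@le_trans _ _ (\sum_(j < d) `|q| ^+ 2)); last first.
        by rewrite sumr_const card_ord mulr_natl.
      apply: ler_sum => j _.
      rewrite -expr2 -(real_normK (num_real _)) ler_pXn2r ?nnegrE//.
      rewrite {2}/Num.norm /= mx_normrE.
      by apply: (@bigmax_sup _ _ _ _ (ord0, j)).
    by have := sqr_ge0 `|q|; nra.
  rewrite {1}/Num.norm /=; have [->|] := eqVneq (mx_norm q) 0.
    by rewrite expr0n /= mulr_ge0// addr_ge0.
  move=> /mx_norm_neq0[[i j] ->] /=; rewrite real_normK ?num_real// (ord1 i).
  by have := coord j; nra.
Qed.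

End L2_hilbertian.

Lemma hilbertian_R (R : realType) : hilbertian (fun x y : R => x * y).
Proof.
pose j (x : R) : 'rV[R]_1 := const_mx x; pose p (v : 'rV[R]_1) := v ord0 ord0.
apply: (@hilbertian_retract _ 'rV[R]_1 R (@rVdot R 1) _ j p).
- exact: hilbertian_rV.
- by move=> x; rewrite /j /p mxE.
- by move=> x y; apply/rowP => k; rewrite !mxE.
- by move=> x y; rewrite /p !mxE.
- by move=> x y; rewrite /rVdot big_ord1 !mxE.
- by move=> v; rewrite /rVdot big_ord1.
- by move=> x y z; rewrite mulrDl.
- by move=> a x z; rewrite mulrA.
- by exists 1 => // x; rewrite !mul1r real_normK ?num_real// expr2.
Qed.

Lemma hilbertian_spacetime (R : realType) (E : normedModType R) ip :
  @hilbertian R E ip -> @hilbertian R (E * R)%type (spacetime_dot ip).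
Proof. by move=> hE; apply: hilbertian_prod => //; exact: hilbertian_R. Qed.

(** * Reduction to a ball by integer translations *)

Section integer_part.
Context {R : realType} {d : nat}.
Local Notation V := (L2 R d).
Local Notation lam := (lebesgue_cube R d).

Lemma measurable_floor : measurable_fun setT (fun x : R => (Num.floor x)%:~R : R).
Proof.
by apply: nondecreasing_measurable => // x y xy; rewrite ler_int le_floor.
Qed.

(** Subtracting coordinatewise floors leaves fractional parts, and as the total mass is one each
    coordinate contributes at most 1. In place of a compact torus this gives a bounded set meeting
    all classes modulo integer-valued maps. *)
Lemma integer_translate (x : V) : exists2 z : V, integer_valued z &
  L2dot (x + z) (x + z) <= d%:R.
Proof.
pose g (i : cube R d) : 'rV[R]_d := \row_j - (Num.floor (x i ord0 j))%:~R.
have mfl j : measurable_fun setT (fun i : cube R d =>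
    (Num.floor (x i ord0 j))%:~R : R).
  by apply: (measurableT_comp measurable_floor); exact: measurable_L2coord.
have mfrac j : measurable_fun setT (fun i : cube R d =>
    x i ord0 j - (Num.floor (x i ord0 j))%:~R : R).
  by apply: measurable_funB => //; exact: measurable_L2coord.
have frac (t : R) : 0 <= t - (Num.floor t)%:~R <= 1.
  rewrite subr_ge0 floor_le /= lerBlDr addrC ltW//.
  by rewrite -[1]/(1%:~R) -intrD floorD1_gt.
have frac2 j : (\int[lam]_i ((x i ord0 j - (Num.floor (x i ord0 j))%:~R) ^+ 2)%:E
    <= 1)%E.
  apply: (@le_trans _ _ (\int[lam]_i (cst 1%E i))%E).
    apply: ge0_le_integral => //.
    - by move=> i _; rewrite lee_fin sqr_ge0.
    - by apply/measurable_EFinP; exact: measurable_funX.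
    - move=> i _; rewrite /cst -[1%E]/(1%:E) lee_fin /=; have /andP[] := frac (x i ord0 j).
      by move=> h1 h2; rewrite exprn_ile1.
  by rewrite integral_cst// mul1e [leLHS](@probability_setT _ _ _ lam).
(* g is the fractional part of x minus x, a difference of square integrable maps. *)
have gL : g \in @square_integrable R d.
  apply/asboolP => j.
  have fL : (fun i => x i ord0 j - (Num.floor (x i ord0 j))%:~R) \in Lfun lam 2%:E.
    by apply: Lfun2_sqr => //; apply: le_lt_trans (frac2 j) (ltry _).
  have [_ LD] := Lfun_submod_closed lam (lee1n 2).
  rewrite (_ : (fun i => _) = (-1) *: (fun i => x i ord0 j) +
      (fun i => x i ord0 j - (Num.floor (x i ord0 j))%:~R)).
    by apply: LD => //; exact: L2coord.
  by apply/funext => i; rewrite /g mxE !fctE scaleN1r addKr.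
exists (L2class g).
  apply: filterS (L2classE gL) => i -> j.
  by rewrite mxE rpredN intr_int.
rewrite -lee_fin L2dot_coordE.
apply: (@le_trans _ _ (\sum_(j < d) 1)%:E); last first.
  by rewrite lee_fin sumr_const card_ord.
rewrite -sumEFin; apply: lee_sum => j _; apply: le_trans (frac2 j).
rewrite (ae_sqr_integral _ _ _
  (fun i => x i ord0 j - (Num.floor (x i ord0 j))%:~R))//.
  exact: measurable_L2coord.
apply: filterS2 (L2addE x (L2class g)) (L2classE gL) => i -> ->.
by rewrite !mxE.
Qed.

End integer_part.

(** * Quadratic jets and jet solutions *)

Section jets.
Context {R : realType} {E : normedModType R}.
Implicit Types (ip : E -> E -> R) (w : E -> R) (z D : E).

(** Contact from above with a paraboloid of slope D and arbitrary curvature. The class is stable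
    under freezing variables, dilations and adding penalties, which is all that happens to test
    functions below. *)
Definition superjet ip w z D : Prop := exists C : R, \forall y \near z,
  w y <= w z + ip D (y - z) + C * ip (y - z) (y - z).

Definition subjet ip w z D : Prop := exists C : R, \forall y \near z,
  w z + ip D (y - z) - C * ip (y - z) (y - z) <= w y.

Lemma subjetN ip w z D : hilbertian ip ->
  subjet ip (fun y => - w y) z D <-> superjet ip w z (- D).
Proof.
move=> hE; split => -[C h]; exists C; apply: filterS h => y;
  rewrite (ipNl hE); lra.
Qed.

Definition jet_subsolution ip (U : set E) (F : E -> E -> R) w : Prop :=
  forall z D, U z -> superjet ip w z D -> F z D <= 0.

Definition jet_supersolution ip (U : set E) (F : E -> E -> R) w : Prop :=
  forall z D, U z -> subjet ip w z D -> 0 <= F z D.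

Lemma viscosity_jet_sub ip U F w : hilbertian ip ->
  viscosity_subsolution ip U F w -> jet_subsolution ip U F w.
Proof.
move=> hE sub z D Uz [C h].
have := sub _ _ (C1_paraboloid hE D z C U) z Uz.
rewrite subrr scaler0 addr0; apply; apply: filterS h => y.
by rewrite /paraboloid subrr !(ip0r hE); lra.
Qed.

Lemma viscosity_jet_super ip U F w : hilbertian ip ->
  viscosity_supersolution ip U F w -> jet_supersolution ip U F w.
Proof.
move=> hE sub z D Uz [C h].
have := sub _ _ (C1_paraboloid hE D z (- C) U) z Uz.
rewrite subrr scaler0 addr0; apply; apply: filterS h => y.
by rewrite /paraboloid subrr !(ip0r hE); lra.
Qed.

(** A step s D from z raises w by at least s |D|^2 - C s^2 |D|^2 and by at most L s |D|; divide by s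
    |D| and let s tend to 0. *)
Lemma subjet_lipschitz ip w z D (L : R) : hilbertian ip -> 0 <= L ->
  (forall y, w y - w z <= L * Num.sqrt (ip (y - z) (y - z))) ->
  subjet ip w z D -> Num.sqrt (ip D D) <= L.
Proof.
move=> hE L0 wL [C h].
have [D0|D0] := eqVneq (ip D D) 0; first by rewrite D0 sqrtr0.
have Dgt0 : 0 < ip D D by rewrite lt_def D0 ip_ge0.
set n := Num.sqrt (ip D D); have n0 : 0 < n by rewrite sqrtr_gt0.
have nE : ip D D = n ^+ 2 by rewrite sqr_sqrtr ?ip_ge0.
have cv : z + s *: D @[s --> (0 : R)] --> z.
  rewrite -[X in _ --> X](addr0 z); apply: cvgD; first exact: cvg_cst.
  rewrite -[X in _ --> X](scale0r D); apply: cvgZ; first exact: cvg_id.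
  exact: cvg_cst.
have {}h : \forall s \near (0 : R), w z + ip D (z + s *: D - z) -
  C * ip (z + s *: D - z) (z + s *: D - z) <= w (z + s *: D) := cv _ h.
apply/ler_addgt0Pr => r r0.
have [d /= d0 dP] := (nbhs_ballP _ _).1 h.
pose s := Num.min (d / 2) (r / (n * (`|C| + 1))).
have C1 : 0 < `|C| + 1 by rewrite ltr_wpDl.
have s0 : 0 < s by rewrite lt_min !divr_gt0 ?mulr_gt0.
have sd : s < d by rewrite gt_min; apply/orP; left; rewrite ltr_pdivrMr//; lra.
have sr : s * (n * (`|C| + 1)) <= r.
  by rewrite -ler_pdivlMr ?mulr_gt0// ge_min lexx orbT.
have := dP s; rewrite /ball /= sub0r normrN gtr0_norm// => /(_ sd).
have := wL (z + s *: D).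
rewrite addrAC subrr add0r (ip_sqrZ hE) (ipZr hE) nE -exprMn sqrtr_sqr.
rewrite gtr0_norm ?mulr_gt0// => h1 h2.
have CC := ler_norm C.
have : s * n * n <= s * n * L + s * n * (s * (n * (`|C| + 1))).
  have : C * (s * n) ^+ 2 <= (`|C| + 1) * (s * n) ^+ 2.
    by rewrite ler_wpM2r ?sqr_ge0//; lra.
  by lra.
rewrite -mulrDr ler_pM2l ?mulr_gt0// => h3.
by apply: le_trans h3 _; rewrite lerD2l.
Qed.

End jets.

(** * Penalized doubling of the time variable *)

Definition pospart {R : realType} (t : R) := (`|t| + t) / 2.

Lemma pospart_ge0 {R : realType} (t : R) : 0 <= pospart t.
Proof.
by rewrite /pospart divr_ge0// -lerBlDr sub0r -normrN ler_norm.
Qed.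

(** The squared positive part is C^1 with 2-Lipschitz derivative, so a paraboloid touches it from
    above at every point and final-time penalties are compatible with superjets. *)
Lemma pospart_sqr {R : realType} (t u : R) :
  pospart u ^+ 2 <= pospart t ^+ 2 + 2 * pospart t * (u - t) + (u - t) ^+ 2.
Proof.
rewrite /pospart; have [t0|t0] := leP 0 t; have [u0|u0] := leP 0 u.
- by rewrite (ger0_norm t0) (ger0_norm u0); nra.
- by rewrite (ger0_norm t0) (ltr0_norm u0); nra.
- by rewrite (ltr0_norm t0) (ger0_norm u0); nra.
- rewrite (ltr0_norm t0) (ltr0_norm u0) !addNr !mul0r mulr0 mul0r expr0n /=.
  by rewrite !add0r sqr_ge0.
Qed.

Lemma pospart_le0 {R : realType} (t : R) : t <= 0 -> pospart t = 0.
Proof. by move=> t0; rewrite /pospart ler0_norm// addNr mul0r. Qed.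

Lemma continuous_pospart (R : realType) : continuous (@pospart R).
Proof.
move=> t; apply: cvgM; last exact: cvg_cst.
by apply: cvgD; [apply: cvg_norm; exact: cvg_id|exact: cvg_id].
Qed.

Lemma pospart1 (R : realType) : pospart (1 : R) = 1.
Proof. by rewrite /pospart normr1; lra. Qed.

Section time_doubling.
Context {R : realType} {E1 E2 : normedModType R}.
Variables (ip1 : E1 -> E1 -> R) (ip2 : E2 -> E2 -> R).
Hypotheses (h1 : hilbertian ip1) (h2 : hilbertian ip2).
Variables (w1 : E1 * R -> R) (w2 : E2 * R -> R) (T M : R).
Hypothesis w1_buc : buc_on [set z : E1 * R | 0 <= z.2 <= T + 1] w1.
Hypothesis w2_buc : buc_on [set z : E2 * R | 0 <= z.2 <= T + 1] w2.
Hypothesis w1M : forall x t, 0 <= t <= T + 1 -> `|w1 (x, t)| <= M.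
Hypothesis w2M : forall y s, 0 <= s <= T + 1 -> `|w2 (y, s)| <= M.
Variables (P : Type) (psi : P -> E1 * E2 -> R) (m B mu delta : R).
Hypothesis psi_cont : forall pi, continuous (psi pi).
Hypothesis psi_ge : forall pi z, m <= psi pi z.
Hypothesis initB : forall pi x y, w1 (x, 0) - w2 (y, 0) - psi pi (x, y) <= B.
Hypotheses (mu_ge0 : 0 <= mu) (delta_gt0 : 0 < delta).

Local Notation S := ((E1 * R) * (E2 * R))%type.
Let ipS (z z' : S) := spacetime_dot ip1 z.1 z'.1 + spacetime_dot ip2 z.2 z'.2.

Let hS : hilbertian ipS.
Proof.
by apply: hilbertian_prod; exact: hilbertian_spacetime.
Qed.

Let t_cont : continuous (fun z : S => z.1.2).
Proof.
by move=> z; apply: (cvg_comp (fun z : S => z.1) snd); [exact: cvg_fst|exact: cvg_snd].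
Qed.

Let s_cont : continuous (fun z : S => z.2.2).
Proof.
by move=> z; apply: (cvg_comp (fun z : S => z.2) snd); exact: cvg_snd.
Qed.

Let xy_cont : continuous (fun z : S => (z.1.1, z.2.1)).
Proof.
move=> z; apply: cvg_pair.
  by apply: (cvg_comp (fun z : S => z.1) fst); exact: cvg_fst.
by apply: (cvg_comp (fun z : S => z.2) fst); [exact: cvg_snd|exact: cvg_fst].
Qed.

Definition doubled pi (z : S) :=
  w1 z.1 - w2 z.2 - psi pi (z.1.1, z.2.1).

(* The penalties on [t - T]^+ and [s - T]^+ keep the maximum point away from the
   final time T + 1, and the bound at time 0 keeps it away from the initial time;
   the maximum is taken over the parameter pi as well, up to delta. *)
Lemma time_doubling pi0 x0 y0 (t0 : R) : 0 <= t0 <= T ->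
  B + mu * t0 < w1 (x0, t0) - w2 (y0, t0) - psi pi0 (x0, y0) ->
  exists pi (z : S) e1 e2 (tau a b : R),
  [/\ 0 < z.1.2, 0 < z.2.2,
      superjet ipS (doubled pi) z ((e1, tau + mu + a), (e2, b - tau)),
      [/\ ip1 e1 e1 <= delta ^+ 2, ip2 e2 e2 <= delta ^+ 2,
          - delta <= a & - delta <= b] &
      (forall pi', psi pi (z.1.1, z.2.1) <= psi pi' (z.1.1, z.2.1) + delta) /\
      psi pi (z.1.1, z.2.1) <= 2 * M - B].
Proof.
move=> t0T gap; set J0 := w1 (x0, t0) - w2 (y0, t0) - psi pi0 (x0, y0) - mu * t0.
have g0 : 0 < J0 - B by rewrite /J0; lra.
set g := J0 - B in g0.
have T1_ge0 : 0 <= T + 1 by lra.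
(* K exceeds the total penalty at any near-maximum of [Phi]. A weight N = K + 1 then rules out t = T
   + 1, where the positive part equals 1. *)
pose K := 2 * M - m - J0 + 2 * g + 1.
have K0 : 0 < K.
  have /ler_normlP[_ A1] := w1M x0 t0 ltac:(lra).
  have /ler_normlP[A2 _] := w2M y0 t0 ltac:(lra).
  have mt0 : 0 <= mu * t0 by apply: mulr_ge0 => //; lra.
  by have := psi_ge pi0 (x0, y0); move: g0; rewrite /K /g /J0; lra.
pose N := K + 1.
have [_ /(_ (g / 4) ltac:(lra)) [r1 r1_gt0 r1P]] := w1_buc.
have [_ /(_ (g / 4) ltac:(lra)) [r2 r2_gt0 r2P]] := w2_buc.
pose r := Num.min r1 r2.
have r0 : 0 < r by rewrite lt_min r1_gt0.
(* A penalty below K forces (t - s)^2 <= 2 kap K = r^2 / 2, so |t - s| < r, the modulus at which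
   [w1] and [w2] vary by less than g / 4. *)
pose kap := r ^+ 2 / (4 * K).
have kap0 : 0 < kap by rewrite divr_gt0 ?exprn_gt0 ?mulr_gt0.
pose A := [set z : S | 0 <= z.1.2 <= T + 1 /\ 0 <= z.2.2 <= T + 1].
pose pen (z : S) := (z.1.2 - z.2.2) ^+ 2 / (2 * kap) + mu * z.1.2 +
  N * pospart (z.1.2 - T) ^+ 2 + N * pospart (z.2.2 - T) ^+ 2.
pose Phi pi z := doubled pi z - pen z.
have pen_ge0 z : A z -> 0 <= pen z.
  move=> [/andP[z1 _] _]; have N0 : 0 <= N by rewrite /N; lra.
  have q1 : 0 <= (z.1.2 - z.2.2) ^+ 2 / (2 * kap).
    by rewrite mulr_ge0 ?sqr_ge0// invr_ge0; lra.
  have q2 : 0 <= mu * z.1.2 by rewrite mulr_ge0.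
  have q3 := mulr_ge0 N0 (sqr_ge0 (pospart (z.1.2 - T))).
  have q4 := mulr_ge0 N0 (sqr_ge0 (pospart (z.2.2 - T))).
  by rewrite /pen; lra.
have dbl_le pi z : A z -> doubled pi z <= 2 * M - m.
  case: z => [[x t] [y s]] [/= tT sT]; rewrite /doubled /=.
  have /ler_normlP[_ A1] := w1M x t tT; have /ler_normlP[A2 _] := w2M y s sT.
  by have := psi_ge pi (x, y); lra.
have Phi_le pi z : A z -> Phi pi z <= 2 * M - m.
  by move=> Az; have := pen_ge0 z Az; have := dbl_le pi z Az; rewrite /Phi; lra.
pose z0 : S := ((x0, t0), (y0, t0)).
have Az0 : A z0 by rewrite /A /z0 /=; split; lra.
have Phi0 : Phi pi0 z0 = J0.
  rewrite /Phi /pen /z0 /doubled /= subrr expr0n /= mul0r.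
  rewrite pospart_le0; last by lra.
  by rewrite expr0n /= mulr0 /J0; lra.
(* e <= delta^2 keeps the perturbation slopes below delta; 2 e <= delta bounds the loss in the
   parameter, one e for choosing [pi] and one for Borwein-Preiss; e <= g / 8 preserves the gap. *)
pose e := Num.min (delta ^+ 2) (Num.min (delta / 2) (Num.min (g / 8) 1)).
have e0 : 0 < e by rewrite !lt_min exprn_gt0 //= ltr01 andbT !divr_gt0.
have ed2 : e <= delta ^+ 2 by rewrite ge_min lexx.
have ed : e <= delta / 2 by rewrite !ge_min lexx orbT.
have eg : e <= g / 8 by rewrite !ge_min lexx !orbT.
have e1 : e <= 1 by rewrite !ge_min lexx !orbT.
(* The parameter type has no topology, so [pi] is fixed first by a near-maximum over pairs; the
   variational principle is then applied in z alone. *)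
have [] := near_max [set pz : P * S | A pz.2] (fun pz => Phi pz.1 pz.2)
  (2 * M - m) e.
- by exists (pi0, z0).
- by move=> [pi z] /= Az; exact: Phi_le.
- exact: e0.
move=> [pi z1] /= Az1 z1P.
have [zs [zb [Azs Qzs near_opt zsP]]] : exists zs zb : S, [/\ A zs,
    ipS (zs - zb) (zs - zb) <= e, forall y, A y -> Phi pi y <= Phi pi zs + e &
    forall y, A y -> Phi pi y - 2^-1 * ipS (y - zb) (y - zb)
                <= Phi pi zs - 2^-1 * ipS (zs - zb) (zs - zb)].
  apply: (borwein_preiss hS A (Phi pi) (2 * M - m)) => //.
  - have cl (h : S -> R) : continuous h -> closed [set z | 0 <= h z <= T + 1].
      move=> hc; rewrite (_ : [set z | _] = h @^-1` `[0, T + 1]%classic).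
        apply: closed_comp; first by move=> z _; exact: hc.
        exact: itv_closed.
      by apply/seteqP; split => z; rewrite /= in_itv.
    by apply: closedI; exact: cl.
  - by exists z1.
  - exact: Phi_le.
  - move=> z d Az d0.
    have d3 : 0 < d / 3 by rewrite divr_gt0.
    have [_ /(_ _ d3) [k1 k1_gt0 k1P]] := w1_buc.
    have [_ /(_ _ d3) [k2 k2_gt0 k2P]] := w2_buc.
    have rest : {for z, continuous (fun z : S => psi pi (z.1.1, z.2.1) + pen z)}.
      have sq (h : S -> R) : {for z, continuous h} ->
          {for z, continuous (fun z => h z ^+ 2)}.
        by move=> hc; exact: (cvgM hc hc).
      apply: cvgD.
        by apply: (cvg_comp (fun z : S => (z.1.1, z.2.1)) (psi pi));
          [exact: xy_cont|exact: psi_cont].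
      apply: cvgD; first apply: cvgD; first apply: cvgD.
      - by apply: cvgM; [apply: sq; apply: cvgB;
          [exact: t_cont|exact: s_cont]|exact: cvg_cst].
      - by apply: cvgM; [exact: cvg_cst|exact: t_cont].
      - apply: cvgM; first exact: cvg_cst.
        apply: (sq (fun z : S => pospart (z.1.2 - T))).
        apply: (cvg_comp (fun z : S => z.1.2 - T) pospart); last exact: continuous_pospart.
        by apply: cvgB; [exact: t_cont|exact: cvg_cst].
      - apply: cvgM; first exact: cvg_cst.
        apply: (sq (fun z : S => pospart (z.2.2 - T))).
        apply: (cvg_comp (fun z : S => z.2.2 - T) pospart); last exact: continuous_pospart.
        by apply: cvgB; [exact: s_cont|exact: cvg_cst].
    have near_rest : \forall y \near z, `|psi pi (z.1.1, z.2.1) + pen z -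
        (psi pi (y.1.1, y.2.1) + pen y)| < d / 3.
      by move/cvgrPdist_lt : rest; apply.
    have near_k (k : R) : 0 < k -> \forall y \near z, `|z - y| < k.
      by move=> k0; have /cvgrPdist_lt := @cvg_id _ (nbhs z); apply.
    apply: filterS3 near_rest (near_k _ k1_gt0) (near_k _ k2_gt0).
    move=> y /ltr_normlP[j1 j2] zy1 zy2 Ay.
    have : `|w1 z.1 - w1 y.1| < d / 3.
      apply: k1P; [exact: Az.1|exact: Ay.1|].
      by apply: le_lt_trans zy1; rewrite prod_normE /= le_max lexx.
    move=> /ltr_normlP[j3 j4].
    have : `|w2 z.2 - w2 y.2| < d / 3.
      apply: k2P; [exact: Az.2|exact: Ay.2|].
      by apply: le_lt_trans zy2; rewrite [leRHS]prod_normE /= le_max lexx orbT.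
    move=> /ltr_normlP[j5 j6].
    by move: j1 j2; rewrite /Phi /doubled; lra.
have opt pi' z' : A z' -> Phi pi' z' <= Phi pi zs + 2 * e.
  move=> Az'; have := z1P (pi', z') Az'; have := near_opt z1 Az1 => /=.
  by lra.
have PhiJ : J0 - 2 * e <= Phi pi zs by rewrite -Phi0; have := opt pi0 z0 Az0; lra.
have penK : pen zs <= K - g.
  by have := dbl_le pi zs Azs; move: PhiJ; rewrite /Phi /K; lra.
move: (Azs); rewrite /A /=.
case: zs Azs Qzs near_opt zsP opt PhiJ penK => [[x t] [y s]] /= Azs Qzs near_opt
  zsP opt PhiJ penK [/andP[t_ge0 t_le] /andP[s_ge0 s_le]].
have NP : 0 < N by rewrite /N; lra.
have pen_parts : [/\ (t - s) ^+ 2 / (2 * kap) <= K - g,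
    N * pospart (t - T) ^+ 2 <= K - g & N * pospart (s - T) ^+ 2 <= K - g].
  have q1 : 0 <= (t - s) ^+ 2 / (2 * kap).
    by rewrite mulr_ge0 ?sqr_ge0// invr_ge0; lra.
  have q2 : 0 <= mu * t by rewrite mulr_ge0.
  have q3 : 0 <= N * pospart (t - T) ^+ 2 by rewrite mulr_ge0 ?sqr_ge0// ltW.
  have q4 : 0 <= N * pospart (s - T) ^+ 2 by rewrite mulr_ge0 ?sqr_ge0// ltW.
  move: penK; rewrite /pen /=; clear -q1 q2 q3 q4 => penK; split; lra.
have [ts_le Nt Ns] := pen_parts.
have t_lt : t < T + 1.
  rewrite lt_neqAle t_le andbT; apply/eqP => tE; move: Nt.
  rewrite tE (_ : T + 1 - T = 1); last by ring.
  by rewrite pospart1 expr1n /N; lra.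
have s_lt : s < T + 1.
  rewrite lt_neqAle s_le andbT; apply/eqP => sE; move: Ns.
  rewrite sE (_ : T + 1 - T = 1); last by ring.
  by rewrite pospart1 expr1n /N; lra.
have ts_r : `|t - s| < r.
  rewrite -(@ltr_pXn2r _ 2) ?nnegrE//; last exact: ltW.
  rewrite real_normK ?num_real//.
  have kk : 0 < 2 * kap by rewrite mulr_gt0.
  move: ts_le; rewrite ler_pdivrMr// => ts_le.
  apply: le_lt_trans ts_le _.
  rewrite /kap (_ : (K - g) * _ = r ^+ 2 * ((K - g) / K) / 2); last first.
    by field; rewrite gt_eqF.
  have : (K - g) / K <= 1 by rewrite ler_pdivrMr// mul1r; lra.
  by have := exprn_gt0 2 r0; nra.
have rr1 : r <= r1 by rewrite ge_min lexx.
have rr2 : r <= r2 by rewrite ge_min lexx orbT.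
(* If t = 0 then s < r, and replacing s by 0 costs less than g / 4. The initial bound then caps the
   maximum at B + g / 4, below the value B + g - 2 e attained. *)
have t_gt0 : 0 < t.
  rewrite lt_neqAle t_ge0 andbT eq_sym; apply/eqP => tE.
  have : `|w2 (y, s) - w2 (y, 0)| < g / 4.
    apply: r2P; rewrite /= ?s_ge0 ?s_le ?lexx//.
    rewrite prod_normE /= subrr normr0 subr0 gt_max r2_gt0 /=.
    by move: ts_r; rewrite tE sub0r normrN; lra.
  move=> /ltr_normlP[j1 j2]; have := initB pi x y; move: PhiJ.
  have := pen_ge0 _ Azs; rewrite /Phi /doubled /= tE /g.
  by move: eg j1 j2; rewrite /g; lra.
have s_gt0 : 0 < s.
  rewrite lt_neqAle s_ge0 andbT eq_sym; apply/eqP => sE.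
  have : `|w1 (x, t) - w1 (x, 0)| < g / 4.
    apply: r1P; rewrite /= ?t_ge0 ?t_le ?lexx//.
    rewrite prod_normE /= subrr normr0 subr0 gt_max r1_gt0 /=.
    by move: ts_r; rewrite sE subr0; lra.
  move=> /ltr_normlP[j1 j2]; have := initB pi x y; move: PhiJ.
  have := pen_ge0 _ Azs; rewrite /Phi /doubled /= sE /g.
  by move: eg j1 j2; rewrite /g; lra.
pose tau := (t - s) / kap.
case: zb Qzs zsP => [[xb tb] [yb sb]] Qzs zsP.
exists pi, ((x, t), (y, s)), (x - xb), (y - yb), tau.
(* Derivatives of the final-time penalties, which are nonnegative, plus the time components of the
   Borwein-Preiss slope; hence both are at least -delta. *)
exists (2 * N * pospart (t - T) + (t - tb)), (2 * N * pospart (s - T) + (s - sb)).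
have Qsum : ip1 (x - xb) (x - xb) + (t - tb) ^+ 2 +
    (ip2 (y - yb) (y - yb) + (s - sb) ^+ 2) <= e by move: Qzs.
have Q1 := ip_ge0 h1 (x - xb); have Q2 := ip_ge0 h2 (y - yb).
have Q3 := sqr_ge0 (t - tb); have Q4 := sqr_ge0 (s - sb).
split => //=.
- exists (2^-1 + kap^-1 + N).
  have nearA : \forall z \near (((x, t), (y, s)) : S), A z.
    have near_itv (h : S -> R) : continuous h ->
        0 < h ((x, t), (y, s)) < T + 1 ->
        \forall z \near (((x, t), (y, s)) : S), 0 <= h z <= T + 1.
      move=> hc /andP[k1 k2].
      have l1 : \forall z \near (((x, t), (y, s)) : S), 0 < h z.
        exact: (cvgr_gt _ (hc ((x, t), (y, s)))).
      have l2 : \forall z \near (((x, t), (y, s)) : S), h z < T + 1.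
        exact: (cvgr_lt _ (hc ((x, t), (y, s)))).
      by apply: filterS2 l1 l2 => z l1 l2; rewrite !ltW.
    apply: filterI; apply: near_itv => //=; first by rewrite t_gt0.
    by rewrite s_gt0.
  apply: filterS nearA => -[[x' t'] [y' s']] Az'.
  have := zsP _ Az'; rewrite /Phi.
  have -> : (x', t', (y', s')) - (xb, tb, (yb, sb)) =
    ((x, t, (y, s)) - (xb, tb, (yb, sb))) +
    ((x', t', (y', s')) - (x, t, (y, s))) by rewrite [RHS]addrC addrA subrK.
  set d1 := (x, t, (y, s)) - (xb, tb, (yb, sb)).
  set d2 := (x', t', (y', s')) - (x, t, (y, s)).
  rewrite (ip_sqrD hS) => hmax.
  have pt := ler_wpM2l (ltW NP) (pospart_sqr (t - T) (t' - T)).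
  have ps := ler_wpM2l (ltW NP) (pospart_sqr (s - T) (s' - T)).
  rewrite (_ : t' - T - (t - T) = t' - t) in pt; last by ring.
  rewrite (_ : s' - T - (s - T) = s' - s) in ps; last by ring.
  have quad : (t' - s') ^+ 2 / (2 * kap) <= (t - s) ^+ 2 / (2 * kap) +
      tau * (t' - t) - tau * (s' - s) + kap^-1 * (t' - t) ^+ 2 + kap^-1 * (s' - s) ^+ 2.
    rewrite /tau invfM !mulrA.
    set ik := kap^-1; have ik0 : 0 < ik by rewrite invr_gt0.
    have : 0 <= ik * ((t' - t) + (s' - s)) ^+ 2 by rewrite mulr_ge0 ?sqr_ge0// ltW.
    by lra.
  have q1 := ip_ge0 h1 (x' - x); have q2 := ip_ge0 h2 (y' - y).
  have ikN : 0 <= kap^-1 + N.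
    by apply: addr_ge0; [rewrite invr_ge0|]; exact: ltW.
  have k1 : 0 <= (kap^-1 + N) * ip1 (x' - x) (x' - x).
    exact: mulr_ge0.
  have k2 : 0 <= (kap^-1 + N) * ip2 (y' - y) (y' - y).
    exact: mulr_ge0.
  move: hmax; rewrite /d1 /d2 /ipS /spacetime_dot /pen /=.
  by lra.
- have NT := mulr_ge0 (ltW NP) (pospart_ge0 (t - T)).
  have NS := mulr_ge0 (ltW NP) (pospart_ge0 (s - T)).
  clear -Qsum Q1 Q2 Q3 Q4 ed2 delta_gt0 NT NS.
  have aux (u : R) : u ^+ 2 <= delta ^+ 2 -> - delta <= u.
    move=> u2; suff /ler_normlP[] : `|u| <= delta by lra.
    rewrite -(@ler_pXn2r _ 2) ?nnegrE//; last exact: ltW.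
    by rewrite real_normK ?num_real.
  have dt : - delta <= t - tb by apply: aux; lra.
  have ds : - delta <= s - sb by apply: aux; lra.
  by split; lra.
- split.
  + move=> pi'; have := opt pi' _ Azs; rewrite /Phi /doubled /=; lra.
  + have /ler_normlP[_ A1] := w1M x t ltac:(lra).
    have /ler_normlP[A2 _] := w2M y s ltac:(lra).
    have := pen_ge0 _ Azs; move: PhiJ eg; rewrite /Phi /doubled /= /g; lra.
Qed.

End time_doubling.

(** * Hilbert norms, operations on jets, perturbed maxima *)

Section hilbert_norm.
Context {R : realType} {E : normedModType R} (ip : E -> E -> R).
Implicit Types x y z : E.

Definition hnorm x := Num.sqrt (ip x x).

Hypothesis hE : hilbertian ip.

Lemma hnorm_ge0 x : 0 <= hnorm x. Proof. exact: sqrtr_ge0. Qed.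

Lemma hnorm_sqr x : hnorm x ^+ 2 = ip x x.
Proof. by rewrite sqr_sqrtr// (ip_ge0 hE). Qed.

Lemma hnorm_le x r : 0 <= r -> (hnorm x <= r) = (ip x x <= r ^+ 2).
Proof. by move=> r0; rewrite -hnorm_sqr ler_pXn2r ?nnegrE ?hnorm_ge0. Qed.

Lemma hnormN x : hnorm (- x) = hnorm x.
Proof. by rewrite /hnorm (ip_sqrN hE). Qed.

Lemma hnormZ a x : hnorm (a *: x) = `|a| * hnorm x.
Proof. by rewrite /hnorm (ip_sqrZ hE) sqrtrM ?sqr_ge0// sqrtr_sqr. Qed.

Lemma hnorm0 : hnorm 0 = 0.
Proof. by rewrite /hnorm (ip0l hE) sqrtr0. Qed.

Lemma hnorm_cs x y : ip x y <= hnorm x * hnorm y.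
Proof.
apply: le_trans (ler_norm _) _.
rewrite -(@ler_pXn2r _ 2) ?nnegrE ?mulr_ge0 ?hnorm_ge0//.
by rewrite -normrX ger0_norm ?sqr_ge0// exprMn !hnorm_sqr ip_cauchy_schwarz.
Qed.

Lemma hnormD x y : hnorm (x + y) <= hnorm x + hnorm y.
Proof.
rewrite hnorm_le ?addr_ge0 ?hnorm_ge0// (ip_sqrD hE) -!hnorm_sqr.
by have := hnorm_cs x y; nra.
Qed.

Lemma hnormB x y : hnorm (x - y) <= hnorm x + hnorm y.
Proof. by rewrite -(hnormN y) hnormD. Qed.

Lemma hnormBC x y : hnorm (x - y) = hnorm (y - x).
Proof. by rewrite -hnormN opprB. Qed.

Lemma hnorm_gt0 x : x != 0 -> 0 < hnorm x.
Proof.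
move=> x0; rewrite lt_neqAle hnorm_ge0 andbT eq_sym.
apply: contra_neq x0 => h; apply: (ip_eq0 hE).
by rewrite -hnorm_sqr h expr0n.
Qed.

End hilbert_norm.

Section jet_calculus.
Context {R : realType}.

(** In use, f is the doubled function with all variables but one frozen and G the gradient of the
    penalties in that variable; a jet of f is thereby turned into one of the solution g. *)
Lemma superjet_le (E : normedModType R) ip (f g : E -> R) z D G (C : R) :
  @hilbertian R E ip -> superjet ip f z D ->
  (forall y, g y - g z <= f y - f z + ip G (y - z) + C * ip (y - z) (y - z)) ->
  superjet ip g z (D + G).
Proof.
move=> hE [C' h] gf; exists (C + C'); apply: filterS h => y hy.
by have := gf y; rewrite (ipDl hE D); lra.
Qed.

Lemma subjet_le (E : normedModType R) ip (f g : E -> R) z D G (C : R) :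
  @hilbertian R E ip -> superjet ip f z D ->
  (forall y, g z - g y <= f y - f z + ip G (y - z) + C * ip (y - z) (y - z)) ->
  subjet ip g z (- (D + G)).
Proof.
move=> hE [C' h] gf; exists (C + C'); apply: filterS h => y hy.
by have := gf y; rewrite (ipNl hE (D + G)) (ipDl hE D); lra.
Qed.

Section slices.
Variables (E F : normedModType R) (ipE : E -> E -> R) (ipF : F -> F -> R).
Hypotheses (hE : hilbertian ipE) (hF : hilbertian ipF).
Let ipEF (z z' : E * F) := ipE z.1 z'.1 + ipF z.2 z'.2.

Lemma superjet_slicel w x y D : superjet ipEF w (x, y) D ->
  superjet ipE (fun x' => w (x', y)) x D.1.
Proof.
move=> [C h]; exists C.
have cv : (x', y) @[x' --> x] --> (x, y).
  by apply: cvg_pair; [exact: cvg_id|exact: cvg_cst].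
have h' : \forall x' \near x, w (x', y) <= w (x, y) +
    ipEF D ((x', y) - (x, y)) + C * ipEF ((x', y) - (x, y)) ((x', y) - (x, y)) :=
  cv _ h.
apply: filterS h' => x'.
by rewrite /ipEF /= subrr !(ip0r hF) !addr0.
Qed.

Lemma superjet_slicer w x y D : superjet ipEF w (x, y) D ->
  superjet ipF (fun y' => w (x, y')) y D.2.
Proof.
move=> [C h]; exists C.
have cv : (x, y') @[y' --> y] --> (x, y).
  by apply: cvg_pair; [exact: cvg_cst|exact: cvg_id].
have h' : \forall y' \near y, w (x, y') <= w (x, y) +
    ipEF D ((x, y') - (x, y)) + C * ipEF ((x, y') - (x, y)) ((x, y') - (x, y)) :=
  cv _ h.
apply: filterS h' => y'.
by rewrite /ipEF /= subrr !(ip0r hE) !add0r.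
Qed.

End slices.

(** Replaces an attained maximum: D is the slope zs - zb of the Borwein-Preiss paraboloid. *)
Lemma perturbed_max (E : normedModType R) ip (w : E -> R) (M e : R) :
  @hilbertian R E ip -> continuous w -> (forall z, w z <= M) -> 0 < e ->
  exists z D, [/\ superjet ip w z D, ip D D <= e & forall y, w y <= w z + e].
Proof.
move=> hE wc wM e0.
have [|||zs [zb [_ Qe wle h]]] := borwein_preiss hE setT w M e closedT _ _ _ e0.
- by exists 0.
- by [].
- move=> z r _ r0; have /cvgrPdist_lt /(_ r r0) := wc z.
  by apply: filterS => y /ltr_normlP[h1 h2] _; lra.
exists zs, (zs - zb); split => //; last by move=> y; exact: wle.
exists 2^-1; apply: nearW => y.
have := h y Logic.I.
have -> : y - zb = (zs - zb) + (y - zs) by rewrite [RHS]addrC addrA subrK.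
by rewrite (ip_sqrD hE); lra.
Qed.

End jet_calculus.

(** * A Lipschitz bound from a gradient bound on jets *)

Section lipschitz_from_jets.
Context {R : realType} {E : normedModType R} (ip : E -> E -> R).
Hypothesis hE : hilbertian ip.
Local Notation nrm := (hnorm ip).
Variables (v : E -> R) (M rho : R).
Hypotheses (vc : continuous v) (vM : forall y, `|v y| <= M) (rho_ge0 : 0 <= rho).
Hypothesis jet_le : forall y D, superjet ip v y D -> nrm D <= rho.

(* Maximizing v - |. - y0|^2 / (2 a) with a = |y - y0| / k yields a point where the
   gradient of the paraboloid is at most rho + 1. *)
Lemma lipschitz_halving (k : R) : 0 < k ->
  (forall y y0, v y - v y0 <= k * nrm (y - y0)) ->
  forall y y0, v y - v y0 <= (k / 2 + rho + 1) * nrm (y - y0).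
Proof.
move=> k0 vk y y0.
have [->|yy0] := eqVneq y y0; first by rewrite !subrr (hnorm0 _ hE) mulr0.
have r0 : 0 < nrm (y - y0) by apply: (hnorm_gt0 _ hE); rewrite subr_eq0.
set r := nrm (y - y0) in r0 *.
(* With this a the paraboloid costs k r / 2 at y, while k |z - y0| <= (rho + 1) r; the sum is the
   new constant times r. *)
pose a := r / k; have a0 : 0 < a by rewrite divr_gt0.
pose w z := v z - (2 * a)^-1 * ip (z - y0) (z - y0).
have ia0 : 0 < (2 * a)^-1 by rewrite invr_gt0 mulr_gt0.
apply/ler_addgt0Pr => e' e'0.
pose e := Num.min e' 1.
have e0 : 0 < e by rewrite lt_min e'0 ltr01.
have ee' : e <= e' by rewrite ge_min lexx.
have e1 : e <= 1 by rewrite ge_min lexx orbT.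
have wc : continuous w.
  move=> z; apply: cvgB; first exact: vc.
  by apply: cvgM; [exact: cvg_cst|exact: (ip_sqr_continuous hE y0 z)].
have wM z : w z <= M.
  have /ler_normlP[_ h] := vM z; have := ip_ge0 hE (z - y0); rewrite /w.
  by move=> q; have := mulr_ge0 (ltW ia0) q; lra.
have [z [D [jD De wle]]] := perturbed_max _ _ w M e hE wc wM e0.
have jv : superjet ip v z (D + a^-1 *: (z - y0)).
  apply: (superjet_le _ _ w v z D _ (2 * a)^-1 hE jD) => z'.
  rewrite /w; have -> : z' - y0 = (z - y0) + (z' - z).
    by rewrite [RHS]addrC addrA subrK.
  rewrite (ip_sqrD hE) (ipZl hE) invfM.
  set i := a^-1; set q := ip (z - y0) (z' - z).
  by lra.
have D1 : nrm D <= 1 by rewrite (hnorm_le _ hE)// expr1n; apply: le_trans De e1.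
have zy0 : nrm (z - y0) <= (rho + 1) * a.
  rewrite mulrC -ler_pdivrMl//.
  have -> : a^-1 * nrm (z - y0) = nrm (a^-1 *: (z - y0)).
    by rewrite (hnormZ _ hE) gtr0_norm ?invr_gt0.
  rewrite -(addKr D (a^-1 *: _)) addrC; apply: le_trans (hnormB _ hE _ _) _.
  by apply: lerD => //; exact: jet_le jv.
have := wle y; rewrite /w -(hnorm_sqr _ hE) -/r -(hnorm_sqr _ hE) => h.
have ra : (2 * a)^-1 * r ^+ 2 = k / 2 * r.
  by rewrite /a; field; rewrite !gt_eqF.
have ka : k * ((rho + 1) * a) = (rho + 1) * r.
  by rewrite /a; field; rewrite gt_eqF.
have := vk z y0; have := sqr_ge0 (nrm (z - y0)).
rewrite ra in h.
have : k * nrm (z - y0) <= k * ((rho + 1) * a) by rewrite ler_pM2l.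
rewrite ka.
have : 0 <= (2 * a)^-1 * nrm (z - y0) ^+ 2 by rewrite mulr_ge0 ?sqr_ge0 ?ltW.
move: h; lra.
Qed.

(** The halving step is iterated: 2 (rho + 1) is the fixed point of k -> k / 2 + rho + 1, and the
    result no longer depends on the initial k. *)
Lemma lipschitz_of_jets (k : R) : 0 < k ->
  (forall y y0, v y - v y0 <= k * nrm (y - y0)) ->
  forall y y0, v y - v y0 <= 2 * (rho + 1) * nrm (y - y0).
Proof.
move=> k0 vk y y0.
have it n : forall y y0, v y - v y0 <= (2 * (rho + 1) + k * 2^-1 ^+ n) * nrm (y - y0).
  elim: n => [|n IH] x x0.
    apply: le_trans (vk x x0) _; rewrite ler_wpM2r ?hnorm_ge0// expr0 mulr1.
    by move: rho_ge0; lra.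
  have := lipschitz_halving _ _ IH x x0.
  rewrite (_ : _ / 2 + rho + 1 = 2 * (rho + 1) + k * 2^-1 ^+ n.+1).
    by apply; rewrite ltr_wpDr// ?mulr_gt0 ?ltr_wpDl// mulr_ge0 ?exprn_ge0 ?ltW.
  by rewrite exprS; field.
have cv : (fun n => (2 * (rho + 1) + k * 2^-1 ^+ n) * nrm (y - y0)) @ \oo -->
    (2 * (rho + 1) + k * 0) * nrm (y - y0).
  apply: cvgM; last exact: cvg_cst.
  apply: cvgD; first exact: cvg_cst.
  apply: cvgM; first exact: cvg_cst.
  by apply: cvg_expr; rewrite ger0_norm//; lra.
rewrite mulr0 addr0 in cv.
apply: (ler_cvg_to (cvg_cst (v y - v y0)) cv).
by apply: nearW => n; exact: it.
Qed.

End lipschitz_from_jets.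

(** * Local Lipschitz continuity of the effective Hamiltonian *)

Section effective.
Context {R : realType} {E F : normedModType R}.
Variables (ip : E -> E -> R) (ipF : F -> F -> R) (j : F -> E).
Hypotheses (hE : hilbertian ip) (jB : forall p q, j (p - q) = j p - j q).
Local Notation nrm := (hnorm ip).
Variables (H : E -> E -> R) (Hbar : F -> R).

(** The cell problem in jet form, with boundedness standing for periodicity. *)
Definition corrector (p : F) (c : R) (v : E -> R) : Prop :=
  [/\ continuous v,
      exists M, forall y, `|v y| <= M,
      exists k, forall y y0, v y - v y0 <= k * nrm (y - y0),
      forall y D, superjet ip v y D -> H y (j p + D) <= c &
      forall y D, subjet ip v y D -> c <= H y (j p + D)].

Hypothesis H_bounded : forall r, exists2 M, 0 < M &
  forall x p, nrm p <= r -> `|H x p| <= M.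
Hypothesis H_lipschitz_x : exists2 Lx, 0 < Lx & forall x y p,
  `|H x p - H y p| <= Lx * (1 + nrm p) * nrm (x - y).
Hypothesis H_lipschitz_p : forall r, 0 < r -> exists2 Lr, 0 < Lr &
  forall x p q, nrm p < r -> nrm q < r -> `|H x p - H x q| <= Lr * nrm (p - q).
Hypothesis H_coercive : forall M, exists2 r, 0 < r &
  forall x p, H x p <= M -> nrm p <= r.
Hypothesis Hbar_corrector : forall p, exists v, corrector p (Hbar p) v.

(** The cell equation is read at a perturbed minimum of the corrector, where the gradient has norm
    at most 1. *)
Lemma effective_le (r : R) : exists2 M, 0 < M &
  forall p, nrm (j p) <= r -> Hbar p <= M.
Proof.
have [M M0 HM] := H_bounded (r + 1); exists M; first exact: M0.
move=> p pr.
have [v [vc [Mv vM] _ _ vsup]] := Hbar_corrector p.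
have vNc : continuous (fun y => - v y).
  by move=> y; apply: cvgN; exact: vc.
have vNM y : - v y <= Mv by have /ler_normlP[] := vM y.
have [z [D [jD De _]]] := perturbed_max _ _ _ _ 1 hE vNc vNM ltr01.
have jv : subjet ip v z (- (D + 0)).
  apply: (subjet_le _ _ _ _ _ _ 0 0 hE jD) => y.
  by rewrite (ip0l hE); lra.
apply: le_trans (vsup _ _ jv) _.
apply: le_trans (ler_norm _) (HM _ _ _).
rewrite addr0; apply: le_trans (hnormB _ hE _ _) _; apply: lerD => //.
by rewrite (hnorm_le _ hE)// expr1n.
Qed.

(* Doubling the variables between correctors of slopes p and q; coercivity bounds
   the gradient X of the penalty. *)
Lemma effective_lipschitz (r : R) : exists2 C, 0 < C &
  forall p q, nrm (j p) <= r -> nrm (j q) <= r -> Hbar q - Hbar p <= C * nrm (j (q - p)).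
Proof.
have [M M0 HbM] := effective_le r.
have [rho rho0 Hrho] := H_coercive M.
have [Lx Lx0 HLx] := H_lipschitz_x.
pose r1 := rho + 2 * `|r| + 3.
have r1_gt0 : 0 < r1 by rewrite /r1; have := normr_ge0 r; lra.
have [Lr Lr0 HLr] := H_lipschitz_p _ r1_gt0.
exists Lr; first exact: Lr0.
move=> p q pr qr.
(* K collects the coefficients of [th] in the final inequality: the perturbations e1, e2 of size
   [th], and |y - xi| <= th (rho + |r| + 1) in the first argument of H. *)
pose K := 2 * Lr + Lx * (1 + rho) * (rho + `|r| + 1) + 1.
have K0 : 0 < K.
  have : 0 <= Lx * (1 + rho) * (rho + `|r| + 1).
    have r_ge0 := normr_ge0 r.
    by apply: mulr_ge0; [apply: mulr_ge0|]; lra.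
  by rewrite /K; lra.
apply/ler_addgt0Pr => e e0.
pose th := Num.min 1 (e / K).
have th0 : 0 < th by rewrite lt_min ltr01 divr_gt0.
have th1 : th <= 1 by rewrite ge_min lexx.
have thK : K * th <= e by rewrite mulrC -ler_pdivlMr// ge_min lexx orbT.
have [v [vc [Mv vM] _ vsub _]] := Hbar_corrector p.
have [v' [vc' [Mv' vM'] _ _ vsup]] := Hbar_corrector q.
have hEE := hilbertian_prod _ _ _ _ hE hE.
pose w (z : E * E) := v z.1 - v' z.2 - (2 * th)^-1 * ip (z.1 - z.2) (z.1 - z.2).
have ith0 : 0 < (2 * th)^-1 by rewrite invr_gt0 mulr_gt0.
have wc : continuous w.
  move=> z.
  have c1 : z'.1 @[z' --> z] --> z.1 by exact: cvg_fst.
  have c2 : z'.2 @[z' --> z] --> z.2 by exact: cvg_snd.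
  apply: cvgB; first apply: cvgB.
  - by apply: (cvg_comp (fun z : E * E => z.1) v c1); exact: vc.
  - by apply: (cvg_comp (fun z : E * E => z.2) v' c2); exact: vc'.
  - apply: cvgM; first exact: cvg_cst.
    by apply: (ip_cvg hE); exact: cvgB.
have wM z : w z <= Mv + Mv'.
  have /ler_normlP[_ h1] := vM z.1; have /ler_normlP[h2 _] := vM' z.2.
  have : 0 <= (2 * th)^-1 * ip (z.1 - z.2) (z.1 - z.2).
    by rewrite mulr_ge0 ?(ip_ge0 hE)// ltW.
  by rewrite /w; lra.
have [[y xi] [[e1 e2] [jw /= De _]]] :=
  perturbed_max _ _ w _ (th ^+ 2) hEE wc wM (exprn_gt0 2 th0).
have Q1 := ip_ge0 hE e1; have Q2 := ip_ge0 hE e2.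
have e1th : nrm e1 <= th.
  by rewrite (hnorm_le _ hE); [lra|exact: ltW].
have e2th : nrm e2 <= th.
  by rewrite (hnorm_le _ hE); [lra|exact: ltW].
pose X := th^-1 *: (y - xi).
have jv : superjet ip v y (e1 + X).
  apply: (superjet_le _ _ _ _ _ _ _ (2 * th)^-1 hE (superjet_slicel _ _ _ _ hE w _ _ _ jw)) => y'.
  rewrite /w /X /=; have -> : y' - xi = (y - xi) + (y' - y).
    by rewrite [RHS]addrC addrA subrK.
  rewrite (ip_sqrD hE (y - xi)) (ipZl hE) invfM; lra.
have jv' : subjet ip v' xi (- (e2 - X)).
  apply: (subjet_le _ _ _ _ _ _ _ (2 * th)^-1 hE (superjet_slicer _ _ _ _ hE w _ _ _ jw)) => y'.
  rewrite /w /X /=; have -> : y - y' = (y - xi) - (y' - xi).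
    by rewrite opprB addrA subrK.
  rewrite (ip_sqrB hE (y - xi)) (ipNl hE (_ *: _)) (ipZl hE) invfM; lra.
have hsub := vsub _ _ jv.
have hsup := vsup _ _ jv'.
set P := j p + (e1 + X) in hsub.
set P' := j q + - (e2 - X) in hsup.
(* The subsolution side alone bounds its momentum, by H y P <= Hbar p <= M; P' follows because X
   cancels in P' - P. *)
have Prho : nrm P <= rho by apply: Hrho (le_trans hsub _); exact: HbM.
have rr := ler_norm r.
have PP : P' - P = j (q - p) - e1 - e2.
  rewrite jB /P /P'; move: (j q) (j p) => a b.
  have -> : a - (e2 - X) = (a - e2) + X by rewrite opprB addrCA addrC.
  have -> : b + (e1 + X) = X + (b + e1) by rewrite addrA addrC.
  by rewrite addrKA opprD addrACA -[RHS]addrA [- e1 - e2]addrC.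
have dPP : nrm (P' - P) <= nrm (j (q - p)) + 2 * th.
  rewrite PP; apply: le_trans (hnormB _ hE _ _) _.
  have := hnormB _ hE (j (q - p)) e1; lra.
have qp : nrm (j (q - p)) <= 2 * `|r|.
  by rewrite jB; apply: le_trans (hnormB _ hE _ _) _; lra.
have Pr1' : nrm P' < r1.
  have -> : P' = P + (P' - P) by rewrite addrCA subrr addr0.
  by apply: le_lt_trans (hnormD _ hE _ _) _; rewrite /r1; lra.
have Pr1 : nrm P < r1 by rewrite /r1; have := normr_ge0 r; lra.
have yxi : nrm (y - xi) <= th * (rho + `|r| + 1).
  have -> : y - xi = th *: X by rewrite /X scalerA divff ?scale1r// gt_eqF.
  rewrite (hnormZ _ hE) gtr0_norm// ler_pM2l//.
  have -> : X = P - (j p + e1) by rewrite /P addrA [_ + X]addrC addrK.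
  apply: le_trans (hnormB _ hE _ _) _; have := hnormD _ hE (j p) e1; lra.
have h1 := HLr xi P' P Pr1' Pr1.
have h2 := HLx xi y P.
have h3 : Lx * (1 + nrm P) * nrm (xi - y) <= Lx * (1 + rho) * (th * (rho + `|r| + 1)).
  rewrite (hnormBC _ hE); apply: ler_pM; rewrite ?hnorm_ge0//.
    by rewrite mulr_ge0 ?ltW// ltr_wpDr ?hnorm_ge0.
  by rewrite ler_pM2l//; lra.
have h4 : Lr * nrm (P' - P) <= Lr * (nrm (j (q - p)) + 2 * th) by rewrite ler_pM2l.
move/ler_normlP : h1 => [_ h1]; move/ler_normlP : h2 => [_ h2].
move: thK; rewrite /K.
by lra.
Qed.

End effective.

Section jet_pullback.
Context {R : realType} {E E' : normedModType R}.
Variables (ip : E -> E -> R) (ip' : E' -> E' -> R).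

(** Here i is an affine similarity: insertion of one variable among frozen ones (c = 1), possibly
    after the dilation y -> eps y (c = eps^2). *)
Lemma superjet_pull (w : E -> R) (i : E' -> E) z D D' (c : R) :
  {for z, continuous i} ->
  (forall y, ip D (i y - i z) = ip' D' (y - z)) ->
  (forall y, ip (i y - i z) (i y - i z) = c * ip' (y - z) (y - z)) ->
  superjet ip w (i z) D -> superjet ip' (fun y => w (i y)) z D'.
Proof.
move=> ic iD iQ [C h]; exists (C * c).
have h' : \forall y \near z, w (i y) <= w (i z) + ip D (i y - i z) +
  C * ip (i y - i z) (i y - i z) := ic _ h.
by apply: filterS h' => y; rewrite iD iQ mulrA.
Qed.

Lemma subjetZ (v : E' -> R) z D (c : R) : hilbertian ip' -> 0 < c ->
  subjet ip' (fun y => c * v y) z (c *: D) -> subjet ip' v z D.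
Proof.
move=> hE' c0 [C h]; exists (C / c); apply: filterS h => y.
rewrite (ipZl hE') -(ler_pM2l c0 _ (v y)) => h.
apply: le_trans h; rewrite le_eqVlt; apply/orP; left; apply/eqP.
by field; rewrite gt_eqF.
Qed.

Lemma superjetN (w : E' -> R) z D : hilbertian ip' ->
  superjet ip' (fun y => - w y) z D <-> subjet ip' w z (- D).
Proof.
move=> hE'; split => -[C h]; exists C; apply: filterS h => y;
  rewrite (ipNl hE'); lra.
Qed.

End jet_pullback.

Lemma subjet_slicel (R : realType) (E F : normedModType R) ipE ipF
    (w : E * F -> R) x y D : @hilbertian R E ipE -> @hilbertian R F ipF ->
  subjet (fun z z' : E * F => ipE z.1 z'.1 + ipF z.2 z'.2) w (x, y) D ->
  subjet ipE (fun x' => w (x', y)) x D.1.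
Proof.
move=> hE hF; have hEF := hilbertian_prod _ _ _ _ hE hF.
rewrite -[D]opprK => /(superjetN _ _ _ _ hEF).
by move=> /(superjet_slicel _ _ _ _ hF)/(superjetN _ _ _ _ hE).
Qed.

(** * Propagation of the initial Lipschitz constant by the effective equation *)

Section effective_solution_lipschitz.
Context {R : realType} {F : normedModType R}.
Variables (ip : F -> F -> R).
Hypothesis hF : hilbertian ip.
Local Notation nrm := (hnorm ip).
Variables (Hb : F -> R) (g : F -> R) (u : F * R -> R) (L : R).
Hypothesis Hb_lipschitz : forall r, exists2 C, 0 < C & forall p q,
  nrm p <= r -> nrm q <= r -> Hb q - Hb p <= C * nrm (q - p).
Hypothesis u_buc : forall T, 0 < T ->
  buc_on [set z : F * R | 0 <= z.2 <= T] u.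
Hypothesis u_sub : jet_subsolution (spacetime_dot ip)
  [set z : F * R | 0 < z.2] (fun z q => q.2 + Hb q.1) u.
Hypothesis u_super : jet_supersolution (spacetime_dot ip)
  [set z : F * R | 0 < z.2] (fun z q => q.2 + Hb q.1) u.
Hypothesis u_init : forall q, u (q, 0) = g q.
Hypothesis L_gt0 : 0 < L.
Hypothesis g_lipschitz : forall q q', g q - g q' <= L * nrm (q - q').

(** Doubling u against itself: Hb does not depend on the position, so both equations hold at the
    same slope p up to e1 and e2, and mu > 0 contradicts them. The bound is Young's inequality for L
    |q - q'|, with equality at a = |q - q'| / L. *)
Let quadratic_estimate (t a : R) q q' : 0 <= t -> 0 < a ->
  u (q, t) - u (q', t) <= L ^+ 2 * a / 2 + (2 * a)^-1 * ip (q - q') (q - q').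
Proof.
move=> t0 a0; apply/ler_addgt0Pr => e e0; rewrite leNgt; apply/negP => gap.
pose T := t + 1; have T0 : 0 < T by rewrite /T; lra.
have T1 : 0 < T + 1 by lra.
pose mu := e / T; have mu0 : 0 < mu by rewrite divr_gt0.
have mut : mu * t <= e.
  by rewrite /mu mulrAC ler_pdivrMr// ler_pM2l// /T; lra.
have buc := u_buc _ T1.
have [M M0 uM] : exists2 M, 0 < M &
    forall x s, 0 <= s <= T + 1 -> `|u (x, s)| <= M.
  have [[M [_ uM]] _] := buc; exists (`|M| + 1); first by rewrite ltr_wpDl.
  move=> x s sT; apply: (uM (`|M| + 1)) => //.
  by have := ler_norm M; lra.
have ia0 : 0 < (2 * a)^-1 by rewrite invr_gt0 mulr_gt0.
pose psi (_ : unit) (z : F * F) := (2 * a)^-1 * ip (z.1 - z.2) (z.1 - z.2).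
pose B := L ^+ 2 * a / 2.
have B0 : 0 <= B by rewrite /B !mulr_ge0 ?sqr_ge0 ?ltW// invr_ge0.
(* The penalty is at most 2 M at the maximum, so |p|^2 <= 4 M / a <= (4 M / a + 1)^2; the remaining
   1 covers e1 and e2. *)
pose r := 4 * M / a + 2.
have [C C0 HbC] := Hb_lipschitz r.
(* Subtracting the two equations leaves mu <= 2 (C + 1) del, which this choice contradicts. *)
pose del := Num.min 1 (mu / (4 * (C + 1))).
have C10 : 0 < 4 * (C + 1) by lra.
have del0 : 0 < del by rewrite lt_min ltr01 divr_gt0.
have del1 : del <= 1 by rewrite ge_min lexx.
have delmu : 4 * (C + 1) * del <= mu.
  by rewrite mulrC -ler_pdivlMr// ge_min lexx orbT.
have psi_cont pi : continuous (psi pi).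
  move=> z; apply: cvgM; first exact: cvg_cst.
  by apply: (ip_cvg hF); apply: cvgB; (exact: cvg_fst || exact: cvg_snd).
have psi_ge pi z : 0 <= psi pi z.
  by rewrite /psi mulr_ge0 ?(ip_ge0 hF)// ltW.
have init pi x y : u (x, 0) - u (y, 0) - psi pi (x, y) <= B.
  rewrite !u_init /psi /= /B; have := g_lipschitz x y.
  rewrite -(hnorm_sqr _ hF); set n := hnorm ip _.
  have : L * n <= L ^+ 2 * a / 2 + (2 * a)^-1 * n ^+ 2.
    have := sqr_ge0 (L * a - n); rewrite sqrrB -(ler_pM2l ia0) mulr0.
    have -> : (2 * a)^-1 * ((L * a) ^+ 2 - L * a * n *+ 2 + n ^+ 2) =
      L ^+ 2 * a / 2 - L * n + (2 * a)^-1 * n ^+ 2 by field; rewrite gt_eqF.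
    by lra.
  by lra.
have gap' : B + mu * t < u (q, t) - u (q', t) - psi tt (q, q').
  by move: gap; rewrite /psi /B /=; lra.
have tT : 0 <= t <= T by rewrite /T; lra.
have [[] [[[x s] [y s']] [e1 [e2 [tau [b1 [b2 [/= s0 s'0 jet [ee1 ee2 hb1 hb2] [_ psiM]]]]]]]]] :=
  time_doubling ip ip hF hF u u T M buc buc uM uM unit psi 0 B mu del
    psi_cont psi_ge init (ltW mu0) del0 tt q q' t tT gap'.
have hS := hilbertian_spacetime _ _ _ hF.
pose p := a^-1 *: (x - y).
have j1 : superjet (spacetime_dot ip) u (x, s) ((e1, tau + mu + b1) + (p, 0)).
  apply: (superjet_le _ _ _ _ _ _ _ (2 * a)^-1 hS
    (superjet_slicel _ _ _ _ hS _ _ _ _ jet)) => -[x' t'].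
  rewrite /doubled /psi /spacetime_dot /p /= (_ : x' - y = (x - y) + (x' - x)); last first.
    by rewrite [RHS]addrC addrA subrK.
  rewrite (ip_sqrD hF (x - y)) (ipZl hF) invfM mul0r addr0.
  have : 0 <= 2^-1 * a^-1 * ((t' - s) * (t' - s)).
    by rewrite -expr2 mulr_ge0 ?sqr_ge0// -invfM ltW.
  by lra.
have j2 : subjet (spacetime_dot ip) u (y, s') (- ((e2, b2 - tau) + (- p, 0))).
  apply: (subjet_le _ _ _ _ _ _ _ (2 * a)^-1 hS
    (superjet_slicer _ _ _ _ hS _ _ _ _ jet)) => -[y' t'].
  rewrite /doubled /psi /spacetime_dot /p /= (_ : x - y' = (x - y) - (y' - y)); last first.
    by rewrite opprB addrA subrK.
  rewrite (ip_sqrB hF (x - y)) (ipNl hF (_ *: _)) (ipZl hF) invfM mul0r addr0.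
  have : 0 <= 2^-1 * a^-1 * ((t' - s') * (t' - s')).
    by rewrite -expr2 mulr_ge0 ?sqr_ge0// -invfM ltW.
  by lra.
have /= h1 := u_sub (x, s) _ s0 j1.
have /= h2 := u_super (y, s') _ s'0 j2.
have n1 : nrm e1 <= del by rewrite (hnorm_le _ hF)// ltW.
have n2 : nrm e2 <= del by rewrite (hnorm_le _ hF)// ltW.
have np : nrm p <= 4 * M / a + 1.
  have Ma : 0 < 4 * M / a by rewrite divr_gt0// mulr_gt0.
  rewrite (hnorm_le _ hF); last by lra.
  rewrite /p (ip_sqrZ hF).
  have : (2 * a)^-1 * ip (x - y) (x - y) <= 2 * M by move: psiM; rewrite /psi /=; lra.
  have -> : a^-1 ^+ 2 * ip (x - y) (x - y) = 2 * a^-1 * ((2 * a)^-1 * ip (x - y) (x - y)).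
    by field; rewrite gt_eqF.
  have i0 : 0 < 2 * a^-1 by rewrite mulr_gt0 ?invr_gt0.
  rewrite -(ler_pM2l i0) => h; apply: le_trans h _.
  have -> : 2 * a^-1 * (2 * M) = 4 * M / a by field; rewrite gt_eqF.
  by nra.
have r1 : nrm (e1 + p) <= r.
  by apply: le_trans (hnormD _ hF _ _) _; rewrite /r; lra.
have r2 : nrm (- (e2 - p)) <= r.
  rewrite (hnormN _ hF); apply: le_trans (hnormB _ hF _ _) _; rewrite /r; lra.
have := HbC _ _ r1 r2.
have -> : - (e2 - p) - (e1 + p) = - (e1 + e2).
  by rewrite -opprD [e2 - p + _]addrC addrACA subrr addr0.
rewrite (hnormN _ hF) => h3.
have h4 : C * nrm (e1 + e2) <= C * (2 * del).
  by rewrite ler_pM2l//; apply: le_trans (hnormD _ hF _ _) _; lra.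
by move: h1 h2; rewrite !addr0; lra.
Qed.

Lemma effective_solution_lipschitz (t : R) q q' : 0 <= t ->
  u (q, t) - u (q', t) <= L * nrm (q - q').
Proof.
move=> t0; have [->|qq'] := eqVneq q q'.
  by rewrite !subrr (hnorm0 _ hF) mulr0.
have n0 : 0 < nrm (q - q') by apply: (hnorm_gt0 _ hF); rewrite subr_eq0.
have a0 : 0 < nrm (q - q') / L by rewrite divr_gt0.
apply: le_trans (quadratic_estimate t _ q q' t0 a0) _.
rewrite -(hnorm_sqr _ hF) le_eqVlt; apply/orP; left; apply/eqP.
by field; rewrite !gt_eqF.
Qed.

End effective_solution_lipschitz.

(** * The one-sided estimate by the perturbed test function *)

Section one_sided_estimate.
Context {R : realType} {E F : normedModType R}.
Variables (ip : E -> E -> R) (ipF : F -> F -> R) (j : F -> E) (m : E -> F).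
Hypotheses (hE : hilbertian ip) (hF : hilbertian ipF).
Hypotheses (jD : forall p q, j (p + q) = j p + j q)
  (jN : forall p, j (- p) = - j p)
  (j_iso : forall p q, ipF p q = ip (j p) (j q)).
Hypotheses (mB : forall x y, m (x - y) = m x - m y)
  (m_adj : forall p x, ip (j p) x = ipF p (m x))
  (m_contract : forall x, ipF (m x) (m x) <= ip x x).
Local Notation nrm := (hnorm ip).

Lemma continuous_contraction : continuous m.
Proof.
have [k k0 kP] := ip_norm hE; have [l l0 lP] := ip_norm hF.
move=> x; apply/cvgrPdist_lt => e e0.
have lk0 : 0 < l * k by rewrite mulr_gt0.
pose c := e / (1 + l * k).
have c0 : 0 < c by rewrite divr_gt0// ltr_wpDr// ltW.
have /cvgrPdist_lt /(_ c c0) := @cvg_id _ (nbhs x).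
apply: filterS => y xy.
rewrite -(@ltr_pXn2r _ 2) ?nnegrE//; last exact: ltW.
have [_ h1] := lP (m x - m y); apply: le_lt_trans h1 _.
rewrite -mB.
have h2 : l * ipF (m (x - y)) (m (x - y)) <= l * (k * `|x - y| ^+ 2).
  rewrite ler_pM2l//; apply: le_trans (m_contract _) _.
  by have [] := kP (x - y).
apply: le_lt_trans h2 _; rewrite mulrA.
have h3 : `|x - y| ^+ 2 < c ^+ 2.
  by rewrite ltr_pXn2r ?nnegrE// ltW.
have h4 : l * k * `|x - y| ^+ 2 < l * k * c ^+ 2 by rewrite ltr_pM2l.
apply: lt_le_trans h4 _.
have -> : e = c * (1 + l * k) by rewrite /c divfK// gt_eqF// ltr_wpDr// ltW.
have := mulr_ge0 (exprn_ge0 2 (ltW c0)) (ltW lk0).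
have := mulr_ge0 (exprn_ge0 2 (ltW c0)) (sqr_ge0 (l * k)).
have := exprn_gt0 2 c0; rewrite [(c * _) ^+ 2]exprMn [l * k * _]mulrC; clearbody c.
by move: (c ^+ 2) (l * k) => a b; lra.
Qed.

Variables (H : E -> E -> R) (Hb : F -> R).
Hypothesis H_lipschitz_x : exists2 Lx, 0 < Lx & forall x y p,
  `|H x p - H y p| <= Lx * (1 + nrm p) * nrm (x - y).
Hypothesis H_lipschitz_p : forall r, 0 < r -> exists2 Lr, 0 < Lr &
  forall x p q, nrm p < r -> nrm q < r -> `|H x p - H x q| <= Lr * nrm (p - q).
(* The second alternative is the first one for the Hamiltonian -H(x,-p). *)
Hypothesis H_coercive :
  (forall M, exists r, forall x p, H x p <= M -> nrm p <= r) \/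
  (forall M, exists r, forall x p, - M <= H x p -> nrm p <= r).
Hypothesis Hb_lipschitz : forall r, exists2 C, 0 < C & forall p q,
  nrm (j p) <= r -> nrm (j q) <= r -> Hb q - Hb p <= C * nrm (j (q - p)).
(** [Cv] bounds the correctors, and [A] is the defect allowed in the cell inequality: 0 for exact
    correctors, a large constant for the zero function. *)
Variables (L Cv A : R).
Hypotheses (L_gt0 : 0 < L) (Cv_ge0 : 0 <= Cv) (A_ge0 : 0 <= A).

Let jB p q : j (p - q) = j p - j q.
Proof. by rewrite jD jN. Qed.

Let j0 : j 0 = 0.
Proof. by rewrite -(subrr 0) jB subrr. Qed.

Let nrmF p : hnorm ipF p = nrm (j p).
Proof. by rewrite /hnorm j_iso. Qed.

(** At the doubling point H is bounded above at P1 and below at P2. The first alternative of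
    [H_coercive] exploits the former, the second the latter; the other momentum follows since P1 -
    P2 is bounded. *)
Lemma coercive_pair : exists2 r, 0 < r & forall x y P1 P2 p1 p2,
  nrm (j p1) <= L + 2 -> nrm (j p2) <= L + 2 ->
  H x P1 <= Hb p1 + 2 -> Hb p2 - A <= H y P2 ->
  nrm P1 <= r \/ nrm P2 <= r.
Proof.
have [C C0 HbC] := Hb_lipschitz (L + 2).
have L2 : nrm (j 0) <= L + 2 by rewrite j0 (hnorm0 _ hE); move: L_gt0; lra.
pose MH := `|Hb 0| + C * (L + 2).
have HbM p : nrm (j p) <= L + 2 -> `|Hb p| <= MH.
  move=> pL; have h1 := HbC _ _ pL L2; have h2 := HbC _ _ L2 pL.
  rewrite sub0r jN (hnormN _ hE) in h1; rewrite subr0 in h2.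
  have h3 : C * nrm (j p) <= C * (L + 2) by rewrite ler_pM2l.
  have h4 := ler_norm (Hb 0); have h5 := ler_norm (- Hb 0); rewrite normrN in h5.
  by apply/ler_normlP; rewrite /MH; split; lra.
pose M := MH + A + 2.
case: H_coercive => co; have [r rP] := co M; exists (`|r| + 1);
  rewrite ?ltr_wpDl// => x y P1 P2 p1 p2 /HbM/ler_normlP[h1 h2]
  /HbM/ler_normlP[h3 h4] h5 h6; have rr := ler_norm r; have := A_ge0.
- left; suff : nrm P1 <= r by lra.
  by apply: (rP x); rewrite /M; lra.
- right; suff : nrm P2 <= r by lra.
  by apply: (rP y); rewrite /M; lra.
Qed.

Section doubling.
Variables (v : F -> E -> R) (w1 : E * R -> R) (w2 : F * R -> R) (g : F -> R).
Variables (eps s T : R).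
Hypothesis v_corrector : forall p, nrm (j p) <= L + 1 ->
  [/\ continuous (v p), forall y, `|v p y| <= Cv &
      forall y D, subjet ip (v p) y D -> Hb p - A <= H y (j p + D)].
Hypotheses (s_gt0 : 0 < s) (epsE : eps = s ^+ 3).
Hypothesis w1_buc : buc_on [set z : E * R | 0 <= z.2 <= T + 1] w1.
Hypothesis w2_buc : buc_on [set z : F * R | 0 <= z.2 <= T + 1] w2.
Hypothesis w1_sub : jet_subsolution (spacetime_dot ip)
  [set z : E * R | 0 < z.2] (fun z q => q.2 + H (eps^-1 *: z.1) q.1) w1.
Hypothesis w2_super : jet_supersolution (spacetime_dot ipF)
  [set z : F * R | 0 < z.2] (fun z q => q.2 + Hb q.1) w2.
Hypotheses (w1_init : forall x, w1 (x, 0) = g (m x))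
  (w2_init : forall q, w2 (q, 0) = g q).
Hypothesis g_lipschitz : forall q q', g q - g q' <= L * nrm (j (q - q')).
Hypothesis w2_lipschitz : forall t q q', 0 <= t ->
  w2 (q, t) - w2 (q', t) <= L * nrm (j (q - q')).

(** On this ball the correctors share the bound [Cv]. The margin 1 over the Lipschitz constant of
    [w2] absorbs the perturbation [eq], so that p is an admissible competitor of p'. *)
Local Notation slope := {p : F | nrm (j p) <= L + 1}.
Let psi (th : R) (pi : slope) (z : E * (E * F)) : R :=
  (2 * s)^-1 * ipF (m z.1 - z.2.2) (m z.1 - z.2.2) +
  (2 * s)^-1 * ipF (m z.1 - z.2.2 - s *: sval pi) (m z.1 - z.2.2 - s *: sval pi) +
  (2 * th)^-1 * ip (z.1 - z.2.1) (z.1 - z.2.1) +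
  eps * v (sval pi) (eps^-1 *: z.2.1).

Let eps_gt0 : 0 < eps.
Proof. by rewrite epsE exprn_gt0. Qed.

Let is2 : 0 < (2 * s)^-1.
Proof. by rewrite invr_gt0 mulr_gt0. Qed.

Let psi_cont th pi : continuous (psi th pi).
Proof.
have [vc _ _] := v_corrector _ (valP pi).
move=> z.
have cx : z'.1 @[z' --> z] --> z.1 by exact: cvg_fst.
have c2 : z'.2 @[z' --> z] --> z.2 by exact: cvg_snd.
have cxi : z'.2.1 @[z' --> z] --> z.2.1.
  by apply: (cvg_comp (fun z : E * (E * F) => z.2) fst c2); exact: cvg_fst.
have cq : z'.2.2 @[z' --> z] --> z.2.2.
  by apply: (cvg_comp (fun z : E * (E * F) => z.2) snd c2); exact: cvg_snd.
have cm : m z'.1 @[z' --> z] --> m z.1.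
  by apply: (cvg_comp (fun z : E * (E * F) => z.1) m cx); exact: continuous_contraction.
apply: cvgD; first apply: cvgD; first apply: cvgD.
- by apply: cvgM; [exact: cvg_cst|apply: (ip_cvg hF); exact: cvgB].
- apply: cvgM; first exact: cvg_cst.
  by apply: (ip_cvg hF); (apply: cvgB; [exact: cvgB|exact: cvg_cst]).
- by apply: cvgM; [exact: cvg_cst|apply: (ip_cvg hE); exact: cvgB].
- apply: cvgM; first exact: cvg_cst.
  have c3 : eps^-1 *: z'.2.1 @[z' --> z] --> eps^-1 *: z.2.1.
    by apply: cvgZ => //; exact: cvg_cst.
  by apply: (cvg_comp (fun z : E * (E * F) => eps^-1 *: z.2.1) (v (sval pi)) c3); exact: vc.
Qed.

Let psi_ge th pi z : 0 < th -> - (eps * Cv) <= psi th pi z.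
Proof.
move=> th0; have [_ vC _] := v_corrector _ (valP pi).
have /ler_normlP[h _] := vC (eps^-1 *: z.2.1).
have q1 : 0 <= (2 * s)^-1 * ipF (m z.1 - z.2.2) (m z.1 - z.2.2).
  exact: mulr_ge0 (ltW is2) (ip_ge0 hF _).
have q2 : 0 <= (2 * s)^-1 * ipF (m z.1 - z.2.2 - s *: sval pi)
    (m z.1 - z.2.2 - s *: sval pi).
  exact: mulr_ge0 (ltW is2) (ip_ge0 hF _).
have q3 : 0 <= (2 * th)^-1 * ip (z.1 - z.2.1) (z.1 - z.2.1).
  by rewrite mulr_ge0 ?(ip_ge0 hE)// invr_ge0; lra.
have := ler_wpM2l (ltW eps_gt0) h; rewrite /psi; lra.
Qed.

(** [time_doubling] allots one spatial variable to each time, so the corrector variable xi travels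
    with q as a dummy variable. *)
Let w2' (z : (E * F) * R) := w2 (z.1.2, z.2).

Let w2'_buc : buc_on [set z : (E * F) * R | 0 <= z.2 <= T + 1] w2'.
Proof.
have [b u] := w2_buc; split.
  have [M [Mr h]] := b; exists M; split => // r Mr' z zT.
  by apply: (h r Mr' (z.1.2, z.2)).
move=> e e0; have [d d0 h] := u e e0; exists d => // z z' zT z'T zz'.
apply: h => //; apply: le_lt_trans zz'.
rewrite !prod_normE /= ge_max; apply/andP; split.
  by rewrite !le_max lexx orbT.
by rewrite le_max lexx orbT.
Qed.

Let initB th pi x y : 0 < th ->
  w1 (x, 0) - w2' (y, 0) - psi th pi (x, y) <= L ^+ 2 * s / 2 + eps * Cv.
Proof.
move=> th0; have [_ vC _] := v_corrector _ (valP pi).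
have /ler_normlP[h _] := vC (eps^-1 *: y.1).
have q2 : 0 <= (2 * s)^-1 * ipF (m x - y.2 - s *: sval pi)
    (m x - y.2 - s *: sval pi).
  exact: mulr_ge0 (ltW is2) (ip_ge0 hF _).
have q3 : 0 <= (2 * th)^-1 * ip (x - y.1) (x - y.1).
  by rewrite mulr_ge0 ?(ip_ge0 hE)// invr_ge0; lra.
have := ler_wpM2l (ltW eps_gt0) h.
rewrite /psi /w2' /= w1_init w2_init.
have := g_lipschitz (m x) y.2; rewrite -nrmF -(hnorm_sqr _ hF (m x - y.2)).
set n := hnorm ipF _.
have i0 : 0 < (2 * s)^-1 by rewrite invr_gt0 mulr_gt0.
have : L * n <= L ^+ 2 * s / 2 + (2 * s)^-1 * n ^+ 2.
  have := sqr_ge0 (L * s - n); rewrite sqrrB -(ler_pM2l i0) mulr0.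
  have -> : (2 * s)^-1 * ((L * s) ^+ 2 - L * s * n *+ 2 + n ^+ 2) =
    L ^+ 2 * s / 2 - L * n + (2 * s)^-1 * n ^+ 2 by field; rewrite gt_eqF.
  by lra.
by lra.
Qed.

(* Adding the equations of w1 and w2 at the maximum cancels the time slope. *)
Lemma doubling_point (mu th del : R) x0 (t0 : R) : 0 < mu -> 0 < th -> 0 < del ->
  del <= 1 -> 0 <= t0 <= T ->
  2 * (eps * Cv) + L ^+ 2 * s / 2 + mu * t0 < w1 (x0, t0) - w2 (m x0, t0) ->
  exists (x xi : E) (p p' eq : F) (e1 e2 X : E), let p1 := p + (p - p') in
  [/\ nrm (j p') <= L + 1, nrm (j (p1 - eq)) <= L,
      [/\ nrm e1 <= del, nrm e2 <= del & nrm (j eq) <= del],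
      [/\ x - xi = th *: X,
          mu + H (eps^-1 *: x) (j p1 + X + e1) <= Hb (p1 - eq) + 2 * del &
          Hb p' - A <= H (eps^-1 *: xi) (j p' + (X - e2))] &
      nrm (j p) <= L + 1 ->
        s / 2 * nrm (j (p - p')) ^+ 2 <= 2 * (eps * Cv) + del].
Proof.
move=> mu0 th0 del0 del1 t0T gap.
have [M M0 [w1M w2M]] : exists2 M, 0 < M &
    (forall x t, 0 <= t <= T + 1 -> `|w1 (x, t)| <= M) /\
    (forall y t, 0 <= t <= T + 1 -> `|w2' (y, t)| <= M).
  have [[M1 [_ uM1]] _] := w1_buc; have [[M2 [_ uM2]] _] := w2'_buc.
  have l1 := ler_norm M1; have l2 := ler_norm M2.
  have g1 := normr_ge0 M1; have g2 := normr_ge0 M2.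
  exists (`|M1| + `|M2| + 1); first by lra.
  by split => [x t tT|x t tT]; [apply: uM1|apply: uM2] => //; lra.
have zero_slope : nrm (j 0) <= L + 1 by rewrite j0 (hnorm0 _ hE); move: L_gt0; lra.
pose pi0 : slope := exist _ 0 zero_slope.
pose B := L ^+ 2 * s / 2 + eps * Cv.
(* At xi = x0, q = m x0 and slope 0 every quadratic penalty vanishes; only the corrector term, at
   most eps Cv, is lost. *)
have gap' : B + mu * t0 < w1 (x0, t0) - w2' ((x0, m x0), t0) -
    psi th pi0 (x0, (x0, m x0)).
  have [_ vC _] := v_corrector _ zero_slope.
  have /ler_normlP[_ h] := vC (eps^-1 *: x0).
  have := ler_wpM2l (ltW eps_gt0) h.
  rewrite /psi /w2' /= !subrr scaler0 subr0 !(ip0l hF) (ip0l hE) !mulr0 /B.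
  by move: gap; lra.
have hEF := hilbertian_prod _ _ _ _ hE hF.
have sE := hilbertian_spacetime _ _ _ hE; have sF := hilbertian_spacetime _ _ _ hF.
have [pi [z [e1 [e2' [tau [b1 [b2 [/= pos1 pos2 jet [ee1 ee2 hb1 hb2] [opt _]]]]]]]]] :=
  time_doubling ip _ hE hEF w1 w2' T M w1_buc w2'_buc w1M w2M slope (psi th)
    (- (eps * Cv)) B mu del (psi_cont th) (fun pi z => psi_ge th pi z th0)
    (fun pi x y => initB th pi x y th0) (ltW mu0) del0 pi0 x0 (x0, m x0) t0 t0T gap'.
case: z pos1 pos2 jet opt => [[x t] [[xi q] t2]] /= pos1 pos2 jet opt.
case: e2' ee2 jet => [exi eq] /= ee2 jet.
case: pi opt jet => [p' p'L] opt jet.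
have is0 : 0 < s^-1 by rewrite invr_gt0.
have ith0 : 0 < th^-1 by rewrite invr_gt0.
have [p smx] : exists p, m x - q = s *: p.
  by exists (s^-1 *: (m x - q)); rewrite scalerA divff ?gt_eqF// scale1r.
have smx' : m x - q - s *: p' = s *: (p - p') by rewrite smx scalerBr.
have [X thX] : exists X, x - xi = th *: X.
  by exists (th^-1 *: (x - xi)); rewrite scalerA divff ?gt_eqF// scale1r.
pose p1 := p + (p - p').
(* The two squares in m x - q contribute p and p - p', that is p1 in all; [m_adj] lifts it to
   [j p1]. *)
have j1 : superjet (spacetime_dot ip) w1 (x, t)
    ((e1, tau + mu + b1) + (j p1 + X, 0)).
  apply: (superjet_le _ _ _ _ _ _ _ (s^-1 + (2 * th)^-1) sE
    (superjet_slicel _ _ _ _ (hilbertian_spacetime _ _ _ hEF) _ _ _ _ jet)) => -[x' t'].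
  rewrite /doubled /psi /spacetime_dot /=.
  set h := x' - x.
  have -> : m x' - q = (m x - q) + m h by rewrite /h mB [RHS]addrC addrA subrK.
  have -> : x' - xi = (x - xi) + h by rewrite /h [RHS]addrC addrA subrK.
  rewrite [m x - q + m h - _]addrAC smx' smx thX.
  rewrite !(ip_sqrD hF) (ip_sqrD hE) !(ip_sqrZ hF) (ip_sqrZ hE).
  rewrite !(ipZl hF) !(ipZl hE) (ipDl hE) m_adj /p1 (ipDl hF p (p - p') (m h)) mul0r addr0.
  have := m_contract h; rewrite -(ler_pM2l is0) !invfM.
  have : 0 <= (s^-1 + 2^-1 * th^-1) * ((t' - t) * (t' - t)).
    by rewrite -expr2 mulr_ge0 ?sqr_ge0// addr_ge0 ?mulr_ge0// ltW.
  set c := ip X h; set c1 := ipF p (m h); set c2 := ipF (p - p') (m h).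
  have -> : 2^-1 * s^-1 * (s ^+ 2 * ipF p p + 2 * (s * c1) + ipF (m h) (m h)) =
    2^-1 * s^-1 * (s ^+ 2 * ipF p p) + c1 + 2^-1 * (s^-1 * ipF (m h) (m h)).
    by field; rewrite gt_eqF.
  have -> : 2^-1 * s^-1 * (s ^+ 2 * ipF (p - p') (p - p') + 2 * (s * c2) + ipF (m h) (m h)) =
    2^-1 * s^-1 * (s ^+ 2 * ipF (p - p') (p - p')) + c2 + 2^-1 * (s^-1 * ipF (m h) (m h)).
    by field; rewrite gt_eqF.
  have -> : 2^-1 * th^-1 * (th ^+ 2 * ip X X + 2 * (th * c) + ip h h) =
    2^-1 * th^-1 * (th ^+ 2 * ip X X) + c + 2^-1 * th^-1 * ip h h.
    by field; rewrite gt_eqF.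
  by lra.
have jq : superjet (spacetime_dot ipF) (fun z : F * R =>
    doubled w1 w2' slope (psi th) (exist _ p' p'L) ((x, t), ((xi, z.1), z.2)))
    (q, t2) (eq, b2 - tau).
  apply: (superjet_pull _ _ _ (fun z : F * R => ((x, t), ((xi, z.1), z.2)))
    (q, t2) _ _ 1 _ _ _ jet) => [|[q' t']|[q' t']].
  - have c1 : z.1 @[z --> (q, t2)] --> q by exact: cvg_fst.
    have c2 : z.2 @[z --> (q, t2)] --> t2 by exact: cvg_snd.
    have c3 : (xi, z.1) @[z --> (q, t2)] --> (xi, q) by exact: (cvg_pair (cvg_cst xi) c1).
    have c4 : ((xi, z.1), z.2) @[z --> (q, t2)] --> ((xi, q), t2) by exact: (cvg_pair c3 c2).
    exact: (cvg_pair (cvg_cst (x, t)) c4).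
  - by rewrite /spacetime_dot /= !subrr !(ip0r hE) mulr0 !add0r.
  - by rewrite /spacetime_dot /= !subrr !(ip0r hE) mulr0 !add0r mul1r.
have j2 : subjet (spacetime_dot ipF) w2 (q, t2) (- ((eq, b2 - tau) + (- p1, 0))).
  apply: (subjet_le _ _ _ _ _ _ _ s^-1 sF jq) => -[q' t'].
  rewrite /doubled /psi /w2' /spacetime_dot /=.
  set h := q' - q.
  have -> : m x - q' = (m x - q) - h by rewrite /h opprB addrA subrK.
  rewrite [m x - q - h - _]addrAC smx' smx.
  rewrite (ip_sqrB hF (s *: p)) (ip_sqrB hF (s *: (p - p'))) !(ip_sqrZ hF) !(ipZl hF).
  rewrite (ipNl hF p1) /p1 (ipDl hF p (p - p') h) mul0r addr0 !invfM.
  have : 0 <= s^-1 * ((t' - t2) * (t' - t2)).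
    by rewrite -expr2 mulr_ge0 ?sqr_ge0// ltW.
  set c1 := ipF p h; set c2 := ipF (p - p') h.
  have -> : 2^-1 * s^-1 * (s ^+ 2 * ipF p p - 2 * (s * c1) + ipF h h) =
    2^-1 * s^-1 * (s ^+ 2 * ipF p p) - c1 + 2^-1 * (s^-1 * ipF h h).
    by field; rewrite gt_eqF.
  have -> : 2^-1 * s^-1 * (s ^+ 2 * ipF (p - p') (p - p') - 2 * (s * c2) + ipF h h) =
    2^-1 * s^-1 * (s ^+ 2 * ipF (p - p') (p - p')) - c2 + 2^-1 * (s^-1 * ipF h h).
    by field; rewrite gt_eqF.
  by lra.
have epsK y : eps^-1 *: (eps *: y) = y :> E.
  by rewrite scalerA mulVf ?scale1r// gt_eqF.
have Keps y : eps *: (eps^-1 *: y) = y :> E.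
  by rewrite scalerA divff ?scale1r// gt_eqF.
pose y0 := eps^-1 *: xi.
have jy : superjet ip (fun y : E =>
    doubled w1 w2' slope (psi th) (exist _ p' p'L) ((x, t), ((eps *: y, q), t2)))
    y0 (eps *: exi).
  apply: (superjet_pull _ _ _ (fun y : E => ((x, t), ((eps *: y, q), t2)))
    y0 _ _ (eps ^+ 2) _ _ _ _) => [|y|y|]; last by rewrite /y0 Keps; exact: jet.
  - have c1 : eps *: y @[y --> y0] --> eps *: y0.
      by apply: cvgZ; [exact: cvg_cst|exact: cvg_id].
    have c2 : (eps *: y, q) @[y --> y0] --> (eps *: y0, q) by exact: (cvg_pair c1 (cvg_cst q)).
    have c3 : ((eps *: y, q), t2) @[y --> y0] --> ((eps *: y0, q), t2) by
      exact: (cvg_pair c2 (cvg_cst t2)).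
    exact: (cvg_pair (cvg_cst (x, t)) c3).
  - rewrite /spacetime_dot /= !subrr !(ip0r hE) !(ip0r hF) !mulr0 !add0r !addr0.
    by rewrite -scalerBr (ipZr hE) (ipZl hE).
  - rewrite /spacetime_dot /= !subrr !(ip0r hE) !(ip0r hF) !mulr0 !add0r !addr0.
    by rewrite -scalerBr (ip_sqrZ hE).
(* In the fast variable y = xi / eps the function eps v_p' has slope eps (X - exi); dividing by eps
   leaves a slope comparable with the gradient in x. *)
have j3 : subjet ip (v p') y0 (X - exi).
  apply: (subjetZ _ _ _ _ _ hE eps_gt0).
  have -> : eps *: (X - exi) = - (eps *: exi + - (eps *: X)).
    by rewrite scalerBr opprB.
  apply: (subjet_le _ _ _ _ _ _ _ ((2 * th)^-1 * eps ^+ 2) hE jy) => y.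
  rewrite /doubled /psi /w2' /= !epsK.
  set h := y - y0.
  have -> : x - eps *: y = (x - eps *: y0) - eps *: h.
    by rewrite /h scalerBr opprB addrA subrK.
  rewrite {1}/y0 Keps thX (ip_sqrB hE (th *: X)) (ip_sqrZ hE _ h) (ip_sqrZ hE).
  rewrite (ipNl hE (eps *: X)) !(ipZl hE) (ipZr hE).
  rewrite -/y0; set c := ip X h; set Qh := ip h h.
  have -> : (2 * th)^-1 * (th ^+ 2 * ip X X - 2 * (th * (eps * c)) + eps ^+ 2 * Qh) =
    (2 * th)^-1 * (th ^+ 2 * ip X X) - eps * c + (2 * th)^-1 * (eps ^+ 2 * Qh).
    by field; rewrite gt_eqF.
  by lra.
have /= h1 := w1_sub (x, t) _ pos1 j1.
have /= h2 := w2_super (q, t2) _ pos2 j2.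
have [_ _ vsup] := v_corrector _ p'L.
have h3 := vsup _ _ j3.
have E2 : - (eq - p1) = p1 - eq by rewrite opprB.
have := subjet_slicel _ _ _ _ _ _ _ _ _ hF (hilbertian_R R) j2.
rewrite /= E2 => j4.
(* The Lipschitz bound of [w2] applies to its whole jet p1 - eq, and so controls p1 only up to
   [eq]. *)
have h4 : nrm (j (p1 - eq)) <= L.
  rewrite -nrmF; apply: (subjet_lipschitz _ _ _ _ _ hF (ltW L_gt0) _ j4) => y.
  by have := w2_lipschitz t2 y q (ltW pos2); rewrite -nrmF.
exists x, xi, p, p', eq, e1, exi, X; split => //.
- have Qe := ip_ge0 hE exi; have Qq := ip_ge0 hF eq.
  split.
  + by rewrite (hnorm_le _ hE)// ltW.
  + by rewrite (hnorm_le _ hE); [lra|exact: ltW].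
  + by rewrite -nrmF (hnorm_le _ hF); [lra|exact: ltW].
- split => //.
  have -> : j p1 + X + e1 = e1 + (j p1 + X) by rewrite addrC.
  by move: h1 h2; rewrite E2; lra.
(* Near-optimality of p' is tested against p: the second square is 0 there and s |p - p'|^2 / 2 at
   p', while the correctors differ by at most 2 eps Cv. *)
- move=> pL; have := opt (exist _ p pL); rewrite /psi /= smx subrr (ip0l hF) mulr0 addr0.
  have -> : s *: p - s *: p' = s *: (p - p') by rewrite scalerBr.
  rewrite -nrmF (hnorm_sqr _ hF) (ip_sqrZ hF s (p - p')).
  have [_ vC _] := v_corrector _ p'L; have [_ vC' _] := v_corrector _ pL.
  have /ler_normlP[c1 _] := vC y0; have /ler_normlP[_ c2] := vC' y0.
  have -> : (2 * s)^-1 * (s ^+ 2 * ipF (p - p') (p - p')) =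
    s / 2 * ipF (p - p') (p - p') by field; rewrite gt_eqF.
  have := ler_wpM2l (ltW eps_gt0) c1; have := ler_wpM2l (ltW eps_gt0) c2.
  by rewrite -/y0; lra.
Qed.

End doubling.

(** The time slope mu = A + C1 s is taken larger than the total mismatch of the equations at the
    doubling point. C1 is fixed before v, w1, w2, eps and s, which makes the bound uniform. *)
Lemma one_sided_bound : exists2 C1, 0 < C1 &
  forall (v : F -> E -> R) (w1 : E * R -> R) (w2 : F * R -> R) (g : F -> R) (eps s T : R),
  (forall p, nrm (j p) <= L + 1 ->
    [/\ continuous (v p), forall y, `|v p y| <= Cv &
        forall y D, subjet ip (v p) y D -> Hb p - A <= H y (j p + D)]) ->
  0 < s -> eps = s ^+ 3 ->
  buc_on [set z : E * R | 0 <= z.2 <= T + 1] w1 ->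
  buc_on [set z : F * R | 0 <= z.2 <= T + 1] w2 ->
  jet_subsolution (spacetime_dot ip)
    [set z : E * R | 0 < z.2] (fun z q => q.2 + H (eps^-1 *: z.1) q.1) w1 ->
  jet_supersolution (spacetime_dot ipF)
    [set z : F * R | 0 < z.2] (fun z q => q.2 + Hb q.1) w2 ->
  (forall x, w1 (x, 0) = g (m x)) -> (forall q, w2 (q, 0) = g q) ->
  (forall q q', g q - g q' <= L * nrm (j (q - q'))) ->
  (forall t q q', 0 <= t -> w2 (q, t) - w2 (q', t) <= L * nrm (j (q - q'))) ->
  forall x t, 0 <= t <= T ->
    w1 (x, t) - w2 (m x, t) <= 2 * (eps * Cv) + L ^+ 2 * s / 2 + T * (A + C1 * s).
Proof.
have L0 := L_gt0; have Cv0 := Cv_ge0; have A0 := A_ge0.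
have [r r0 rP] := coercive_pair.
pose Rr := r + 2 * L + 5; have Rr0 : 0 < Rr by rewrite /Rr; lra.
pose KX := Rr + L + 2; have KX0 : 0 < KX by rewrite /KX; lra.
have [Lr Lr0 HLr] := H_lipschitz_p _ Rr0.
have [Lx Lx0 HLx] := H_lipschitz_x.
have [Cb Cb0 HbC] := Hb_lipschitz (L + 2).
pose Kx := Lx * (1 + Rr) * KX.
have Kx0 : 0 < Kx by rewrite !mulr_gt0//; lra.
pose K := 2 * (2 * Cv + 1).
have K0 : 0 < K by rewrite /K; lra.
(* In units of s: 2 for the errors [2 * del], [Lr] times |P1 - P2|, [Kx] for |x - xi| / eps, [Cb]
   times the distance of the effective slopes, and 1 for strictness. *)
pose C1 := 2 + Lr * (K + 2) + Kx + Cb * (K + 1) + 1.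
have C10 : 0 < C1.
  have : 0 < Lr * (K + 2) by rewrite mulr_gt0//; lra.
  have : 0 < Cb * (K + 1) by rewrite mulr_gt0//; lra.
  by rewrite /C1; lra.
exists C1; first exact: C10.
move=> v w1 w2 g eps s T vcor s0 epsE w1b w2b w1s w2s w1i w2i gL w2L x0 t0 t0T.
rewrite leNgt; apply/negP => gap.
have C1s : 0 < C1 * s by rewrite mulr_gt0.
pose mu := A + C1 * s; have mu0 : 0 < mu by rewrite /mu; lra.
have eps0 : 0 < eps by rewrite epsE exprn_gt0.
(* This scale gives |x - xi| / eps = s |X|, of order s since X is bounded. *)
pose th := eps * s; have th0 : 0 < th by rewrite mulr_gt0.
pose del := Num.min 1 (Num.min s (eps / 2)).
have del0 : 0 < del by rewrite !lt_min ltr01 s0 divr_gt0.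
have del1 : del <= 1 by rewrite ge_min lexx.
have dels : del <= s by rewrite !ge_min lexx !orbT.
have dele : del <= eps / 2 by rewrite !ge_min lexx !orbT.
have gap' : 2 * (eps * Cv) + L ^+ 2 * s / 2 + mu * t0 < w1 (x0, t0) - w2 (m x0, t0).
  have : mu * t0 <= mu * T by rewrite ler_pM2l//; case/andP: t0T.
  by move: gap; rewrite -/mu [T * mu]mulrC; lra.
have [x [xi [p [p' [eq [e1 [e2 [X]]]]]]]] := doubling_point v w1 w2 g eps s T vcor
  s0 epsE w1b w2b w1s w2s w1i w2i gL w2L mu th del x0 t0 mu0 th0 del0 del1 t0T gap'.
clear vcor w1b w2b w1s w2s w1i w2i gL w2L gap gap'.
set p1 := p + (p - p') => -[p'L p1L [e1d e2d eqd] [thX hsub hsup] hopt].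
have p1L' : nrm (j p1) <= L + 1.
  have -> : j p1 = j (p1 - eq) + j eq by rewrite -jD subrK.
  by apply: le_trans (hnormD _ hE _ _) _; lra.
(* p is the midpoint of p1 and p', both in the ball. *)
have pL : nrm (j p) <= L + 1.
  have e : 2 *: j p = j p1 + j p'.
    by rewrite -jD /p1 -addrA subrK jD scaler_nat mulr2n.
  have : nrm (2 *: j p) <= 2 * (L + 1).
    by rewrite e; apply: le_trans (hnormD _ hE _ _) _; lra.
  by rewrite (hnormZ _ hE) ger0_norm//; lra.
have := hopt pL; set n := nrm (j (p - p')) => hn.
have n0 : 0 <= n by exact: hnorm_ge0.
(* With del <= eps / 2 and eps = s^3, near-optimality reads n^2 <= (4 Cv + 1) s^2 <= ((2 Cv + 1)
   s)^2. *)
have nK : 2 * n <= K * s.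
  suff : n <= (2 * Cv + 1) * s by rewrite /K; lra.
  rewrite -(@ler_pXn2r _ 2) ?nnegrE//; last by rewrite mulr_ge0 ?ltW//; lra.
  have h1 : s / 2 * n ^+ 2 <= s / 2 * (s ^+ 2 * (4 * Cv + 1)).
    have -> : s / 2 * (s ^+ 2 * (4 * Cv + 1)) = 2 * (eps * Cv) + eps / 2.
      by rewrite epsE; field.
    by lra.
  rewrite ler_pM2l ?divr_gt0// in h1.
  apply: le_trans h1 _.
  rewrite [(_ * s) ^+ 2]exprMn [leRHS]mulrC ler_pM2l ?exprn_gt0//.
  by nra.
set P1 := j p1 + X + e1 in hsub.
set P2 := j p' + (X - e2) in hsup.
have jpp : 2 *: j (p - p') = j p1 - j p'.
  by rewrite -jB /p1 [p + _ - _]addrAC [RHS]jD scaler_nat mulr2n.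
have P12 : P1 - P2 = 2 *: j (p - p') + (e1 + e2).
  rewrite jpp /P1 /P2 -[_ + X + e1]addrA [X + e1]addrC opprD addrACA.
  by congr (_ + _); rewrite opprB addrA [e1 + X + _ - _]addrAC addrK.
have nP12 : nrm (P1 - P2) <= 2 * n + 2 * del.
  rewrite P12; apply: le_trans (hnormD _ hE _ _) _; apply: lerD.
    by rewrite (hnormZ _ hE) ger0_norm.
  by apply: le_trans (hnormD _ hE _ _) _; lra.
have nP12' : nrm (P1 - P2) <= 2 * L + 4.
  apply: le_trans nP12 _.
  have : 2 * n <= 2 * (L + 1).
    have -> : 2 * n = nrm (j p1 - j p').
      by rewrite -jpp (hnormZ _ hE) ger0_norm.
    by apply: le_trans (hnormB _ hE _ _) _; lra.
  by lra.
have p1L2 : nrm (j (p1 - eq)) <= L + 2 by lra.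
have p'L2 : nrm (j p') <= L + 2 by lra.
have hsub2 : H (eps^-1 *: x) P1 <= Hb (p1 - eq) + 2 by lra.
have [nP1 nP2] : nrm P1 < Rr /\ nrm P2 < Rr.
  have [h|h] := rP _ _ _ _ _ _ p1L2 p'L2 hsub2 hsup.
    have -> : P2 = P1 - (P1 - P2) by rewrite opprB addrC subrK.
    have h' := hnormB _ hE P1 (P1 - P2).
    by rewrite /Rr; split; lra.
  have -> : P1 = P2 + (P1 - P2) by rewrite addrC subrK.
  have h' := hnormD _ hE P2 (P1 - P2).
  by rewrite /Rr; split; lra.
have nX : nrm X <= KX.
  have -> : X = P1 - (j p1 + e1) by rewrite /P1 [j p1 + X + e1]addrAC [j p1 + e1 + X]addrC addrK.
  apply: le_trans (hnormB _ hE _ _) _; have := hnormD _ hE (j p1) e1.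
  by rewrite /KX; lra.
have dx : nrm (eps^-1 *: xi - eps^-1 *: x) <= s * KX.
  rewrite (hnormBC _ hE) -scalerBr thX scalerA /th mulrA mulVf ?gt_eqF// mul1r.
  by rewrite (hnormZ _ hE) gtr0_norm// ler_pM2l.
have h1 : H (eps^-1 *: xi) P2 - H (eps^-1 *: x) P2 <= Kx * s.
  apply: le_trans (ler_norm _) (le_trans (HLx _ _ _) _).
  rewrite /Kx -[_ * KX * s]mulrA [KX * s]mulrC.
  apply: ler_pM => //; rewrite ?hnorm_ge0//.
    by rewrite mulr_ge0 ?ltW// ltr_wpDr ?hnorm_ge0.
  by rewrite ler_pM2l//; lra.
have h2 : H (eps^-1 *: x) P2 - H (eps^-1 *: x) P1 <= Lr * (K + 2) * s.
  apply: le_trans (ler_norm _) (le_trans (HLr _ _ _ nP2 nP1) _).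
  rewrite (hnormBC _ hE) -mulrA ler_pM2l//; lra.
have h3 : Hb (p1 - eq) - Hb p' <= Cb * (K + 1) * s.
  apply: le_trans (HbC _ _ p'L2 p1L2) _; rewrite -mulrA ler_pM2l//.
  have -> : j (p1 - eq - p') = 2 *: j (p - p') - j eq by rewrite jpp -!jB addrAC.
  by apply: le_trans (hnormB _ hE _ _) _; rewrite (hnormZ _ hE) ger0_norm// -/n; lra.
move: hsub hsup h1 h2 h3; rewrite /mu /C1.
by lra.
Qed.

End one_sided_estimate.

Lemma C1_lipschitz (R : realType) (E : normedModType R) ip (w : E -> R) Dw (L : R) :
  @hilbertian R E ip -> C1_on ip setT w Dw -> (forall x, hnorm ip (Dw x) <= L) ->
  forall x y, w x - w y <= L * hnorm ip (x - y).
Proof.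
move=> hE wC1 DwL x y; set v := x - y.
pose f (t : R) := w (t *: v + y).
have quotE t : (fun h : R => h^-1 *: ((f \o shift t) (h *: 1) - f t)) =
    (fun h : R => h^-1 *: ((w \o shift (t *: v + y)) (h *: v) - w (t *: v + y))).
  apply/funext => h; rewrite /f /=; congr (_ *: (w _ - _)).
  by rewrite addrA -scalerDl [h *: 1]mulr1.
have fd (t : R) : is_derive t 1 f (ip (Dw (t *: v + y)) v).
  have [[wd dw] _] := wC1 (t *: v + y) Logic.I.
  apply: DeriveDef.
    by rewrite /derivable quotE; exact: diff_derivable.
  by rewrite /derive quotE -[LHS]/('D_v w (t *: v + y)) deriveE// dw.
have fc : {within `[0, 1], continuous f}.
  apply: continuous_subspaceT => t; apply: differentiable_continuous.
  by apply/derivable1_diffP; have [] := fd t.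
have [c _] := MVT_segment ler01 (fun t _ => fd t) fc.
rewrite /f scale1r scale0r add0r subrK subr0 mulr1 => ->.
apply: le_trans (hnorm_cs _ hE _ _) _.
by rewrite ler_wpM2r ?hnorm_ge0.
Qed.

Lemma buc_onN (R : realType) (E : normedModType R) (A : set E) (w : E -> R) :
  buc_on A w -> buc_on A (fun z => - w z).
Proof.
move=> [[M [Mr wM]] wu]; split.
  by exists M; split=> // r Mr' z Az; rewrite /= normrN; exact: wM.
move=> e /wu [d d0 dP]; exists d => // z z' Az Az' zz'.
by rewrite -opprD normrN dP.
Qed.

(** * The two-sided rate in abstract Hilbert spaces *)

Section rate.
Context {R : realType} {E F : normedModType R}.
Variables (ip : E -> E -> R) (ipF : F -> F -> R) (j : F -> E) (m : E -> F).
Hypotheses (hE : hilbertian ip) (hF : hilbertian ipF).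
Hypotheses (jD : forall p q, j (p + q) = j p + j q)
  (jN : forall p, j (- p) = - j p)
  (j_iso : forall p q, ipF p q = ip (j p) (j q)).
Hypotheses (mB : forall x y, m (x - y) = m x - m y)
  (m_adj : forall p x, ip (j p) x = ipF p (m x))
  (m_contract : forall x, ipF (m x) (m x) <= ip x x).
Local Notation nrm := (hnorm ip).

Section one_sided_rate.
Variables (H : E -> E -> R) (Hb : F -> R).
Hypothesis H_bounded : forall r, exists2 M, 0 < M &
  forall x p, nrm p <= r -> `|H x p| <= M.
Hypothesis H_lipschitz_x : exists2 Lx, 0 < Lx & forall x y p,
  `|H x p - H y p| <= Lx * (1 + nrm p) * nrm (x - y).
Hypothesis H_lipschitz_p : forall r, 0 < r -> exists2 Lr, 0 < Lr &
  forall x p q, nrm p < r -> nrm q < r -> `|H x p - H x q| <= Lr * nrm (p - q).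
Hypothesis H_coercive :
  (forall M, exists r, forall x p, H x p <= M -> nrm p <= r) \/
  (forall M, exists r, forall x p, - M <= H x p -> nrm p <= r).
Hypothesis Hb_lipschitz : forall r, exists2 C, 0 < C & forall p q,
  nrm (j p) <= r -> nrm (j q) <= r -> Hb q - Hb p <= C * nrm (j (q - p)).
Variable L : R.
Hypothesis L_gt0 : 0 < L.
Hypothesis Hb_corrector : exists2 Cv, 0 <= Cv & forall p, nrm (j p) <= L + 1 ->
  exists v : E -> R, [/\ continuous v, forall y, `|v y| <= Cv &
    forall y D, subjet ip v y D -> Hb p <= H y (j p + D)].

Lemma one_sided_rate (T : R) : 0 < T -> exists2 C, 0 < C &
  forall (w1 : E * R -> R) (w2 : F * R -> R) (g : F -> R) (s : R), 0 < s ->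
  (forall T', 0 < T' -> buc_on [set z : E * R | 0 <= z.2 <= T'] w1) ->
  (forall T', 0 < T' -> buc_on [set z : F * R | 0 <= z.2 <= T'] w2) ->
  jet_subsolution (spacetime_dot ip) [set z : E * R | 0 < z.2]
    (fun z q => q.2 + H ((s ^+ 3)^-1 *: z.1) q.1) w1 ->
  jet_supersolution (spacetime_dot ipF)
    [set z : F * R | 0 < z.2] (fun z q => q.2 + Hb q.1) w2 ->
  (forall x, w1 (x, 0) = g (m x)) -> (forall q, w2 (q, 0) = g q) ->
  (forall q q', g q - g q' <= L * nrm (j (q - q'))) ->
  (forall t q q', 0 <= t -> w2 (q, t) - w2 (q', t) <= L * nrm (j (q - q'))) ->
  forall x t, 0 <= t <= T -> w1 (x, t) - w2 (m x, t) <= C * s.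
Proof.
move=> T0; have [Cv Cv0 cor] := Hb_corrector; have L0 := L_gt0.
have [v vP] : exists v : F -> E -> R, forall p, nrm (j p) <= L + 1 ->
    [/\ continuous (v p), forall y, `|v p y| <= Cv &
      forall y D, subjet ip (v p) y D -> Hb p - 0 <= H y (j p + D)].
  (* A corrector is chosen for every p; outside the ball the zero function is a mere default. *)
  have [v vP] := choice (fun p : F => match pselect (nrm (j p) <= L + 1) with
    | left h => let: ex_intro v hv := cor p h in
        ex_intro (fun v => nrm (j p) <= L + 1 -> [/\ continuous v, forall y, `|v y| <= Cv &
           forall y D, subjet ip v y D -> Hb p <= H y (j p + D)]) v (fun _ => hv)
    | right h => ex_intro _ (fun=> 0) (fun h' => False_ind _ (h h')) end).
  by exists v => p /vP; rewrite subr0.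
have j0 : j 0 = 0 by rewrite -(subrr 0) jD jN subrr.
have [C0 C00 HbC] := Hb_lipschitz (L + 1).
have [M M0 HM] := H_bounded (L + 1).
(* A bounds Hb p - H y (j p) over the ball of slopes, hence the defect of the zero function, whose
   only subjet is 0. *)
pose A := `|Hb 0| + C0 * (L + 1) + M.
have A0 : 0 <= A.
  have : 0 < C0 * (L + 1) by rewrite mulr_gt0//; lra.
  by rewrite /A; have := normr_ge0 (Hb 0); lra.
have zero_corrector p : nrm (j p) <= L + 1 ->
    [/\ continuous (fun _ : E => 0 : R), forall y : E, `|0 : R| <= 0 &
      forall y D, subjet ip (fun _ => 0) y D -> Hb p - A <= H y (j p + D)].
  move=> pL; split; [by move=> y; exact: cvg_cst|by rewrite normr0|].
  move=> y D jD0.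
  have D0 : D = 0.
    have h : Num.sqrt (ip D D) <= 0.
      apply: (subjet_lipschitz _ _ _ _ _ hE (lexx 0) _ jD0) => y'.
      by rewrite subrr mul0r.
    apply: (ip_eq0 hE); apply/le_anti.
    by rewrite (ip_ge0 hE) andbT -sqrtr_eq0 eq_le h sqrtr_ge0.
  rewrite D0 addr0.
  have := HbC 0 p; rewrite subr0 j0 (hnorm0 _ hE) => /(_ ltac:(lra) pL) h1.
  have : C0 * nrm (j p) <= C0 * (L + 1) by rewrite ler_pM2l.
  have /ler_normlP[h2 _] := HM y (j p) pL.
  by rewrite /A; have := ler_norm (Hb 0); lra.
have [C1 C10 C1P] := one_sided_bound ip ipF j m hE hF jD jN j_iso mB m_adj m_contract
  H Hb H_lipschitz_x H_lipschitz_p H_coercive Hb_lipschitz L Cv 0 L_gt0 Cv0 (lexx 0).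
have [C2 C20 C2P] := one_sided_bound ip ipF j m hE hF jD jN j_iso mB m_adj m_contract
  H Hb H_lipschitz_x H_lipschitz_p H_coercive Hb_lipschitz L 0 A L_gt0 (lexx 0) A0.
pose C := 2 * Cv + L ^+ 2 / 2 + T * (A + C1 + C2).
have TC1 : 0 < T * C1 by rewrite mulr_gt0.
have TC2 : 0 < T * C2 by rewrite mulr_gt0.
have TA : 0 <= T * A by rewrite mulr_ge0// ltW.
have L2 := sqr_ge0 L.
exists C; first by rewrite /C; lra.
move=> w1 w2 g s s0 w1b w2b w1s w2s w1i w2i gL w2L x t tT.
have T1 : 0 < T + 1 by lra.
(* The corrector error s^3 Cv is at most s Cv only for s <= 1. For s > 1 the corrector is 0 and the
   defect costs T A <= T A s. *)
have [s1|s1] := leP s 1.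
  have := C1P v w1 w2 g (s ^+ 3) s T vP s0 erefl (w1b _ T1) (w2b _ T1) w1s w2s
    w1i w2i gL w2L x t tT.
  have h : Cv * s ^+ 3 <= Cv * s.
    by rewrite ler_wpM2l// exprS ger_pMr// exprn_ile1// ltW.
  have : 0 <= T * A * s by rewrite mulr_ge0// ltW.
  have : 0 <= T * C2 * s by rewrite mulr_ge0// ltW.
  by rewrite /C; lra.
have := C2P (fun _ _ => 0) w1 w2 g (s ^+ 3) s T zero_corrector s0 erefl (w1b _ T1)
  (w2b _ T1) w1s w2s w1i w2i gL w2L x t tT.
have : T * A * 1 <= T * A * s by rewrite ler_wpM2l// ltW.
have : 0 <= T * C1 * s by rewrite mulr_ge0// ltW.
have : 0 <= Cv * s by rewrite mulr_ge0// ltW.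
by rewrite /C; lra.
Qed.

End one_sided_rate.

Variables (H : E -> E -> R) (Hbar : F -> R).
Hypothesis H_bounded : forall r, exists2 M, 0 < M &
  forall x p, nrm p <= r -> `|H x p| <= M.
Hypothesis H_lipschitz_x : exists2 Lx, 0 < Lx & forall x y p,
  `|H x p - H y p| <= Lx * (1 + nrm p) * nrm (x - y).
Hypothesis H_lipschitz_p : forall r, 0 < r -> exists2 Lr, 0 < Lr &
  forall x p q, nrm p < r -> nrm q < r -> `|H x p - H x q| <= Lr * nrm (p - q).
Hypothesis H_coercive : forall M, exists2 r, 0 < r &
  forall x p, H x p <= M -> nrm p <= r.
(** Periodicity in abstract form: the values of a corrector are all attained in the ball of this
    radius. *)
Variable diam : R.
Hypothesis Hbar_corrector : forall p, exists2 v, corrector ip j H p (Hbar p) v &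
  forall y, exists2 z, nrm z <= diam & v y = v z.

Let jB p q : j (p - q) = j p - j q.
Proof. by rewrite jD jN. Qed.

Let Hbar_corrector' p : exists v, corrector ip j H p (Hbar p) v.
Proof. by have [v vP _] := Hbar_corrector p; exists v. Qed.

(** Over the ball of slopes Hbar has one upper bound, so coercivity gives one Lipschitz constant k
    for all correctors. Subtracting v 0 leaves the jets unchanged and makes k |diam| a common
    bound. *)
Lemma bounded_correctors (r : R) : exists2 Cv, 0 <= Cv & forall p, nrm (j p) <= r ->
  exists v : E -> R, [/\ continuous v, forall y, `|v y| <= Cv,
    forall y D, superjet ip v y D -> H y (j p + D) <= Hbar p &
    forall y D, subjet ip v y D -> Hbar p <= H y (j p + D)].
Proof.
have [M M0 HbM] := effective_le ip j hE H Hbar H_bounded Hbar_corrector' r.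
have [rho rho0 Hrho] := H_coercive M.
pose k := 2 * ((rho + `|r|) + 1); have r0 := normr_ge0 r.
have k0 : 0 <= k by rewrite /k; lra.
exists (k * `|diam|); first exact: mulr_ge0.
move=> p pr; have [v [vc [Mv vM] [kv vk] vsub vsup] vdiam] := Hbar_corrector p.
have jr y D : superjet ip v y D -> nrm D <= rho + `|r|.
  move=> /vsub h; have := Hrho _ _ (le_trans h (HbM p pr)).
  have -> : D = (j p + D) - j p by rewrite addrAC subrr add0r.
  rewrite [j p + (_ - _)]addrC subrK => h'.
  by apply: le_trans (hnormB _ hE _ _) _; have := ler_norm r; lra.
have kv0 : 0 < `|kv| + 1 by rewrite ltr_wpDl.
have vk' y y0 : v y - v y0 <= (`|kv| + 1) * nrm (y - y0).
  apply: le_trans (vk y y0) _; rewrite ler_wpM2r ?hnorm_ge0//.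
  by have := ler_norm kv; lra.
have rr : 0 <= rho + `|r| by lra.
have vlip := lipschitz_of_jets ip hE v Mv (rho + `|r|) vc vM rr jr _ kv0 vk'.
exists (fun y => v y - v 0); split.
- by move=> y; apply: cvgB; [exact: vc|exact: cvg_cst].
- move=> y; have [z zd ->] := vdiam y.
  have zd' : k * nrm z <= k * `|diam|.
    by rewrite ler_wpM2l//; have := ler_norm diam; lra.
  have h1 := vlip z 0; have h2 := vlip 0 z.
  rewrite subr0 in h1; rewrite sub0r (hnormN _ hE) in h2.
  by apply/ler_normlP; rewrite -/k in h1 h2; split; lra.
- move=> y D [C h]; apply: vsub; exists C; apply: filterS h => z; lra.
- move=> y D [C h]; apply: vsup; exists C; apply: filterS h => z; lra.
Qed.

Variables (g : F -> R) (L : R) (u : R -> E * R -> R) (ubar : F * R -> R).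
Hypotheses (L_gt0 : 0 < L) (g_lipschitz : forall q q', g q - g q' <= L * nrm (j (q - q'))).
Hypothesis u_buc : forall eps T, 0 < eps -> 0 < T ->
  buc_on [set z : E * R | 0 <= z.2 <= T] (u eps).
Hypothesis u_sub : forall eps, 0 < eps ->
  jet_subsolution (spacetime_dot ip) [set z : E * R | 0 < z.2]
    (fun z q => q.2 + H (eps^-1 *: z.1) q.1) (u eps).
Hypothesis u_super : forall eps, 0 < eps ->
  jet_supersolution (spacetime_dot ip) [set z : E * R | 0 < z.2]
    (fun z q => q.2 + H (eps^-1 *: z.1) q.1) (u eps).
Hypothesis u_init : forall eps x, 0 < eps -> u eps (x, 0) = g (m x).
Hypothesis ubar_buc : forall T, 0 < T ->
  buc_on [set z : F * R | 0 <= z.2 <= T] ubar.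
Hypothesis ubar_sub : jet_subsolution (spacetime_dot ipF)
  [set z : F * R | 0 < z.2] (fun z q => q.2 + Hbar q.1) ubar.
Hypothesis ubar_super : jet_supersolution (spacetime_dot ipF)
  [set z : F * R | 0 < z.2] (fun z q => q.2 + Hbar q.1) ubar.
Hypothesis ubar_init : forall q, ubar (q, 0) = g q.

Lemma homogenization_rate (T : R) : 0 < T -> exists2 C, 0 < C & forall s x t,
  0 < s -> 0 <= t <= T -> `|u (s ^+ 3) (x, t) - ubar (m x, t)| <= C * s.
Proof.
move=> T0.
have Hb_lip := effective_lipschitz ip j hE jB H Hbar H_bounded H_lipschitz_x
  H_lipschitz_p H_coercive Hbar_corrector'.
have [Cv Cv0 cor] := bounded_correctors (L + 1).
have nrmF p : hnorm ipF p = nrm (j p) by rewrite /hnorm j_iso.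
have ubar_lip t q q' : 0 <= t -> ubar (q, t) - ubar (q', t) <= L * nrm (j (q - q')).
  move=> t0; rewrite -nrmF.
  apply: (effective_solution_lipschitz ipF hF Hbar g) => // [r|p p'].
    have [C C0 HC] := Hb_lip r; exists C; first exact: C0.
    by move=> p q''; rewrite !nrmF; exact: HC.
  by rewrite nrmF.
have Hco : forall M, exists r, forall x p, H x p <= M -> nrm p <= r.
  by move=> M; have [r _ rP] := H_coercive M; exists r.
have [C1 C10 C1P] : exists2 C, 0 < C & forall s x t, 0 < s -> 0 <= t <= T ->
    u (s ^+ 3) (x, t) - ubar (m x, t) <= C * s.
  have [|C C0 CP] := one_sided_rate H Hbar H_bounded H_lipschitz_x H_lipschitz_p
    (or_introl Hco) Hb_lip L L_gt0 _ T T0.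
    by exists Cv => // p /cor [v [? ? _ ?]]; exists v.
  exists C => // s x t s0 tT; have s3 : 0 < s ^+ 3 by rewrite exprn_gt0.
  apply: (CP (u (s ^+ 3)) ubar g s s0) => //.
  - by move=> T' T'0; exact: u_buc.
  - exact: u_sub.
  - by move=> y; exact: u_init.
pose H' x p := - H x (- p); pose Hb' p := - Hbar (- p).
have [C2 C20 C2P] : exists2 C, 0 < C & forall s x t, 0 < s -> 0 <= t <= T ->
    - u (s ^+ 3) (x, t) - - ubar (m x, t) <= C * s.
  have [||||||C C0 CP] := one_sided_rate H' Hb' _ _ _ _ _ L L_gt0 _ T T0.
  - move=> r; have [M M0 HM] := H_bounded r; exists M; first exact: M0.
    by move=> x p pr; rewrite /H' normrN HM// (hnormN _ hE).
  - have [Lx Lx0 HLx] := H_lipschitz_x; exists Lx; first exact: Lx0.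
    by move=> x y p; rewrite /H' -opprD normrN -(hnormN _ hE p).
  - move=> r r0; have [Lr Lr0 HLr] := H_lipschitz_p _ r0; exists Lr; first exact: Lr0.
    move=> x p q pr qr; rewrite /H' -opprD normrN.
    have -> : p - q = - (- p - - q) by rewrite opprB opprK addrC.
    by rewrite (hnormN _ hE); apply: HLr; rewrite (hnormN _ hE).
  - right => M; have [r rP] := Hco M; exists r => x p h.
    by rewrite -(hnormN _ hE); apply: (rP x); rewrite /H' in h; lra.
  - move=> r; have [C C0 HC] := Hb_lip r; exists C; first exact: C0.
    move=> p q pr qr; rewrite /Hb' opprK addrC.
    have -> : q - p = - p - - q by rewrite opprK addrC.
    by apply: HC; rewrite jN (hnormN _ hE).
  (* For the reflected Hamiltonian the corrector of slope p is minus the one of slope -p; its subjet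
     inequality is the superjet side of [cor]. *)
  - exists Cv => // p pL; have [|v [vc vC vsub _]] := cor (- p).
      by rewrite jN (hnormN _ hE).
    exists (fun y => - v y); split.
    + by move=> y; apply: cvgN; exact: vc.
    + by move=> y; rewrite normrN.
    + move=> y D /(subjetN _ _ _ _ hE)/vsub; rewrite /H' /Hb' jN -opprD; lra.
  exists C => // s x t s0 tT; have s3 : 0 < s ^+ 3 by rewrite exprn_gt0.
  have sE := hilbertian_spacetime _ _ _ hE; have sF := hilbertian_spacetime _ _ _ hF.
  apply: (CP (fun z => - u (s ^+ 3) z) (fun z => - ubar z) (fun q => - g q) s s0) => //.
  - by move=> T' T'0; apply: buc_onN; exact: u_buc.
  - by move=> T' T'0; apply: buc_onN; exact: ubar_buc.
  - move=> z D z0 /(superjetN _ _ _ _ sE)/(u_super _ s3 z _ z0) /=; rewrite /H'; lra.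
  - move=> z D z0 /(subjetN _ _ _ _ sF)/(ubar_sub z _ z0) /=; rewrite /Hb'; lra.
  - by move=> y; rewrite u_init.
  - by move=> q; rewrite ubar_init.
  - by move=> q q'; rewrite opprK addrC -(hnormN _ hE) -jN opprB.
  - by move=> t' q q' t'0; rewrite opprK addrC -(hnormN _ hE) -jN opprB; exact: ubar_lip.
exists (C1 + C2); first exact: addr_gt0.
move=> s x t s0 tT; have := C1P s x t s0 tT; have := C2P s x t s0 tT.
have : 0 <= C1 * s by rewrite mulr_ge0// ltW.
have : 0 <= C2 * s by rewrite mulr_ge0// ltW.
by move=> h1 h2 h3 h4; apply/ler_normlP; split; lra.
Qed.

End rate.

(** * Verification of the abstract hypotheses on L^2 *)

Section concrete_hamiltonian.
Context {R : realType} {d : nat}.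
Local Notation V := (L2 R d).
Variable H : V -> V -> R.
Hypotheses (H_periodic : periodic_hamiltonian H)
  (H_lipschitz : locally_lipschitz_hamiltonian H)
  (H_coercive : coercive_hamiltonian H).

Lemma L2norm_translate (x : V) : exists2 z : V, integer_valued z &
  `|x + z| <= d%:R + 1.
Proof.
have [z zint xz] := integer_translate x; exists z => //.
rewrite L2norm_le ?addr_ge0//; apply: le_trans xz _.
by have : 0 <= d%:R :> R by []; nra.
Qed.

(** Periodicity moves x into a fixed ball, and the two Lipschitz conditions then compare H x p with
    H 0 0. *)
Lemma hamiltonian_bounded (r : R) : exists2 M, 0 < M &
  forall x p, `|p| <= r -> `|H x p| <= M.
Proof.
have [[Lx Lx0 HLx] HLp] := H_lipschitz.
have r1 : 0 < `|r| + 1 by rewrite ltr_wpDl.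
have [Lr Lr0 HLr] := HLp _ r1.
exists (`|H 0 0| + Lr * (`|r| + 1) + Lx * (1 + (`|r| + 1)) * (d%:R + 1) + 1).
  have d1 : 0 <= d%:R + 1 :> R by rewrite addr_ge0.
  have k1 : 0 <= Lr * (`|r| + 1) by rewrite mulr_ge0 ?ltW.
  have k2 : 0 <= Lx * (1 + (`|r| + 1)) * (d%:R + 1).
    by rewrite !mulr_ge0// ?ltW//; lra.
  by have := normr_ge0 (H 0 0); lra.
move=> x p pr.
have pr1 : `|p| < `|r| + 1 by have := ler_norm r; lra.
have [z zint xz1] := L2norm_translate x.
rewrite -(H_periodic x p z zint).
have h1 := HLx (x + z) 0 p; rewrite subr0 in h1.
have h2 : `|H 0 p - H 0 0| <= Lr * `|p - 0| by apply: HLr; rewrite ?normr0.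
rewrite subr0 in h2.
have -> : H (x + z) p = (H (x + z) p - H 0 p) + (H 0 p - H 0 0) + H 0 0 by ring.
apply: le_trans (ler_normD _ _) _.
apply: le_trans (lerD (ler_normD _ _) (lexx _)) _.
have h3 : Lr * `|p| <= Lr * (`|r| + 1) by rewrite ler_pM2l// ltW.
have h4 : Lx * (1 + `|p|) * `|x + z| <= Lx * (1 + (`|r| + 1)) * (d%:R + 1).
  apply: ler_pM => //; first by rewrite mulr_ge0 ?ltW// ltr_wpDr.
  by rewrite ler_pM2l//; lra.
by lra.
Qed.

Lemma coercive_bounded (M : R) : exists2 r, 0 < r &
  forall x p, H x p <= M -> `|p| <= r.
Proof.
(* The level M + 1 makes the contradiction with H x p <= M strict. *)
have [r rP] := H_coercive (M + 1); exists (`|r| + 1); first by rewrite ltr_wpDl.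
move=> x p HM; rewrite leNgt; apply/negP => rp.
have rp' : r < `|p| by have := ler_norm r; lra.
have := rP p rp'; apply/negP; rewrite -ltNge.
apply: (@le_lt_trans _ _ (H x p)%:E).
  by apply: ereal_inf_lbound; exists x.
by rewrite lte_fin; lra.
Qed.

(** Being Lipschitz and determined by its values on a ball, a periodic cell solution is bounded. *)
Lemma cell_corrector p c v : cell_solution H p c v ->
  corrector (@L2dot R d) (@L2cst R d) H p c v /\
  forall y, exists2 z, hnorm (@L2dot R d) z <= d%:R + 1 & v y = v z.
Proof.
move=> [[vc sub sup] [k vk] vper _].
have vlip y y0 : `|v y - v y0| <= k * `|y - y0| by exact: (vk (y, y0)).
have vdiam y : exists2 z, hnorm (@L2dot R d) z <= d%:R + 1 & v y = v z.
  have [z zint yz] := L2norm_translate y.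
  by exists (y + z); [exact: yz|rewrite vper].
split; last exact: vdiam.
split.
- by move=> y; exact: vc.
- exists (`|v 0| + `|k| * (d%:R + 1)) => y; have [z zd ->] := vdiam y.
  have := vlip z 0; rewrite subr0 => h.
  have -> : v z = v 0 + (v z - v 0) by ring.
  apply: le_trans (ler_normD _ _) _; rewrite lerD2l; apply: le_trans h _.
  apply: le_trans (ler_norm _) _; rewrite normrM normr_id.
  by rewrite ler_wpM2l.
- by exists k => y y0; apply: le_trans (ler_norm _) _; exact: vlip.
- move=> y D /(viscosity_jet_sub _ _ _ _ hilbertian_L2 sub y D Logic.I).
  by rewrite subr_le0.
- move=> y D /(viscosity_jet_super _ _ _ _ hilbertian_L2 sup y D Logic.I).
  by rewrite subr_ge0.
Qed.

End concrete_hamiltonian.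

Theorem theorem1p2 (R : realType) (d : nat) (d_ge1 : (1 <= d)%N)
  (H : L2 R d -> L2 R d -> R)
  (H_periodic : periodic_hamiltonian H)
  (H_invariant : rearrangement_invariant_hamiltonian H)
  (H_lipschitz : locally_lipschitz_hamiltonian H)
  (H_coercive : coercive_hamiltonian H)
  (u0 : L2 R d -> R)
  (u0_mean : forall x, u0 x = u0 (L2cst (mean x)))
  (u0_C1b : C1b u0)
  (u : R -> L2 R d * R -> R)
  (u_sol : forall eps : R, 0 < eps ->
     buc_cauchy_solution (@L2dot R d) (fun x p => H (eps^-1 *: x) p) u0 (u eps))
  (Hbar : 'rV[R]_d -> R)
  (Hbar_eff : effective_hamiltonian H Hbar)
  (ubar : 'rV[R]_d * R -> R)
  (ubar_sol : buc_cauchy_solution (@rVdot R d) (fun _ p => Hbar p)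
     (fun q => u0 (L2cst q)) ubar) :
  forall T : R, 0 < T -> exists2 C : R, 0 < C & forall eps : R, 0 < eps ->
    (ereal_sup [set (`|u eps (x, t) - ubar (mean x, t)|)%:E |
                  x in [set: L2 R d] & t in `[0%R, T]%classic]
      <= (C * eps `^ 3^-1)%:E)%E.

Proof.
have hV := @hilbertian_L2 R d; have hF := @hilbertian_rV R d.
have [HLx HLp] := H_lipschitz.
have [Dw Dw_C1 [_ [M [Mr DwM]]]] := u0_C1b.
(* Boundedness provides every bound strictly above M; this one is also positive, as the rate
   requires. *)
pose L := `|M| + 1.
have L0 : 0 < L by rewrite ltr_wpDl.
have DwL x : hnorm (@L2dot R d) (Dw x) <= L.
  by apply: DwM => //; rewrite /L; have := ler_norm M; lra.
pose g (q : 'rV[R]_d) := u0 (L2cst q).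
have gL q q' : g q - g q' <= L * hnorm (@L2dot R d) (L2cst (q - q')).
  by rewrite L2cstB; exact: (C1_lipschitz _ _ _ _ _ _ hV Dw_C1 DwL).
have Hcor p : exists2 v, corrector (@L2dot R d) (@L2cst R d) H p (Hbar p) v &
    forall y, exists2 z, hnorm (@L2dot R d) z <= d%:R + 1 & v y = v z.
  have [[v vP] _] := Hbar_eff p.
  by have [? ?] := cell_corrector H _ _ _ vP; exists v.
have sV := hilbertian_spacetime _ _ _ hV; have sF := hilbertian_spacetime _ _ _ hF.
have [bb [_ bsub bsup] bi] := ubar_sol.
move=> T T0.
have [C C0 CP] := homogenization_rate (@L2dot R d) (@rVdot R d) (@L2cst R d)
  (@mean R d) hV hF (@L2cstD R d) (@L2cstN R d) (@rVdot_cst R d) (@meanB R d)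
  (@L2dot_cstl R d) (@mean_contract R d) H Hbar
  (hamiltonian_bounded H H_periodic H_lipschitz) HLx HLp
  (coercive_bounded H H_coercive) (d%:R + 1) Hcor g L u ubar L0 gL
  (fun eps T eps0 T0 => let: And3 b _ _ := u_sol eps eps0 in b T T0)
  (fun eps eps0 => let: And3 _ (And3 _ s _) _ := u_sol eps eps0 in
     viscosity_jet_sub _ _ _ _ sV s)
  (fun eps eps0 => let: And3 _ (And3 _ _ s) _ := u_sol eps eps0 in
     viscosity_jet_super _ _ _ _ sV s)
  (fun eps x eps0 => let: And3 _ _ i := u_sol eps eps0 in etrans (i x) (u0_mean x))
  bb (viscosity_jet_sub _ _ _ _ sF bsub) (viscosity_jet_super _ _ _ _ sF bsup) bi T T0.
exists C; first exact: C0.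
move=> eps eps0; apply: ge_ereal_sup => _ [x _ [t tT <-]].
rewrite lee_fin; set s := eps `^ 3^-1.
have s0 : 0 < s by rewrite powR_gt0.
have -> : eps = s ^+ 3.
  by rewrite -powR_mulrn ?powR_ge0// -powRrM mulVf// powRr1// ltW.
exact: CP.
Qed.
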